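(* Let $p>3$ be a prime. If $p\equiv1\pmod3$ and $p=x^2+3y^2$ with $x,y\in\mathbb Z$, then $$\sum_{k=0}^{p-2}\frac{\binom{2k}k^2\binom{3k}k}{108^k(k+1)^2}\equiv8x^2-4p+\frac{9p^2}{8x^2}\pmod{p^3}.$$ If $p\equiv2\pmod3$, then $$\sum_{k=0}^{p-2}\frac{\binom{2k}k^2\binom{3k}k}{108^k(k+1)^2}\equiv-13\binom{(p-1)/2}{(p-5)/6}^2\Big(1+p\Big(2+\frac43q_p(2)-\frac32q_p(3)\Big)+p^2\Big(1+\frac83q_p(2)+\frac29q_p(2)^2-3q_p(3)-2q_p(2)q_p(3)+\frac{15}8q_p(3)^2+\frac34U_{p-3}\Big)\Big)-p^2\binom{(p-1)/2}{(p-5)/6}^{-2}\pmod{p^3}.$$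
   Context: Congruences modulo $p^3$ are between rational numbers whose denominators are not divisible by $p$. For $a$ not divisible by $p$, $q_p(a)=(a^{p-1}-1)/p$. The sequence $\{U_n\}$ is given by $U_{2n-1}=0$, $U_0=1$, $U_{2n}=-2\sum_{k=1}^n\binom{2n}{2k}U_{2n-2k}$ for $n=1,2,3,\ldots$. *)

(* Defs.v *)
From mathcomp Require Import all_boot all_order all_algebra.
Set Implicit Arguments. Unset Strict Implicit. Unset Printing Implicit Defensive.
Import Order.TTheory GRing.Theory Num.Theory.
Local Open Scope ring_scope.

(* [denq] is the denominator in lowest terms. *)
Definition p_integral (p : nat) (a : rat) : bool := ~~ (p%:Z %| denq a)%Z.

(* Congruence modulo p ^ n between rationals with denominators prime to p;
   the integrality of both sides is part of the relation. *)
Definition rat_congr (p n : nat) (a b : rat) : Prop :=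
  [/\ p_integral p a, p_integral p b &
      exists2 c : rat, p_integral p c & a - b = p%:R ^+ n * c].

Definition fermat_quotient (p : nat) (a : int) : rat :=
  (a%:~R ^+ (p - 1) - 1) / p%:R.

(* The list U_0, U_2, ..., U_{2n}. *)
Fixpoint U_even_seq (n : nat) : seq int :=
  if n is m.+1 then
    let s := U_even_seq m in
    rcons s (- 2 * \sum_(1 <= k < n.+1) 'C(2 * n, 2 * k)%:R * s`_(n - k))
  else [:: 1].

Definition U (n : nat) : int := if odd n then 0 else (U_even_seq n./2)`_(n./2).

Lemma size_U_even_seq n : size (U_even_seq n) = n.+1.
Proof. by elim: n => //= n IHn; rewrite size_rcons IHn. Qed.

Lemma nth_U_even_seq n i : (i <= n)%N -> (U_even_seq n)`_i = U (2 * i).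
Proof.
rewrite /U mul2n odd_double doubleK.
elim: n => [|n IHn]; first by rewrite leqn0 => /eqP ->.
rewrite leq_eqVlt => /orP [/eqP -> //|lt_in].
by rewrite /= nth_rcons size_U_even_seq lt_in IHn.
Qed.

Lemma U0 : U 0 = 1.
Proof. by []. Qed.

Lemma U_odd n : (0 < n)%N -> U (2 * n - 1) = 0.
Proof.
by case: n => // n _; rewrite /U mulnS add2n subn1 /= mul2n odd_double.
Qed.

Lemma U_even n : (0 < n)%N ->
  U (2 * n) = - 2 * \sum_(1 <= k < n.+1) 'C(2 * n, 2 * k)%:R * U (2 * n - 2 * k).
Proof.
case: n => // n _; rewrite -(@nth_U_even_seq n.+1) //.
rewrite [in LHS]/= nth_rcons size_U_even_seq ltnn eqxx; congr (_ * _).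
apply: eq_big_nat => k /andP [k_gt0 _].
by rewrite nth_U_even_seq -?mulnBr // leq_subLR -addn1 addnC leq_add2r.
Qed.

(* Main.v *)
(** By partial summation the sum S is, modulo p^3, equal to 2 F(-1/3) - 13 F(2/3),
    where F(n) is the sum over k < p of (1/2)_k (-n)_k (n+1)_k / k!^3.  Zeilberger's
    recurrence relates F(n+2) to F(n), with a boundary term divisible by p^3 for the
    n that occur, and F(-1-n) = F(n).  Since -1/3 = 2r - p/3 if p = 6r+1 and
    -2/3 = 2r+1 - p/3 if p = 6r+5, everything reduces to F(-p/3) and F(1-p/3), and
    the expansion of F(ps) modulo p^3 follows from harmonic sums and from
    F(-p) = F(p-1), a product.
    If p = 6r+5, harmonic numbers at p/3 and p/6 are expressed by Fermat quotients
    and U_{p-3}, through the umbral identity for (x+U)^n.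
    If p = 6r+1, the same expansion shows that F(-1/3) is the square of a Jacobi sum
    K of cubic times quadratic character with values in Z/p^3, computed by expanding
    the Teichmueller representative (1-t)^(p^2).  Its conjugate K' satisfies
    K K' = p, and K + K' is an integer t with t^2 = 4x^2, because
    t^2 + 3d^2 = 4p holds modulo p^3 and both sides are small. *)
From HB Require Import structures.
Require Import Defs.
From mathcomp Require Import all_boot all_order all_algebra all_fingroup all_solvable all_field.
From mathcomp Require Import ring lra zify.
Set Implicit Arguments. Unset Strict Implicit. Unset Printing Implicit Defensive.
Import Order.TTheory GRing.Theory Num.Theory.
Local Open Scope ring_scope.

(** * Congruences between p-integral rationals *)

(** The arguments -1/3 and 2/3 exchange roles with the residue of p modulo 3: one leads to F(-p/3),
    which is 1 modulo p, the other to F(1 - p/3), which is divisible by p^2. So -13 is the main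
    coefficient if p = 2 mod 3, whereas for p = 1 mod 3 it only meets a multiple of p^2/K^2. In that
    case the sum is 2K^2 + (13/2)p^2/K^2 while 4x^2 = (K + p/K)^2; since 13/2 = 2 + 9/2, this is
    8x^2 - 4p + 9p^2/(8x^2). The obstacle is to match K^2 with F(2r - p/3) to full precision p^3.
    Both are written as a power of one binomial coefficient times a series in p whose coefficients
    are polynomials in q_p(2) and in harmonic numbers at (p-1)/3; the latter are common to both
    sides and stay unevaluated. The hypergeometric side lives in the p-integral rationals, where
    identities are checked by [field]; the Jacobi sums live in Z/p^3, where Teichmueller
    representatives exist. An explicit integer combination of binomial coefficients has an image in
    both rings and joins them. *)

Definition pint (p : nat) : {pred rat} := fun a => coprime p `|denq a|.

Lemma pintE p a : (a \in pint p) = coprime p `|denq a|.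
Proof. by []. Qed.

Lemma pintP p a :
  reflect (exists n d : int, coprime p `|d| /\ a * d%:~R = n%:~R) (a \in pint p).
Proof.
rewrite pintE; apply: (iffP idP) => [co|[n [d [co e]]]].
  by exists (numq a), (denq a); rewrite numqE.
have : (denq a %| numq a * d)%Z.
  apply/dvdzP; exists n; apply: (@intr_inj rat).
  by rewrite !intrM numqE -e; ring.
rewrite Gauss_dvdzr; last by rewrite coprimezE coprime_sym coprime_num_den.
by rewrite dvdzE => /coprime_dvdr; apply.
Qed.

(** Coprimality of the denominator, rather than non-divisibility by p, makes this hold for every p,
    so the subring instance carries no primality hypothesis and the [rpred] lemmas apply at once. *)
Fact pint_subring p : subring_closed (pint p).
Proof.
split; first by rewrite pintE coprimen1.
- move=> a b /pintP [n [d [cd e]]] /pintP [n' [d' [cd' e']]].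
  apply/pintP; exists (n * d' - n' * d), (d * d'); split.
    by rewrite abszM coprimeMr cd cd'.
  by rewrite intrB !intrM -e -e'; ring.
- move=> a b /pintP [n [d [cd e]]] /pintP [n' [d' [cd' e']]].
  apply/pintP; exists (n * n'), (d * d'); split.
    by rewrite abszM coprimeMr cd cd'.
  by rewrite !intrM -e -e'; ring.
Qed.

HB.instance Definition _ p := GRing.isSubringClosed.Build rat (pint p) (pint_subring p).

Lemma pint_int p (n : int) : n%:~R \in pint p.
Proof. exact: rpred_int. Qed.

Lemma pint_nat p n : n%:R \in pint p.
Proof. exact: rpred_nat. Qed.

Lemma pint_inv_nat p n : coprime p n -> n%:R^-1 \in pint p.
Proof.
move=> co; case: (eqVneq n 0%N) => [->|n0]; first by rewrite invr0 rpred0.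
apply/pintP; exists 1, n%:Z; split=> //.
by rewrite mulVf // pnatr_eq0.
Qed.

Lemma pint_p_integral p a : prime p -> (a \in pint p) = p_integral p a.
Proof. by move=> pp; rewrite pintE /p_integral prime_coprime // dvdzE. Qed.

(* Unlike [rat_congr], this does not require a and b to be p-integral, so that
   equal rationals are congruent without side condition. *)
Definition cg (p k : nat) (a b : rat) : Prop :=
  exists2 c, c \in pint p & a = b + p%:R ^+ k * c.

Definition punit (p : nat) (a : rat) : bool :=
  [&& a != 0, a \in pint p & a^-1 \in pint p].

Record prime_gt3 := PrimeGt3 {
  pval :> nat; pval_prime : prime pval; pval_gt3 : (3 < pval)%N }.

Section Congruences.

Variable p : prime_gt3.
Local Notation p_pr := (pval_prime p).
Local Notation P := (p%:R : rat).
Local Notation Z_ := (pint p).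
Local Notation "a ==[ k ] b" := (cg p k a b) (at level 70).

Lemma P_neq0 : P != 0.
Proof. by rewrite pnatr_eq0 -lt0n prime_gt0 ?p_pr. Qed.

Lemma cgP k a b : a ==[k] b <-> exists2 c, c \in Z_ & a = b + P ^+ k * c.
Proof. by []. Qed.

Lemma cg_refl k a : a ==[k] a.
Proof. by exists 0; rewrite ?rpred0 // mulr0 addr0. Qed.

Lemma eq_cg k a b : a = b -> a ==[k] b.
Proof. by move=> ->; exact: cg_refl. Qed.

Lemma eq_cg2 k a b c d : a ==[k] b -> a = c -> b = d -> c ==[k] d.
Proof. by move=> + <- <-. Qed.

Lemma cg_sym k a b : a ==[k] b -> b ==[k] a.
Proof. by move=> [c cZ ->]; exists (- c); rewrite ?rpredN //; ring. Qed.

Lemma cg_trans k b a c : a ==[k] b -> b ==[k] c -> a ==[k] c.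
Proof.
by move=> [e eZ ->] [f fZ ->]; exists (f + e); rewrite ?rpredD //; ring.
Qed.

Lemma cgW l k a b : (k <= l)%N -> a ==[l] b -> a ==[k] b.
Proof.
move=> kl /cgP [c cZ ->]; apply/cgP; exists (P ^+ (l - k) * c).
  by rewrite rpredM ?rpredX ?pint_nat.
by rewrite mulrA -exprD subnKC.
Qed.

Lemma cgN k a b : a ==[k] b -> - a ==[k] - b.
Proof. by move=> [c cZ ->]; exists (- c); rewrite ?rpredN //; ring. Qed.

Lemma cgD k a b c d : a ==[k] b -> c ==[k] d -> a + c ==[k] b + d.
Proof.
by move=> [e eZ ->] [f fZ ->]; exists (e + f); rewrite ?rpredD //; ring.
Qed.

Lemma cgB k a b c d : a ==[k] b -> c ==[k] d -> a - c ==[k] b - d.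
Proof. by move=> H1 /cgN; exact: cgD. Qed.

Lemma cgM k a b c d : b \in Z_ -> d \in Z_ ->
  a ==[k] b -> c ==[k] d -> a * c ==[k] b * d.
Proof.
move=> bZ dZ /cgP [e eZ ->] /cgP [f fZ ->].
apply/cgP; exists (e * d + b * f + P ^+ k * (e * f)); last by ring.
by rewrite !(rpredD, rpredM) ?rpredX ?pint_nat.
Qed.

Lemma cg_pint k a b : a ==[k] b -> (a \in Z_) = (b \in Z_).
Proof.
have H c d : c ==[k] d -> d \in Z_ -> c \in Z_.
  by move=> /cgP [e eZ ->] dZ; rewrite rpredD ?rpredM ?rpredX ?pint_nat.
by move=> h; apply/idP/idP; apply: H => //; exact: cg_sym.
Qed.

Lemma cgMl k c a b : c \in Z_ -> a ==[k] b -> c * a ==[k] c * b.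
Proof.
by move=> cZ /cgP [e eZ ->]; apply/cgP; exists (c * e); rewrite ?rpredM //; ring.
Qed.

Lemma cgMr k c a b : c \in Z_ -> a ==[k] b -> a * c ==[k] b * c.
Proof. by rewrite -!(mulrC c); exact: cgMl. Qed.

Lemma cgMp j k a b : a ==[k] b -> P ^+ j * a ==[j + k] P ^+ j * b.
Proof.
by move=> /cgP [e eZ ->]; apply/cgP; exists e => //; rewrite exprD; ring.
Qed.

Lemma cgX k n a b : b \in Z_ -> a ==[k] b -> a ^+ n ==[k] b ^+ n.
Proof.
move=> bZ h; have aZ : a \in Z_ by rewrite (cg_pint h).
elim: n => [|n IH]; first exact: cg_refl.
by rewrite !exprS; apply: cgM => //; rewrite rpredX.
Qed.

Lemma cg_sum k (I : Type) (s : seq I) (Q : pred I) (f g : I -> rat) :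
  (forall i, Q i -> f i ==[k] g i) ->
  \sum_(i <- s | Q i) f i ==[k] \sum_(i <- s | Q i) g i.
Proof.
by move=> H; elim/big_rec2: _ => [|i a b Qi h]; [exact: cg_refl | exact: cgD (H i Qi) h].
Qed.

Lemma cg_prod k (I : Type) (s : seq I) (Q : pred I) (f g : I -> rat) :
  (forall i, Q i -> g i \in Z_) ->
  (forall i, Q i -> f i ==[k] g i) ->
  \prod_(i <- s | Q i) f i ==[k] \prod_(i <- s | Q i) g i.
Proof.
move=> gZ H; suff: (\prod_(i <- s | Q i) f i ==[k] \prod_(i <- s | Q i) g i)
  /\ (\prod_(i <- s | Q i) g i \in Z_) by case.
elim/big_rec2: _ => [|i a b Qi [h bZ]]; first by rewrite rpred1; split=> //; exact: cg_refl.
have gi := gZ i Qi.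
by split; [apply: cgM => //; apply: H|rewrite rpredM].
Qed.

Lemma cg_sum_nat k m n (f g : nat -> rat) :
  (forall i, (m <= i < n)%N -> f i ==[k] g i) ->
  \sum_(m <= i < n) f i ==[k] \sum_(m <= i < n) g i.
Proof. by move=> H; rewrite big_nat [X in cg _ _ _ X]big_nat; exact: cg_sum. Qed.

Lemma cg_prod_nat k m n (f g : nat -> rat) :
  (forall i, (m <= i < n)%N -> g i \in Z_) ->
  (forall i, (m <= i < n)%N -> f i ==[k] g i) ->
  \prod_(m <= i < n) f i ==[k] \prod_(m <= i < n) g i.
Proof. by move=> gZ H; rewrite big_nat [X in cg _ _ _ X]big_nat; exact: cg_prod. Qed.

Lemma pint_sum_nat m n (f : nat -> rat) :
  (forall i, (m <= i < n)%N -> f i \in Z_) -> \sum_(m <= i < n) f i \in Z_.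
Proof. by move=> H; rewrite big_nat; apply: rpred_sum. Qed.

Lemma pint_prod_nat m n (f : nat -> rat) :
  (forall i, (m <= i < n)%N -> f i \in Z_) -> \prod_(m <= i < n) f i \in Z_.
Proof. by move=> H; rewrite big_nat; apply: rpred_prod. Qed.

Lemma cg_small k j c : (k <= j)%N -> c \in Z_ -> P ^+ j * c ==[k] 0.
Proof.
move=> kj cZ; apply: (cgW kj); apply/cgP; exists c => //; by rewrite add0r.
Qed.

Lemma punit_pint a : punit p a -> a \in Z_. Proof. by case/and3P. Qed.
Lemma punitV_pint a : punit p a -> a^-1 \in Z_. Proof. by case/and3P. Qed.
Lemma punit_neq0 a : punit p a -> a != 0. Proof. by case/and3P. Qed.

Lemma punit_nat n : coprime p n -> (0 < n)%N -> punit p n%:R.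
Proof.
by move=> co n0; rewrite /punit pnatr_eq0 -lt0n n0 pint_nat pint_inv_nat.
Qed.

Lemma punit_small n : (0 < n < p)%N -> punit p n%:R.
Proof.
case/andP=> n0 np; apply: punit_nat => //.
by rewrite prime_coprime ?p_pr // gtnNdvd.
Qed.

Lemma punitM a b : punit p a -> punit p b -> punit p (a * b).
Proof.
move=> /and3P [a0 aZ aV] /and3P [b0 bZ bV].
by rewrite /punit mulf_neq0 // rpredM //= invfM rpredM.
Qed.

Lemma punitV a : punit p a -> punit p a^-1.
Proof. by move=> /and3P [a0 aZ aV]; rewrite /punit invr_eq0 a0 aV invrK. Qed.

Lemma punitN a : punit p a -> punit p (- a).
Proof. by move=> /and3P [a0 aZ aV]; rewrite /punit oppr_eq0 a0 invrN !rpredN aZ aV. Qed.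

Lemma punit_pintE a : a \in Z_ -> a != 0 -> punit p a \/ a ==[1] 0.
Proof.
move=> /pintP [n [d [cd e]]] a0.
have d0 : d != 0 by apply: contraTneq cd => ->; rewrite /coprime gcdn0 gtn_eqF ?prime_gt1 ?p_pr.
have dQ : d%:~R != 0 :> rat by rewrite intr_eq0.
have ae : a = n%:~R / d%:~R by rewrite -e mulfK.
have n0 : n != 0 by apply: contraNneq a0 => n0; rewrite ae n0 mul0r.
have [co|] := boolP (coprime p `|n|).
  left; rewrite /punit a0 /=; apply/andP; split; apply/pintP.
    by exists n, d; split.
  by exists d, n; split => //; rewrite ae invf_div mulfVK // intr_eq0.
rewrite prime_coprime ?p_pr // negbK => H; right.
have : (p%:Z %| n)%Z by rewrite dvdzE.
case/dvdzP=> q qe; apply/cgP; exists (q%:~R / d%:~R); last first.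
  by rewrite ae qe add0r expr1 intrM; field.
by apply/pintP; exists q, d; split=> //; rewrite mulfVK.
Qed.

Lemma ncg01 : ~ 1 ==[1] 0.
Proof.
move=> [c cZ]; rewrite add0r expr1 => e1; move: cZ => /pintP [n [d [cd e]]].
have : d = p%:Z * n.
  by apply: (@intr_inj rat); rewrite intrM -e mulrA -e1 mul1r.
move=> dE; move: cd; rewrite dE abszM /= coprimeMr prime_coprime ?p_pr // dvdnn.
by [].
Qed.

Lemma punit_ncg a : punit p a -> ~ a ==[1] 0.
Proof.
move=> /and3P [a0 aZ aV] /(cgMl aV); rewrite mulVf // mulr0; exact: ncg01.
Qed.

Lemma punit_cg a b : a ==[1] b -> punit p b -> punit p a.
Proof.
move=> ab bu; have aZ : a \in Z_ by rewrite (cg_pint ab) punit_pint.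
have na : ~ a ==[1] 0.
  by move=> a0; apply: (punit_ncg bu); exact: cg_trans (cg_sym ab) a0.
have a0 : a != 0 by apply/eqP => a0; apply: na; rewrite a0; exact: cg_refl.
by case: (punit_pintE aZ a0).
Qed.

Lemma cgV k a b : punit p a -> punit p b -> a ==[k] b -> a^-1 ==[k] b^-1.
Proof.
move=> au bu /(cgMl (punitV_pint au)) /(cgMr (punitV_pint bu)).
rewrite mulVf ?punit_neq0 // mul1r mulfK ?punit_neq0 //; exact: cg_sym.
Qed.

Lemma cg_cancel k c a b : punit p c -> c * a ==[k] c * b -> a ==[k] b.
Proof.
by move=> cu /(cgMl (punitV_pint cu)); rewrite !mulKf ?punit_neq0.
Qed.

End Congruences.

(** Proves membership in the p-integral rationals. The only numerical inverses it accepts are those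
    of divisors of 6^4, by means of a hypothesis [coprime p (6 ^ 4)] in the context; this covers all
    constants in the expansions below. *)
Ltac zp := repeat match goal with
  | h : is_true (in_mem ?a _) |- is_true (in_mem ?a _) => exact h
  | |- is_true (in_mem (_ + _) _) => apply: rpredD
  | |- is_true (in_mem (- _) _) => rewrite rpredN
  | |- is_true (in_mem (_ * _) _) => apply: rpredM
  | |- is_true (in_mem (_ ^+ _) _) => apply: rpredX
  | |- is_true (in_mem 1 _) => apply: rpred1
  | |- is_true (in_mem 0 _) => apply: rpred0
  | co : is_true (coprime _ (6 ^ 4)) |- is_true (in_mem (_ %:R^-1) _) =>
      apply: pint_inv_nat; apply: (coprime_dvdr _ co); vm_compute; reflexivity
  | |- is_true (in_mem (_ %:R) _) => apply: pint_nat
  | |- is_true (in_mem (_ %:~R) _) => apply: pint_int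
  end.

(* Expansion modulo p^3 in powers of p. *)
Definition ser (p : nat) (a a0 a1 a2 : rat) : Prop :=
  [/\ a0 \in pint p, a1 \in pint p, a2 \in pint p &
      cg p 3 a (a0 + p%:R * a1 + p%:R ^+ 2 * a2)].

(** * Arithmetic of expansions modulo p^3 *)

Section Series.

Variable p : prime_gt3.
Local Notation p_pr := (pval_prime p).
Local Notation p_gt3 := (pval_gt3 p).
Local Notation P := (p%:R : rat).
Local Notation Z_ := (pint p).
Local Notation "a ==[ k ] b" := (cg p k a b) (at level 70).
Local Notation ser := (ser p).

Lemma coprime_p6 : coprime p (6 ^ 4).
Proof.
have p3 := p_gt3; have p2 := ltnW p3.
apply: coprimeXr; rewrite -[6%N]/(2 * 3)%N coprimeMr !prime_coprime ?p_pr //.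
by rewrite !gtnNdvd.
Qed.
Let co6 := coprime_p6.

Lemma ser_pint a a0 a1 a2 : ser a a0 a1 a2 -> a \in Z_.
Proof. by case=> z0 z1 z2 e; rewrite (cg_pint e); zp. Qed.

Lemma ser_cg a b a0 a1 a2 : ser a a0 a1 a2 -> ser b a0 a1 a2 -> a ==[3] b.
Proof. by move=> [_ _ _ h] [_ _ _ h']; exact: (cg_trans h (cg_sym h')). Qed.

Lemma cg_ser a b b0 b1 b2 : a ==[3] b -> ser b b0 b1 b2 -> ser a b0 b1 b2.
Proof. by move=> h [? ? ? h']; split=> //; exact: (cg_trans h h'). Qed.

Lemma ser_eq a a0 a1 a2 b b0 b1 b2 : ser b b0 b1 b2 ->
  a = b -> a0 = b0 -> a1 = b1 -> a2 = b2 -> ser a a0 a1 a2.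
Proof. by move=> ? -> -> -> ->. Qed.

Lemma ser_exact a0 a1 a2 : a0 \in Z_ -> a1 \in Z_ -> a2 \in Z_ ->
  ser (a0 + P * a1 + P ^+ 2 * a2) a0 a1 a2.
Proof. by move=> *; split=> //; exact: cg_refl. Qed.

Lemma ser_lin a0 a1 : a0 \in Z_ -> a1 \in Z_ -> ser (a0 + P * a1) a0 a1 0.
Proof.
move=> h0 h1; have := ser_exact h0 h1 (rpred0 Z_) => /ser_eq; apply=> //.
by rewrite mulr0 addr0.
Qed.

Lemma ser_const a0 : a0 \in Z_ -> ser a0 a0 0 0.
Proof.
move=> h0; have := ser_lin h0 (rpred0 Z_) => /ser_eq; apply=> //.
by rewrite mulr0 addr0.
Qed.

Lemma serD a b a0 a1 a2 b0 b1 b2 : ser a a0 a1 a2 -> ser b b0 b1 b2 ->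
  ser (a + b) (a0 + b0) (a1 + b1) (a2 + b2).
Proof.
move=> [? ? ? h] [? ? ? h']; split; zp.
apply: (cg_trans (cgD h h')); apply: eq_cg; ring.
Qed.

Lemma serN a a0 a1 a2 : ser a a0 a1 a2 -> ser (- a) (- a0) (- a1) (- a2).
Proof.
by move=> [? ? ? h]; split; zp; apply: (cg_trans (cgN h)); apply: eq_cg; ring.
Qed.

Lemma serM a b a0 a1 a2 b0 b1 b2 : ser a a0 a1 a2 -> ser b b0 b1 b2 ->
  ser (a * b) (a0 * b0) (a0 * b1 + a1 * b0) (a0 * b2 + a1 * b1 + a2 * b0).
Proof.
move=> [? ? ? h] [? ? ? h']; split; zp.
apply: (cg_trans (cgM _ _ h h')); zp.
apply/cgP; exists (a1 * b2 + a2 * b1 + P * (a2 * b2)); zp.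
by ring.
Qed.

Lemma ser_unit a a0 a1 a2 : ser a a0 a1 a2 -> punit p a0 -> punit p a.
Proof.
move=> [? ? ? h] u; apply: (punit_cg _ u).
apply: (cg_trans (cgW (isT : 1 <= 3)%N h)).
by apply/cgP; exists (a1 + P * a2); zp; ring.
Qed.

Lemma serV a a0 a1 a2 : punit p a0 -> ser a a0 a1 a2 ->
  ser a^-1 a0^-1 (- a1 / a0 ^+ 2) (a1 ^+ 2 / a0 ^+ 3 - a2 / a0 ^+ 2).
Proof.
move=> u s; have au := ser_unit s u.
have vZ := punitV_pint u; have u0 := punit_neq0 u; have w0 := punit_neq0 au.
case: (s) => ? ? ? h.
set b1 := (- a1 / _); set b2 := (_ - a2 / _).
have ? : b1 \in Z_ by rewrite /b1 -exprVn; zp.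
have ? : b2 \in Z_ by rewrite /b2 -!exprVn; zp.
split=> //; apply: (cg_cancel au); rewrite divff //.
have s' := serM s (ser_exact vZ (_ : b1 \in Z_) (_ : b2 \in Z_)).
case: (s' _ _) => // _ _ _ h'; apply: cg_sym; apply: (cg_trans h').
apply: eq_cg; rewrite /b1 /b2; field; exact: u0.
Qed.

(** Coefficients are not unique: a multiple of p in the coefficient of p carries over to the
    coefficient of p^2. This is how harmonic numbers known modulo p^2 are inserted. *)
Lemma ser_cg1 a a0 a1 a2 b1 e : ser a a0 a1 a2 -> b1 \in Z_ -> e \in Z_ ->
  a1 ==[2] b1 + P * e -> ser a a0 b1 (a2 + e).
Proof.
move=> [? ? ? h] ? ? h1; split; zp; apply: (cg_trans h).
have := cgMp 1 h1 => h2.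
have -> : a0 + P * b1 + P ^+ 2 * (a2 + e) = a0 + P ^+ 1 * (b1 + P * e) + P ^+ 2 * a2.
  by ring.
by rewrite -[P in P * a1]expr1; apply: cgD; [apply: cgD => //; exact: cg_refl|exact: cg_refl].
Qed.

Lemma ser_cg2 a a0 a1 a2 b2 : ser a a0 a1 a2 -> b2 \in Z_ ->
  a2 ==[1] b2 -> ser a a0 a1 b2.
Proof.
move=> [? ? ? h] ? h1; split; zp; apply: (cg_trans h).
by apply: cgD; [exact: cg_refl|exact: (cgMp 2 h1)].
Qed.

Lemma cg_divP k a b : P * a ==[k.+1] P * b -> a ==[k] b.
Proof.
move=> /cgP [e eZ h]; apply/cgP; exists e => //.
by apply: (mulfI (P_neq0 p)); rewrite h exprS; ring.
Qed.

(** Once the constant terms agree, only a1 + p a2 modulo p^2 is determined. Two expansions of one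
    number thus give a congruence modulo p^2 between their coefficients. *)
Lemma ser_inj a a0 a1 a2 b1 b2 : ser a a0 a1 a2 -> ser a a0 b1 b2 ->
  a1 + P * a2 ==[2] b1 + P * b2.
Proof.
move=> s s'; case: (serD s (serN s')) => _ _ _; rewrite !subrr => /cg_sym h.
apply: cg_divP; have := cgD h (cg_refl p 3 (P * b1 + P ^+ 2 * b2)).
by rewrite add0r => /eq_cg2; apply; ring.
Qed.

(** The coefficients are the first two elementary symmetric functions of the c x_i; the second is
    expressed by power sums through Newton's identity 2 e_2 = e_1^2 - p_2. *)
Lemma ser_prod (x : nat -> rat) m n c :
  c \in Z_ -> (forall i, (m <= i < n)%N -> x i \in Z_) ->
  ser (\prod_(m <= i < n) (1 + P * (c * x i))) 1 (c * \sum_(m <= i < n) x i)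
    (c ^+ 2 * ((\sum_(m <= i < n) x i) ^+ 2 - \sum_(m <= i < n) x i ^+ 2) / 2%:R).
Proof.
move=> cZ; elim: n => [|n IH] xZ.
  by rewrite !big_geq //; apply: (ser_eq (ser_const (rpred1 Z_))) => //; ring.
have [mn|mn] := leqP m n; last first.
  by rewrite !big_geq //; apply: (ser_eq (ser_const (rpred1 Z_))) => //; ring.
have xn : x n \in Z_ by rewrite xZ ?mn /=.
have {}IH := IH (fun i h => xZ i (introT andP (conj (andP h).1 (ltnW (andP h).2)))).
rewrite !big_nat_recr //=; have l : ser (1 + P * (c * x n)) 1 (c * x n) 0.
  by apply: ser_lin; zp.
by apply: (ser_eq (serM IH l)) => //; field.
Qed.

End Series.

(** * Harmonic sums *)

(* An odd j = 2 h + 1 - 2 i is indexed by i, which will allow the reduction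
   of 1 / j modulo p = 2 h + 1 to a harmonic term in i. *)
Lemma sum_even_odd (f : nat -> rat) h n : (n <= 2 * h)%N ->
  \sum_(1 <= i < n.+1) f i = \sum_(1 <= i < n./2.+1) f (2 * i)%N +
     \sum_((h - uphalf n).+1 <= i < h.+1) f (2 * h + 1 - 2 * i)%N.
Proof.
elim: n => [|n IH] nh; first by rewrite !big_geq ?subn0 ?addr0.
rewrite big_nat_recr //= IH ?(ltnW nh) //.
have [on|en] := boolP (odd n).
  have -> : uphalf n = n./2.+1 by rewrite uphalf_half on.
  have ne : (2 * n./2.+1)%N = n.+1 by lia.
  rewrite [in RHS]big_nat_recr //= ne -!addrA; congr (_ + _).
  by rewrite addrC.
have -> : uphalf n = n./2 by rewrite uphalf_half (negbTE en).
have lt : (n./2 < h)%N by lia.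
rewrite -addrA; congr (_ + _).
rewrite [RHS]big_ltn; last by lia.
have -> : (h - n./2.+1).+1 = (h - n./2)%N by lia.
rewrite addrC; congr (f _ + _); lia.
Qed.

Lemma sum_nat_reflect (f : nat -> rat) n :
  \sum_(1 <= i < n) f i = \sum_(1 <= i < n) f (n - i)%N.
Proof. by rewrite big_nat_rev /=; apply: eq_big_nat => i; rewrite add1n subSS. Qed.

Lemma sum_nat_cat n (f : nat -> rat) m q : (m <= n <= q)%N ->
  \sum_(m <= i < q) f i = \sum_(m <= i < n) f i + \sum_(n <= i < q) f i.
Proof. by case/andP=> mn nq; rewrite (big_cat_nat mn nq). Qed.

Lemma prod_rising_fact m n : \prod_(1 <= i < n.+1) (m + i)%:R * m`!%:R = (m + n)`!%:R :> rat.
Proof.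
elim: n => [|n IH]; first by rewrite big_geq // mul1r addn0.
by rewrite big_nat_recr //= mulrAC IH addnS factS natrM mulrC.
Qed.

Lemma prod_odd_fact n : \prod_(1 <= i < n.+1) (2 * i - 1)%:R * (2 ^+ n * n`!%:R) = (2 * n)`!%:R :> rat.
Proof.
elim: n => [|n IH]; first by rewrite big_geq // muln0 fact0; ring.
rewrite big_nat_recr //=; have -> : (2 * n.+1 = (2 * n).+2)%N by lia.
rewrite !factS !natrM -IH (_ : (2 * n).+2 = 2 * n.+1)%N ?natrM; last by lia.
rewrite (_ : (2 * n.+1 - 1 = (2 * n).+1)%N) ?exprS; last by lia.
by ring.
Qed.

(** For p = 2h + 1 the factor is 2(h+i)/(2i-1), and (2h)!/h! is 2^h times the product of the odd
    numbers. So 2^(p-1) is exactly a product of factors near 1, which links the Fermat quotient of 2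
    to harmonic numbers. *)
Lemma prod_odd_shift h :
  \prod_(1 <= i < h.+1) (1 + (2 * h + 1)%:R * (2 * i - 1)%:R^-1) = 2 ^+ (h + h) :> rat.
Proof.
have -> : \prod_(1 <= i < h.+1) (1 + (2 * h + 1)%:R * (2 * i - 1)%:R^-1) =
   \prod_(1 <= i < h.+1) (2 * (h + i)%:R / (2 * i - 1)%:R) :> rat.
  apply: eq_big_nat => i hi.
  have : (2 * i - 1)%:R != 0 :> rat by rewrite pnatr_eq0; lia.
  rewrite natrB ?natrM; last by lia.
  by rewrite (natrD _ (2 * h)) natrM natrD => nz; field.
rewrite big_split prodfV big_split /= prodr_const_nat subSS subn0.
have f0 n : n`!%:R != 0 :> rat by rewrite pnatr_eq0 -lt0n fact_gt0.
have := prod_rising_fact h h; have := prod_odd_fact h.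
rewrite addnn -mul2n => <- e.
have o0 : \prod_(1 <= i < h.+1) (2 * i - 1)%:R != 0 :> rat.
  rewrite prodf_seq_neq0; apply/allP => i; rewrite mem_index_iota /= pnatr_eq0; lia.
set A := \prod_(1 <= i < h.+1) (h + i)%:R in e *.
set B := \prod_(1 <= i < h.+1) (2 * i - 1)%:R in e o0 *.
have -> : A = B * 2 ^+ h by apply: (mulIf (f0 h)); rewrite e; ring.
by rewrite mul2n -addnn exprD; field.
Qed.

Definition harm (k n : nat) : rat := \sum_(1 <= i < n.+1) i%:R^-1 ^+ k.

Lemma harm0 k : harm k 0 = 0.
Proof. by rewrite /harm big_geq. Qed.

Section Harmonic.

Variable p : prime_gt3.
Local Notation p_pr := (pval_prime p).
Local Notation p_gt3 := (pval_gt3 p).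
Local Notation P := (p%:R : rat).
Local Notation Z_ := (pint p).
Local Notation "a ==[ k ] b" := (cg p k a b) (at level 70).
Let co6 := coprime_p6 p.

Lemma pint_inv_small n : (0 < n < p)%N -> n%:R^-1 \in Z_.
Proof. by move=> h; apply: punitV_pint; exact: punit_small. Qed.

Lemma pint_harm k n : (n < p)%N -> harm k n \in Z_.
Proof.
move=> np; apply: pint_sum_nat => i hi; apply: rpredX.
by apply: pint_inv_small; lia.
Qed.

Lemma inv_reflect a : (0 < a < p)%N ->
  (p - a)%:R^-1 ==[2] - (a%:R^-1 + P * a%:R^-1 ^+ 2).
Proof.
move=> ha; have hb : (0 < p - a < p)%N by lia.
have za := pint_inv_small ha; have zb := pint_inv_small hb.
have := punit_neq0 (punit_small ha); have := punit_neq0 (punit_small hb).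
rewrite natrB ?(ltnW (andP ha).2) // => nb na.
apply/cgP; exists (a%:R^-1 ^+ 2 * (p - a)%:R^-1); zp.
rewrite natrB ?(ltnW (andP ha).2) //; field; by rewrite nb na.
Qed.

Lemma inv_reflect1 a : (0 < a < p)%N -> (p - a)%:R^-1 ==[1] - a%:R^-1.
Proof.
move=> ha; have za := pint_inv_small ha.
apply: cg_trans (cgW (isT : 1 <= 2)%N (inv_reflect ha)) _.
by apply/cgP; exists (- a%:R^-1 ^+ 2); zp; ring.
Qed.

Lemma inv_sqr_reflect a : (0 < a < p)%N -> (p - a)%:R^-1 ^+ 2 ==[1] a%:R^-1 ^+ 2.
Proof.
move=> ha; have za := pint_inv_small ha.
by rewrite -[X in _ ==[_] X]sqrrN; apply: cgX; zp; exact: inv_reflect1.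
Qed.

Section Half.

Variables (h : nat) (pE : p = (2 * h + 1)%N :> nat).

Let two_cancel k a : 2 * a ==[k] 0 -> a ==[k] 0.
Proof.
move=> H; apply: (@cg_cancel p k 2); last by rewrite mulr0.
by apply: punit_small; rewrite (ltn_trans _ p_gt3).
Qed.

Let P_double a : (0 < a)%N -> (2 * a)%:R^-1 = a%:R^-1 / 2 :> rat.
Proof. by move=> a0; rewrite natrM invfM mulrC. Qed.

Lemma harm2_even_odd n : (n <= 2 * h)%N ->
  harm 2 n ==[1] harm 2 n./2 / 4 + (harm 2 h - harm 2 (h - uphalf n)) / 4.
Proof.
move=> nh; rewrite /harm (sum_even_odd _ nh) -pE.
have -> : \sum_(1 <= i < h.+1) i%:R^-1 ^+ 2 - \sum_(1 <= i < (h - uphalf n).+1) i%:R^-1 ^+ 2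
   = \sum_((h - uphalf n).+1 <= i < h.+1) i%:R^-1 ^+ 2 :> rat.
  by rewrite (@sum_nat_cat (h - uphalf n).+1 _ 1 h.+1) /= ?ltnS ?leq_subr // addrC addKr.
apply: cgD; rewrite mulr_suml.
  apply: eq_cg; apply: eq_big_nat => i hi; rewrite P_double; last by case/andP: hi.
  by field; rewrite pnatr_eq0; lia.
apply: cg_sum_nat => i hi.
have h1 : (0 < 2 * i < p)%N by lia.
have z1 : i%:R^-1 \in Z_ by apply: pint_inv_small; lia.
apply: cg_trans (inv_sqr_reflect h1) _.
by apply: eq_cg; rewrite P_double; [field; rewrite pnatr_eq0; lia | lia].
Qed.

Lemma harm1_even_odd n : (n <= 2 * h)%N ->
  harm 1 n ==[2] harm 1 n./2 / 2 - (harm 1 h - harm 1 (h - uphalf n)) / 2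
                 - P * (harm 2 h - harm 2 (h - uphalf n)) / 4.
Proof.
move=> nh; rewrite /harm (sum_even_odd _ nh) -pE.
have E k : \sum_(1 <= i < h.+1) i%:R^-1 ^+ k - \sum_(1 <= i < (h - uphalf n).+1) i%:R^-1 ^+ k
   = \sum_((h - uphalf n).+1 <= i < h.+1) i%:R^-1 ^+ k :> rat.
  by rewrite (@sum_nat_cat (h - uphalf n).+1 _ 1 h.+1) /= ?ltnS ?leq_subr // addrC addKr.
rewrite !E -addrA; apply: cgD.
  rewrite mulr_suml; apply: eq_cg; apply: eq_big_nat => i hi; rewrite !expr1 P_double //.
  by case/andP: hi.
rewrite -opprD mulr_sumr !mulr_suml -big_split /= -sumrN.
apply: cg_sum_nat => i hi.
have h1 : (0 < 2 * i < p)%N by lia.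
have z1 : i%:R^-1 \in Z_ by apply: pint_inv_small; lia.
rewrite expr1; apply: cg_trans (inv_reflect h1) _.
by apply: eq_cg; rewrite P_double; [field; rewrite pnatr_eq0; lia | lia].
Qed.

(** Two evaluations of [harm 2 (2 * h)]: splitting by parity gives half of [harm 2 h], reflecting i
    to p - i gives twice [harm 2 h]. Comparison leaves 3 [harm 2 h], and 3 is a unit. *)
Lemma harm2_half : harm 2 h ==[1] 0.
Proof.
have p3 := p_gt3.
have zh : harm 2 h \in Z_ by apply: pint_harm; lia.
have := harm2_even_odd (leqnn (2 * h)).
have -> : (2 * h)./2 = h by lia.
have -> : (h - uphalf (2 * h))%N = 0%N by lia.
rewrite harm0 subr0 => H1.
have H2 : harm 2 (2 * h) ==[1] 2 * harm 2 h.
  rewrite /harm (@sum_nat_cat h.+1) //=; last by lia.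
  rewrite mulrC mulr_natr mulr2n; apply: cgD; first exact: cg_refl.
  rewrite -[h.+1]add1n big_addn.
  have -> : ((2 * h).+1 - h)%N = h.+1 by lia.
  rewrite sum_nat_reflect; apply: cg_sum_nat => i hi.
  have -> : (h.+1 - i + h = p - i)%N by lia.
  by apply: inv_sqr_reflect; lia.
have := cg_trans (cg_sym H2) H1 => /(@cgMl p 1 2 _ _ (pint_nat _ _)) H3.
apply: (@cg_cancel p 1 3); first by apply: punit_small; lia.
have := cgB H3 (cg_refl p 1 (harm 2 h)); rewrite mulr0.
have -> : 2 * (2 * harm 2 h) - harm 2 h = 3 * harm 2 h by ring.
by have -> : 2 * (harm 2 h / 4 + harm 2 h / 4) - harm 2 h = 0 by field.
Qed.

Lemma harm2_full : harm 2 (p - 1) ==[1] 0.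
Proof.
have -> : (p - 1 = 2 * h)%N by lia.
have := harm2_even_odd (leqnn (2 * h)).
have -> : (2 * h)./2 = h by lia.
have -> : (h - uphalf (2 * h))%N = 0%N by lia.
rewrite harm0 subr0 => H1.
apply: cg_trans H1 _.
have -> : harm 2 h / 4 + harm 2 h / 4 = 2%:R^-1 * harm 2 h by field.
by rewrite -(mulr0 2%:R^-1); apply: cgMl; zp; exact: harm2_half.
Qed.

(** Wolstenholme's congruence: pairing i with p - i shows that twice the sum is -p [harm 2 (p - 1)],
    where [harm 2 (p - 1)] vanishes modulo p. *)
Lemma harm1_full : harm 1 (p - 1) ==[2] 0.
Proof.
have pp : (p - 1).+1 = p by have := p_gt3; lia.
apply: two_cancel.
have E : P * harm 2 (p - 1) ==[2] 0.
  by have := cgMp 1 harm2_full; rewrite expr1 mulr0.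
rewrite mulrC mulr_natr mulr2n.
rewrite {2}/harm sum_nat_reflect pp.
have H : \sum_(1 <= i < p) (p - i)%:R^-1 ^+ 1 ==[2]
   \sum_(1 <= i < p) - (i%:R^-1 + P * i%:R^-1 ^+ 2).
  by apply: cg_sum_nat => i hi; rewrite expr1; exact: inv_reflect.
have := cgD (cg_refl p 2 (harm 1 (p - 1))) H => /cg_trans; apply.
have -> : \sum_(1 <= i < p) - (i%:R^-1 + P * i%:R^-1 ^+ 2)
   = - harm 1 (p - 1) - P * harm 2 (p - 1).
  by rewrite sumrN big_split /= -mulr_sumr /harm pp opprD.
by rewrite addrA subrr add0r -oppr0; exact: cgN.
Qed.

Let q2 := fermat_quotient p 2.

Lemma pow_fermat_quotient (a : nat) : a%:R ^+ (p - 1) = 1 + P * fermat_quotient p a.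
Proof. by rewrite /fermat_quotient mulrC divfK ?P_neq0 //; ring. Qed.

Let sum_odd k : \sum_(1 <= i < h.+1) (2 * i - 1)%:R^-1 ^+ k = harm k (p - 1) - \sum_(1 <= i < h.+1) (2 * i)%:R^-1 ^+ k.
Proof.
have -> : (p - 1 = 2 * h)%N by lia.
rewrite /harm (sum_even_odd _ (leqnn _)).
have -> : (2 * h)./2 = h by lia.
have -> : (h - uphalf (2 * h))%N = 0%N by lia.
rewrite addrC addKr sum_nat_reflect; apply: eq_big_nat => i hi.
by congr (_%:R^-1 ^+ _); lia.
Qed.

(** Expands [prod_odd_shift]. Sums over odd indices are full sums minus even ones; the full sums
    vanish to the required order, and so does [harm 2 h]. *)
Lemma ser_pow2 : ser p (2 ^+ (p - 1)) 1 (- harm 1 h / 2) (harm 1 h ^+ 2 / 8).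
Proof.
have p3 := p_gt3; have zh : harm 1 h \in Z_ by apply: pint_harm; lia.
have zx i : (1 <= i < h.+1)%N -> (2 * i - 1)%:R^-1 \in Z_.
  by move=> hi; apply: pint_inv_small; lia.
have := ser_prod (rpred1 _) zx; set O1 := \sum_(_ <= _ < _) _; set O2 := \sum_(_ <= _ < _) _ ^+ 2.
have O1E : O1 ==[2] - harm 1 h / 2.
  have -> : O1 = harm 1 (p - 1) - harm 1 h / 2.
    rewrite -[O1]/(\sum_(_ <= _ < _) _) -(eq_bigr _ (fun i _ => expr1 _)) sum_odd.
    congr (_ - _); rewrite mulr_suml; apply: eq_big_nat => i hi; rewrite !expr1 P_double //.
    by case/andP: hi.
  by rewrite -[X in cg _ _ _ X]add0r mulNr; apply: cgB harm1_full (cg_refl _ _ _).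
have O2E : O2 ==[1] 0.
  rewrite /O2 sum_odd -[X in cg _ _ _ X]subr0; apply: cgB harm2_full _.
  have -> : \sum_(1 <= i < h.+1) (2 * i)%:R^-1 ^+ 2 = harm 2 h / 4 :> rat.
    rewrite mulr_suml; apply: eq_big_nat => i hi; rewrite P_double; last by case/andP: hi.
    by field; rewrite pnatr_eq0; lia.
  by rewrite -(mul0r 4^-1); apply: cgMr harm2_half; zp.
have zO1 : O1 \in Z_ by rewrite (cg_pint O1E); zp.
have zO2 : O2 \in Z_ by rewrite (cg_pint O2E); zp.
rewrite mul1r expr1n => s.
have {}s : ser p (2 ^+ (p - 1)) 1 O1 ((O1 ^+ 2 - O2) / 2).
  apply: (ser_eq s) => //; last by rewrite mul1r.
  have -> : (p - 1 = h + h)%N by lia.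
  rewrite -(@prod_odd_shift h).
  by apply: eq_big_nat => i hi; rewrite mul1r pE.
have {}s := @ser_cg1 _ _ _ _ _ (- harm 1 h / 2) 0 s.
apply: ser_cg2 (s _ _ _) _ _; zp; first by rewrite mulr0 addr0.
have -> : harm 1 h ^+ 2 / 8 = ((- harm 1 h / 2) ^+ 2 - 0) / 2 by field.
rewrite addr0; apply: cgMr; zp; apply: cgB => //; apply: cgX; zp.
exact: cgW O1E.
Qed.

Lemma pint_q2 : q2 \in Z_.
Proof.
case: ser_pow2 => z0 z1 z2 /cgP [e eZ].
rewrite pow_fermat_quotient -!addrA => /addrI E.
have -> : q2 = - harm 1 h / 2 + P * (harm 1 h ^+ 2 / 8) + P ^+ 2 * e.
  by apply: (mulfI (P_neq0 p)); rewrite E; ring.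
by zp.
Qed.

(** Comparing [ser_pow2] with 2^(p-1) = 1 + p q2 gives a quadratic relation for [harm 1 h]. It is
    solved by successive approximation: the value modulo p is substituted into the term that carries
    p. *)
Lemma harm1_half : harm 1 h ==[2] - 2 * q2 + P * q2 ^+ 2.
Proof.
have p3 := p_gt3; have zh : harm 1 h \in Z_ by apply: pint_harm; lia.
have zq := pint_q2.
have s : ser p (2 ^+ (p - 1)) 1 q2 0.
  by rewrite pow_fermat_quotient; apply: ser_lin; zp.
have e2 := cgMl (_ : -2 \in Z_) (ser_inj s ser_pow2).
have {}e2 : harm 1 h ==[2] - 2 * q2 + P * (harm 1 h / 2) ^+ 2.
  have := cgD (e2 _) (cg_refl p 2 (P * (harm 1 h / 2) ^+ 2)); rewrite mulr0 addr0.
  move=> H; apply: cg_sym; apply: cg_trans (H _) _; zp.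
  by apply: eq_cg; field.
have e1 : harm 1 h / 2 ==[1] - q2.
  have := cgMr (_ : 2^-1 \in Z_) (cgW (isT : 1 <= 2)%N e2) => H.
  apply: cg_trans (H _) _; zp.
  by apply/cgP; exists ((harm 1 h / 2) ^+ 2 / 2); zp; field.
apply: cg_trans e2 _; apply: cgD; first exact: cg_refl.
rewrite -[P]expr1; apply: (@cgMp p 1 1); rewrite -[X in cg _ _ _ X]sqrrN.
by apply: cgX; zp.
Qed.

End Half.

End Harmonic.

(** * Harmonic numbers at p/3 and p/6, and the Fermat quotient of 3 *)

Lemma prod_mod3_fact n :
  \prod_(0 <= k < n.+1) (3 * k + 1)%:R * \prod_(0 <= k < n) (3 * k + 2)%:R
    * (3 ^+ n * n`!%:R) = (3 * n + 1)`!%:R :> rat.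
Proof.
elim: n => [|n IH].
  by rewrite big_nat1 big_geq //= muln0 add0n fact0 (_ : 1`! = 1%N) //; ring.
rewrite big_nat_recr //= [X in _ * X * _]big_nat_recr //=.
have -> : (3 * n.+1 + 1 = (3 * n + 1).+3)%N by lia.
rewrite !factS !natrM -IH (_ : (3 * n + 1).+2 = (3 * n.+1))%N; last by lia.
rewrite (_ : (3 * n + 1).+1 = (3 * n + 2))%N; last by lia.
by rewrite natrM exprS; ring.
Qed.

(** The analogue for 3^(p-1) with p = 3n + 2. The multipliers 1 and 2 make 3k+1+p and 3k+2+2p
    divisible by 3; the quotients run through n+1, ..., 2n+1 and 2n+2, ..., 3n+1, so that together
    they give (3n+1)!/n!. *)
Lemma prod_mod3_shift n :
  \prod_(0 <= k < n.+1) (1 + (3 * n + 2)%:R * (1 * (3 * k + 1)%:R^-1)) *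
  \prod_(0 <= k < n) (1 + (3 * n + 2)%:R * (2 * (3 * k + 2)%:R^-1)) = 3 ^+ (3 * n + 1) :> rat.
Proof.
have c3 m : 3 ^+ m = \prod_(0 <= k < m) 3 :> rat by rewrite prodr_const_nat subn0.
have nz k c : (0 < c)%N -> (3 * k + c)%:R != 0 :> rat by rewrite pnatr_eq0; lia.
have -> : \prod_(0 <= k < n.+1) (1 + (3 * n + 2)%:R * (1 * (3 * k + 1)%:R^-1)) =
   3 ^+ n.+1 * (\prod_(1 <= k < n.+2) (n + k)%:R / \prod_(0 <= k < n.+1) (3 * k + 1)%:R) :> rat.
  rewrite big_add1 /= (c3 n.+1) -prodf_div -big_split /=.
  apply: eq_big_nat => k _; have := nz k 1%N isT.
  rewrite -[k.+1]addn1 (natrD _ (3 * k)) (natrD _ (3 * n)) (natrD _ n) !natrM natrD.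
  by move=> h; field.
have -> : \prod_(0 <= k < n) (1 + (3 * n + 2)%:R * (2 * (3 * k + 2)%:R^-1)) =
   3 ^+ n * (\prod_(1 <= k < n.+1) (2 * n + 1 + k)%:R / \prod_(0 <= k < n) (3 * k + 2)%:R) :> rat.
  rewrite big_add1 /= (c3 n) -prodf_div -big_split /=.
  apply: eq_big_nat => k _; have := nz k 2%N isT.
  rewrite -[k.+1]addn1 (natrD _ (3 * k)) (natrD _ (3 * n)) (natrD _ (2 * n + 1)).
  by rewrite (natrD _ (2 * n)) !natrM natrD => h; field.
have f0 m : m`!%:R != 0 :> rat by rewrite pnatr_eq0 -lt0n fact_gt0.
have := prod_mod3_fact n; have := prod_rising_fact n n.+1.
have := prod_rising_fact (2 * n + 1) n.
rewrite (_ : 2 * n + 1 + n = 3 * n + 1)%N; last by lia.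
rewrite (_ : n + n.+1 = 2 * n + 1)%N; last by lia.
set A := \prod_(1 <= i < n.+2) (n + i)%:R; set B := \prod_(1 <= i < n.+1) _.
set C := \prod_(0 <= k < n.+1) (3 * k + 1)%:R; set D := \prod_(0 <= k < n) (3 * k + 2)%:R.
have C0 : C != 0 by rewrite prodf_seq_neq0; apply/allP => i _; exact: nz.
have D0 : D != 0 by rewrite prodf_seq_neq0; apply/allP => i _; exact: nz.
move=> eB eA eC; have {eA eB} : B * A = C * D * 3 ^+ n.
  by apply: (mulIf (f0 n)); rewrite -!mulrA eA mulrA -!mulrA eB -eC; ring.
move=> e; have -> : 3 ^+ n.+1 * (A / C) * (3 ^+ n * (B / D)) = 3 ^+ n.+1 * 3 ^+ n * (B * A) / (C * D).
  by field; rewrite ?C0 ?D0.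
rewrite e (_ : 3 * n + 1 = n.+1 + (n + n))%N ?exprD; last by lia.
by field; rewrite ?C0 ?D0.
Qed.

Lemma sum_mod3 (f : nat -> rat) n :
  \sum_(1 <= i < (3 * n).+2) f i = \sum_(0 <= k < n.+1) f (3 * k + 1)%N
    + \sum_(0 <= k < n) f (3 * k + 2)%N + \sum_(1 <= k < n.+1) f (3 * k)%N.
Proof.
elim: n => [|n IH]; first by rewrite !big_nat1 !big_geq ?addr0.
have -> : ((3 * n.+1).+2 = (3 * n).+2.+3)%N by lia.
rewrite 3?big_nat_recr //= IH [X in _ = X + _ + _]big_nat_recr //=.
rewrite [X in _ = _ + X + _]big_nat_recr //= [X in _ = _ + _ + X]big_nat_recr //=.
rewrite (_ : 3 * n.+1 + 1 = (3 * n).+4)%N; last by lia.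
rewrite (_ : 3 * n.+1 = (3 * n).+3)%N; last by lia.
rewrite (_ : 3 * n + 2 = (3 * n).+2)%N; last by lia.
by ring.
Qed.

Section Harmonic.

Variable p : prime_gt3.
Local Notation p_pr := (pval_prime p).
Local Notation p_gt3 := (pval_gt3 p).
Local Notation P := (p%:R : rat).
Local Notation Z_ := (pint p).
Local Notation "a ==[ k ] b" := (cg p k a b) (at level 70).
Let co6 := coprime_p6 p.

Section Sixth.

Variables (h M : nat) (pE : p = (2 * h + 1)%N :> nat) (hM : (h - uphalf M)%N = M).
Hypothesis Mh : (M <= 2 * h)%N.
Local Notation r := (M./2).

Let zM k : harm k M \in Z_. Proof. by apply: pint_harm; lia. Qed.
Let zh k : harm k h \in Z_. Proof. by apply: pint_harm; have := p_gt3; lia. Qed.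
Let zr k : harm k r \in Z_. Proof. by apply: pint_harm; have := p_gt3; lia. Qed.

(** The hypothesis [hM] says that M is the integer part of p/3, in either class of p modulo 6. The
    odd indices up to M then correspond to the interval from M+1 to h, so the parity splitting of
    [harm 2 M] closes up and involves only p/6, p/3 and p/2. *)
Lemma harm2_sixth : harm 2 r ==[1] 5 * harm 2 M.
Proof.
have := harm2_even_odd pE Mh; rewrite hM => /(cgMl (_ : 4 \in Z_)) H.
have {}H := cgD (H (pint_nat _ _)) (cg_refl p 1 (harm 2 M)).
have {}H : 5 * harm 2 M ==[1] harm 2 r + harm 2 h.
  by apply: (eq_cg2 H); [ring | field].
apply: cg_sym; apply: cg_trans H _; rewrite -[X in cg _ _ _ X]addr0.
by apply: cgD; [exact: cg_refl | exact: harm2_half].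
Qed.

Lemma harm1_sixth : harm 1 r ==[2]
  harm 1 M - 2 * fermat_quotient p 2 + P * (fermat_quotient p 2 ^+ 2 - harm 2 M / 2).
Proof.
have := harm1_even_odd pE Mh; rewrite hM => /(cgMl (_ : 2 \in Z_)) H.
have {}H := cg_sym (cgD (H (pint_nat _ _)) (cg_refl p 2 (harm 1 h - harm 1 M + P * ((harm 2 h - harm 2 M) / 2)))).
have {}H : harm 1 r ==[2] harm 1 M + harm 1 h + P * ((harm 2 h - harm 2 M) / 2).
  by apply: (eq_cg2 H); field.
apply: cg_trans H _.
have -> : harm 1 M - 2 * fermat_quotient p 2 + P * (fermat_quotient p 2 ^+ 2 - harm 2 M / 2)
 = harm 1 M + (- 2 * fermat_quotient p 2 + P * fermat_quotient p 2 ^+ 2) + P ^+ 1 * ((0 - harm 2 M) / 2).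
  by field.
apply: cgD; first by apply: cgD; [exact: cg_refl | exact: harm1_half].
apply: (@cgMp p 1 1); apply: cgMr; zp.
by apply: cgB; [exact: harm2_half pE | exact: cg_refl].
Qed.

End Sixth.

Section Third.

Variables (h M : nat) (pE : p = (2 * h + 1)%N :> nat) (pM : p = (3 * M + 2)%N :> nat).

Let q3 := fermat_quotient p 3.
Let T := harm 2 M / 9.

Let zM k : harm k M \in Z_. Proof. by apply: pint_harm; lia. Qed.

Let inv3 k i : (0 < i)%N -> (3 * i)%:R^-1 ^+ k = 3^-1 ^+ k * i%:R^-1 ^+ k :> rat.
Proof. by move=> i0; rewrite natrM invfM exprMn. Qed.

Let sum3 k : \sum_(1 <= i < M.+1) (3 * i)%:R^-1 ^+ k = 3^-1 ^+ k * harm k M :> rat.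
Proof.
by rewrite mulr_sumr; apply: eq_big_nat => i hi; rewrite inv3 //; case/andP: hi.
Qed.

Let x1 k := (3 * k + 1)%:R^-1 : rat.
Let x2 k := (3 * k + 2)%:R^-1 : rat.
Let S1 := \sum_(0 <= k < M.+1) x1 k.
Let S2 := \sum_(0 <= k < M) x2 k.
Let Q1 := \sum_(0 <= k < M.+1) x1 k ^+ 2.
Let Q2 := \sum_(0 <= k < M) x2 k ^+ 2.

Let S2_rev k : \sum_(0 <= i < M) x2 i ^+ k = \sum_(1 <= i < M.+1) (p - 3 * i)%:R^-1 ^+ k.
Proof.
rewrite big_add1 /= big_nat_rev /=; apply: eq_big_nat => i hi.
by rewrite /x2; congr (_%:R^-1 ^+ _); lia.
Qed.

(** Indices in the class 2 modulo 3 reflect to the multiples 3i, whose sums are multiples of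
    [harm k M]. The class 1 is stable under reflection, and its sums [S1], [Q1] are obtained as what
    remains of the vanishing full sums. *)
Let Q2E : Q2 ==[1] T.
Proof.
rewrite /Q2 S2_rev; have -> : T = \sum_(1 <= i < M.+1) (3 * i)%:R^-1 ^+ 2.
  by rewrite sum3 /T; field.
by apply: cg_sum_nat => i hi; apply: inv_sqr_reflect; lia.
Qed.

Let S2E : S2 ==[2] - harm 1 M / 3 - P * T.
Proof.
have -> : S2 = \sum_(1 <= i < M.+1) (p - 3 * i)%:R^-1 ^+ 1.
  by rewrite -S2_rev; apply: eq_bigr => i _; rewrite expr1.
have -> : - harm 1 M / 3 - P * T = \sum_(1 <= i < M.+1) - ((3 * i)%:R^-1 + P * (3 * i)%:R^-1 ^+ 2).
  rewrite sumrN big_split /= -mulr_sumr sum3.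
  under eq_bigr => i _ do rewrite -[_^-1]expr1.
  by rewrite sum3 /T; field.
by apply: cg_sum_nat => i hi; rewrite expr1; apply: inv_reflect; lia.
Qed.

Let total k : harm k (p - 1) = \sum_(0 <= i < M.+1) x1 i ^+ k
    + \sum_(0 <= i < M) x2 i ^+ k + 3^-1 ^+ k * harm k M.
Proof.
by rewrite -sum3 -(sum_mod3 (fun i => i%:R^-1 ^+ k)) pM /harm addnS subn1 addn1.
Qed.

Let S1E : S1 ==[2] P * T.
Proof.
have -> : S1 = harm 1 (p - 1) - S2 - 3^-1 * harm 1 M.
  have E1 (f : nat -> rat) m n : \sum_(m <= i < n) f i ^+ 1 = \sum_(m <= i < n) f i.
    by apply: eq_bigr => i _; rewrite expr1.
  by rewrite total !E1 expr1 -/S1 -/S2; ring.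
have -> : P * T = 0 - (- harm 1 M / 3 - P * T) - 3^-1 * harm 1 M by field.
by apply: cgB (cg_refl _ _ _); apply: cgB S2E; apply: harm1_full pE.
Qed.

Let Q1E : Q1 ==[1] - 2 * T.
Proof.
have -> : Q1 = harm 2 (p - 1) - Q2 - T by rewrite total -/Q1 -/Q2 /T; field.
have -> : - 2 * T = 0 - T - T by field.
by apply: cgB (cg_refl _ _ _); apply: cgB Q2E; exact: harm2_full pE.
Qed.

Let zT : T \in Z_. Proof. by have z := zM 2; rewrite /T; zp. Qed.

Let ser_pow3 : ser p (3 ^+ (p - 1)) 1 (- (2 / 3) * harm 1 M)
  ((2 / 9) * harm 1 M ^+ 2 - 2 * T).
Proof.
have z1 := zM 1.
have zS1 : S1 \in Z_ by rewrite (cg_pint S1E); zp.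
have zS2 : S2 \in Z_ by rewrite (cg_pint S2E); zp.
have zQ1 : Q1 \in Z_ by rewrite (cg_pint Q1E); zp.
have zQ2 : Q2 \in Z_ by rewrite (cg_pint Q2E); zp.
have s1 : ser p (\prod_(0 <= k < M.+1) (1 + P * (1 * x1 k))) 1 0 (2 * T).
  have s : ser p (\prod_(0 <= k < M.+1) (1 + P * (1 * x1 k))) 1 S1 ((S1 ^+ 2 - Q1) / 2).
    apply: ser_eq (ser_prod (rpred1 _) (_ : forall i, (0 <= i < M.+1)%N -> x1 i \in Z_)) _ _ _ _ => //.
    - by move=> i hi; apply: pint_inv_small; lia.
    - by rewrite mul1r.
    by rewrite expr1n mul1r.
  have e2 : (S1 ^+ 2 - Q1) / 2 ==[1] T.
    have -> : T = (0 ^+ 2 - (- 2 * T)) / 2 by field.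
    apply: cgMr; zp; apply: cgB Q1E; apply: cgX; zp.
    by apply: cg_trans (cgW (isT : 1 <= 2)%N S1E) _; rewrite -[P]expr1; apply: cg_small.
  apply: ser_eq (ser_cg1 (b1 := 0) (e := T) (ser_cg2 s _ e2) _ _ _) _ _ _ _ => //; zp.
    by rewrite add0r.
  by ring.
have s2 : ser p (\prod_(0 <= k < M) (1 + P * (2 * x2 k))) 1 (- (2 / 3) * harm 1 M)
    ((2 / 9) * harm 1 M ^+ 2 - 4 * T).
  have s : ser p (\prod_(0 <= k < M) (1 + P * (2 * x2 k))) 1 (2 * S2) (2 ^+ 2 * (S2 ^+ 2 - Q2) / 2).
    apply: ser_eq (ser_prod (pint_nat _ 2) (_ : forall i, (0 <= i < M)%N -> x2 i \in Z_)) _ _ _ _ => //.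
    by move=> i hi; apply: pint_inv_small; lia.
  have e2 : 2 ^+ 2 * (S2 ^+ 2 - Q2) / 2 ==[1] (2 / 9) * harm 1 M ^+ 2 - 2 * T.
    have -> : (2 / 9) * harm 1 M ^+ 2 - 2 * T = 2 ^+ 2 * ((- harm 1 M / 3) ^+ 2 - T) / 2 by field.
    apply: cgMr; zp; apply: cgMl; zp; apply: cgB Q2E; apply: cgX; zp.
    apply: cg_trans (cgW (isT : 1 <= 2)%N S2E) _.
    by rewrite -[X in cg _ _ _ X]addr0; apply: cgD; [exact: cg_refl | rewrite -mulrN -[P]expr1; apply: cg_small; zp].
  have e1 : 2 * S2 ==[2] - (2 / 3) * harm 1 M + P * (- 2 * T).
    have -> : - (2 / 3) * harm 1 M + P * (- 2 * T) = 2 * (- harm 1 M / 3 - P * T) by field.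
    by apply: cgMl; zp.
  apply: ser_eq (ser_cg1 (ser_cg2 s _ e2) _ _ e1) _ _ _ _ => //; zp.
  by ring.
have -> : 3 ^+ (p - 1) = (\prod_(0 <= k < M.+1) (1 + P * (1 * x1 k))) * \prod_(0 <= k < M) (1 + P * (2 * x2 k)).
  have -> : (p - 1 = 3 * M + 1)%N by lia.
  by rewrite -prod_mod3_shift -pM.
by apply: ser_eq (serM s1 s2) _ _ _ _ => //; field.
Qed.

Lemma pint_q3 : q3 \in Z_.
Proof.
case: ser_pow3 => z0 z1 z2 /cgP [e eZ].
rewrite pow_fermat_quotient -!addrA => /addrI E.
have -> : q3 = - (2 / 3) * harm 1 M + P * ((2 / 9) * harm 1 M ^+ 2 - 2 * T) + P ^+ 2 * e.
  by apply: (mulfI (P_neq0 p)); rewrite E; ring.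
by zp.
Qed.

(** Successive approximation as in [harm1_half]; here the sum of inverse squares does not vanish and
    survives in the correction. *)
Lemma harm1_third :
  harm 1 M ==[2] - (3 / 2) * q3 + P * ((3 / 4) * q3 ^+ 2 - harm 2 M / 3).
Proof.
have z1 := zM 1; have z2 := zM 2; have zq := pint_q3.
have s : ser p (3 ^+ (p - 1)) 1 q3 0.
  by rewrite pow_fermat_quotient; apply: ser_lin; zp.
have e := ser_inj s ser_pow3; rewrite mulr0 addr0 in e.
have e1 : harm 1 M ==[1] - (3 / 2) * q3.
  have /(cgMl (_ : - (3 / 2) \in Z_)) H := cgW (isT : 1 <= 2)%N e.
  apply: cg_sym; apply: cg_trans (H _) _; zp.
  apply/cgP; exists (- (3 / 2) * ((2 / 9) * harm 1 M ^+ 2 - 2 * T)); zp.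
  by field.
have /(cgMl (_ : - (3 / 2) \in Z_)) := e => H.
have {}H := cgD (H _) (cg_refl p 2 (P * ((1 / 3) * harm 1 M ^+ 2 - harm 2 M / 3))).
apply: cg_trans (cg_sym (cg_trans (H _) _)) _; zp.
  by apply: eq_cg; rewrite /T; field.
apply: cgD; first exact: cg_refl.
rewrite -[P]expr1; apply: (@cgMp p 1 1); apply: cgB (cg_refl _ _ _).
have -> : (3 / 4) * q3 ^+ 2 = (1 / 3) * (- (3 / 2) * q3) ^+ 2 by field.
by apply: cgMl; zp; apply: cgX; zp.
Qed.

End Third.

End Harmonic.

(** * The numbers U_n *)

Definition Uq n : rat := (U n)%:~R.

(* Umbrally (x + U)^n, where U^k stands for U_k. *)
Definition V (n : nat) (x : rat) : rat := \sum_(i < n.+1) 'C(n, i)%:R * x ^+ i * Uq (n - i).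

Lemma Uq_odd n : odd n -> Uq n = 0.
Proof. by rewrite /Uq /U => ->. Qed.

Lemma sum_even_support (f : nat -> rat) n : (forall i, odd i -> f i = 0) ->
  \sum_(i < (2 * n).+1) f i = \sum_(0 <= k < n.+1) f (2 * k)%N.
Proof.
move=> f0; rewrite -(big_mkord predT f); elim: n => [|n IH]; first by rewrite !big_nat1.
rewrite [RHS]big_nat_recr //= -IH.
rewrite (_ : (2 * n.+1) = (2 * n).+2)%N; last by lia.
by rewrite 2?big_nat_recr //= (f0 (2 * n).+1) ?addr0 //=; lia.
Qed.

(** The recursion for U in umbral form: the exponential generating function of U is the inverse of
    e^t + e^(-t) - 1. For odd n everything cancels by parity. *)
Lemma V_pm1 n : V n 1 + V n (-1) - Uq n = (n == 0%N)%:R.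
Proof.
have [on|en] := boolP (odd n).
  rewrite (Uq_odd on) subr0 (_ : (n == 0%N) = false); last by lia.
  rewrite /V -big_split big1 //= => i _; rewrite expr1n mulr1.
  have [oi|ei] := boolP (odd i).
    by rewrite -signr_odd oi expr1 mulrN1 mulNr subrr.
  by rewrite Uq_odd ?mulr0 ?addr0 // oddB ?on //=; have := ltn_ord i; lia.
have nE : n = (2 * n./2)%N by lia.
move: nE; set m := n./2 => ->; rewrite /V -big_split /=.
set f := fun i => 'C(2 * m, i)%:R * 1 ^+ i * Uq (2 * m - i) + 'C(2 * m, i)%:R * (-1) ^+ i * Uq (2 * m - i).
rewrite (@sum_even_support f) => [|i oi]; last first.
  by rewrite /f expr1n -signr_odd oi; ring.
case: m @f => [|m] f; first by rewrite big_nat1 /f muln0 bin0 /Uq U0 !expr0 !mul1r addrK.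
rewrite big_ltn // /f muln0 bin0 subn0 expr0 /Uq U_even // (_ : _ == _ = false); last by lia.
have -> : \sum_(1 <= k < m.+2) ('C(2 * m.+1, 2 * k)%:R * 1 ^+ (2 * k) * (U (2 * m.+1 - 2 * k))%:~R
    + 'C(2 * m.+1, 2 * k)%:R * (-1) ^+ (2 * k) * (U (2 * m.+1 - 2 * k))%:~R)
  = 2 * (\sum_(1 <= k < m.+2) 'C(2 * m.+1, 2 * k)%:R * U (2 * m.+1 - 2 * k))%:~R :> rat.
  rewrite rmorph_sum mulr_sumr; apply: eq_bigr => k _.
  by rewrite (exprM (-1)) sqrrN !expr1n rmorphM /= rmorph_nat; ring.
by rewrite rmorphM /= rmorphN /=; ring.
Qed.

Section Umbral.

Variable N : nat.

(* The linear functional 'X^k |-> U_k on polynomials of size at most N. *)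
Let L (f : {poly rat}) : rat := \sum_(i < N) f`_i * Uq i.

Let LD f g : L (f + g) = L f + L g.
Proof. by rewrite /L -big_split; apply: eq_bigr => i _; rewrite coefD mulrDl. Qed.

Let LZ c f : L (c *: f) = c * L f.
Proof. by rewrite /L mulr_sumr; apply: eq_bigr => i _; rewrite coefZ mulrA. Qed.

Let L0 : L 0 = 0.
Proof. by rewrite -[0 in LHS](scale0r 0) LZ mul0r. Qed.

Let L_sum n (F : 'I_n -> {poly rat}) : L (\sum_(i < n) F i) = \sum_(i < n) L (F i).
Proof. exact: (big_morph L LD L0). Qed.

Let LX k : (k < N)%N -> L 'X^k = Uq k.
Proof.
move=> kN; rewrite /L (bigD1 (Ordinal kN)) //= coefXn eqxx mul1r big1 ?addr0 // => i ik.
by rewrite coefXn (_ : (i == k :> nat) = false) ?mul0r //; apply/negbTE.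
Qed.

Let L_shift n x : (n < N)%N -> L (('X + x%:P) ^+ n) = V n x.
Proof.
move=> nN; rewrite exprDn L_sum /V; apply: eq_bigr => i _.
by rewrite -rmorphXn /= mulrC mul_polyC -scaler_nat scalerA LZ LX //; lia.
Qed.

Let L_comp (f : {poly rat}) (c : rat) : (size f <= N)%N -> L (f \Po ('X + c%:P)) = \sum_(i < N) f`_i * V i c.
Proof.
move=> sf; rewrite {1}(_ : f = \sum_(i < N) f`_i *: 'X^i).
  rewrite linear_sum /= L_sum.
  by apply: eq_bigr => i _; rewrite comp_polyZ LZ comp_Xn_poly L_shift.
by rewrite -(poly_def N (fun i => f`_i)); exact: (esym (take_poly_id sf)).
Qed.

(** By linearity [V_pm1] says L(f(X+1)) + L(f(X-1)) - L(f) = f(0) for polynomials f of size at most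
    N. The identity is this one for f = (X + x)^n. *)
Lemma V_shift n x : (n < N)%N -> V n (x + 1) + V n (x - 1) - V n x = x ^+ n.
Proof.
move=> nN; rewrite -!L_shift //.
have sz : (size (('X + x%:P) ^+ n) <= N)%N by rewrite -[x]opprK polyCN size_exp_XsubC.
have E c : ('X + (x + c)%:P) ^+ n = (('X + x%:P) ^+ n) \Po ('X + c%:P).
  by rewrite rmorphXn /= comp_polyD comp_polyX comp_polyC polyCD addrAC addrA.
rewrite !E !L_comp // /L -big_split -sumrB /=.
have -> : x ^+ n = ((('X + x%:P) ^+ n)`_0).
  by rewrite -horner_coef0 horner_exp !hornerE.
case: N nN => // N' _; rewrite big_ord_recl big1 /=.
  by rewrite -mulrDr -mulrBr V_pm1 mulr1 addr0.
by move=> i _; rewrite -mulrDr -mulrBr V_pm1 mulr0.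
Qed.

End Umbral.

Lemma sum_alternating (f : nat -> rat) n :
  \sum_(1 <= i < n.+1) (-1) ^+ i * f i =
    2 * (\sum_(1 <= i < n./2.+1) f (2 * i)%N) - \sum_(1 <= i < n.+1) f i.
Proof.
elim: n => [|n IH]; first by rewrite !big_geq // mulr0 subrr.
rewrite big_nat_recr //= IH [X in _ = _ - X]big_nat_recr //= uphalf_half -signr_odd /=.
have [on|en] := boolP (odd n); rewrite ?add1n ?add0n; last by ring.
rewrite [in RHS]big_nat_recr //= (_ : 2 * n./2.+1 = n.+1)%N; first by ring.
by lia.
Qed.

(** * U_{p-3} modulo p as a sum of inverse squares *)

Section Kummer.

Variable p : prime_gt3.
Local Notation p_pr := (pval_prime p).
Local Notation p_gt3 := (pval_gt3 p).
Local Notation P := (p%:R : rat).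
Local Notation Z_ := (pint p).
Local Notation "a ==[ k ] b" := (cg p k a b) (at level 70).
Let co6 := coprime_p6 p.

Lemma cg_nat k a b : a = b %[mod p ^ k] -> a%:R ==[k] b%:R.
Proof.
move=> /eqP ab; wlog le_ba : a b ab / (b <= a)%N.
  move=> H; case: (leqP b a) => [|/ltnW] h; first exact: H.
  by apply: cg_sym; apply: H => //; rewrite eq_sym.
move: ab; rewrite eqn_mod_dvd // => /dvdnP [q e].
exists q%:R; first exact: pint_nat.
by rewrite -natrX -natrM -natrD mulnC -e subnKC.
Qed.

Lemma cg_fermat a : (0 < a < p)%N -> a%:R ^+ (p - 1) ==[1] 1.
Proof.
move=> ha; rewrite -natrX; apply: (@cg_nat 1 _ 1%N); rewrite expn1.
rewrite subn1 -totient_prime //; last exact: p_pr.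
by apply: Euler_exp_totient; rewrite coprime_sym prime_coprime ?p_pr // gtnNdvd; lia.
Qed.

Lemma cg_pow_inv_sqr a : (0 < a < p)%N -> a%:R ^+ (p - 3) ==[1] a%:R^-1 ^+ 2.
Proof.
move=> ha; have u := punit_small ha; have z := pint_inv_small ha.
have := cgMl (rpredX 2 z) (cg_fermat ha); rewrite mulr1 => /eq_cg2; apply=> //.
have -> : (p - 1 = p - 3 + 2)%N by have := p_gt3; lia.
by rewrite exprD; have := punit_neq0 u => u0; field.
Qed.

Section Third.

Variables (h M : nat) (pE : p = (2 * h + 1)%N :> nat) (pM : p = (3 * M + 2)%N :> nat).
Let n := (p - 3)%N.
Let a (j : nat) := V n j%:R.

Let n_even : ~~ odd n. Proof. by rewrite /n; have := p_gt3; lia. Qed.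
Let M_odd : odd M. Proof. by lia. Qed.

Let a_rec j : a j.+2 = j.+1%:R ^+ n + a j.+1 - a j.
Proof.
rewrite -(@V_shift p) ?/n; last by have := p_gt3; lia.
by rewrite /a -!natr1 addrK; ring.
Qed.

Let a0 : a 0 = Uq n.
Proof.
rewrite /a /V big_ord_recl big1 /=; first by rewrite bin0 expr0 subn0 addr0 !mul1r.
by move=> i _; rewrite exprS mul0r mulr0 mul0r.
Qed.

Let a1 : a 1 = Uq n / 2.
Proof.
have : V n (0 + 1) + V n (0 - 1) - V n 0 = 0 ^+ n.
  by apply: (@V_shift p); rewrite /n; have := p_gt3; lia.
have -> : V n (0 - 1) = V n (0 + 1).
  apply: eq_bigr => i _; rewrite !add0r expr1n -signr_odd.
  have [oi|ei] := boolP (odd i); last by rewrite expr0.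
  by rewrite Uq_odd ?mulr0 // oddB ?(negbTE n_even) ?oi //; have := ltn_ord i; lia.
rewrite -[V n 0]/(a 0) a0 add0r expr0n (_ : (n == 0)%N = false); last first.
  by rewrite /n; have := p_gt3; lia.
by move=> /eqP; rewrite subr_eq0 => /eqP <-; rewrite /a; field.
Qed.

(** With E the shift of j, the recurrence has characteristic polynomial E^2 - E + 1, a divisor of
    E^3 + 1. Hence a(j+3) + a(j) is a sum of two n-th powers, and steps of length 3 telescope up to
    sign. *)
Let a_third k : (-1) ^+ k * a (3 * k + 2) =
  a 2 - \sum_(0 <= i < k) (-1) ^+ i * ((3 * i + 3)%:R ^+ n + (3 * i + 4)%:R ^+ n).
Proof.
elim: k => [|k IH]; first by rewrite big_geq // muln0 add0n; ring.
rewrite big_nat_recr //= opprD addrA -IH exprS.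
have -> : (3 * k.+1 + 2 = (3 * k + 2).+3)%N by lia.
rewrite !a_rec (_ : (3 * k + 3) = (3 * k + 2).+1)%N; last by lia.
by rewrite (_ : (3 * k + 4) = (3 * k + 2).+2)%N; [ring | lia].
Qed.

Let a_p : a p ==[1] a 0.
Proof.
apply: cg_sum => i _; apply: cgMr; first exact: pint_int.
apply: cgMl; first exact: pint_nat.
apply: cgX; first exact: pint_nat.
by exists 1; rewrite ?rpred1 // add0r expr1 mulr1.
Qed.

Let B := \sum_(0 <= i < M.+1) (-1) ^+ i * (3 * i + 1)%:R^-1 ^+ 2 : rat.

(** Replacing i by M - i turns 3i + 1 into p - (3i + 1) and changes the sign, M being odd; so B
    equals -B modulo p. *)
Let B0 : B ==[1] 0.
Proof.
have p3 := p_gt3.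
have z i : (i <= M)%N -> (3 * i + 1)%:R^-1 \in Z_ by move=> hi; apply: pint_inv_small; lia.
have zs k : (-1) ^+ k \in Z_ by zp.
have BB : B ==[1] - B.
  rewrite {1}/B big_nat_rev /= -sumrN; apply: cg_sum_nat => i hi.
  rewrite -mulNr (_ : (-1) ^+ (0 + M.+1 - i.+1) = - (-1) ^+ i); last first.
    have e : (-1) ^+ (M - i) * (-1) ^+ i = -1 :> rat.
      rewrite -exprD subnK; last by case/andP: hi.
      by rewrite -signr_odd M_odd expr1.
    rewrite add0n subSS; transitivity ((-1) ^+ (M - i) * ((-1) ^+ i * (-1) ^+ i) : rat).
      by rewrite -expr2 sqrr_sign mulr1.
    by rewrite mulrA e mulN1r.
  apply: cgMl; first by rewrite rpredN.
  have -> : (3 * (0 + M.+1 - i.+1) + 1 = p - (3 * i + 1))%N by lia.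
  by apply: inv_sqr_reflect; lia.
apply: (@cg_cancel p 1 2); first by apply: punit_small; lia.
by apply: (eq_cg2 (cgD BB (cg_refl p 1 B))); ring.
Qed.

(** At k = M, [a_third] reaches V n p, which is V n 0 = U_n modulo p. By Fermat the powers with
    exponent n = p - 3 are inverse squares; those of the class 1 modulo 3 cancel by [B0], and the
    alternating sum over multiples of 3 is evaluated by [harm2_sixth]. *)
Lemma U_third : (U (p - 3))%:~R ==[1] - harm 2 M / 3.
Proof.
have p3 := p_gt3; rewrite -/n -/(Uq n).
have zM : harm 2 M \in Z_ by apply: pint_harm; lia.
have E := a_third M; rewrite -pM -signr_odd M_odd expr1 in E.
have a2 : a 2 = 1 + Uq n / 2 - Uq n by rewrite a_rec a1 a0 expr1n.
set S := \sum_(_ <= _ < _) _ in E.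
have SE : S ==[1] 1 + - (\sum_(1 <= i < M.+1) (-1) ^+ i * i%:R^-1 ^+ 2) / 9.
  have H : S ==[1] \sum_(0 <= i < M) (-1) ^+ i * ((3 * i + 3)%:R^-1 ^+ 2 + (3 * i + 4)%:R^-1 ^+ 2).
    apply: cg_sum_nat => i hi; apply: cgMl; first by zp.
    by apply: cgD; apply: cg_pow_inv_sqr; lia.
  apply: cg_trans H _.
  have -> : \sum_(0 <= i < M) (-1) ^+ i * ((3 * i + 3)%:R^-1 ^+ 2 + (3 * i + 4)%:R^-1 ^+ 2)
     = (1 - B) + - (\sum_(1 <= i < M.+1) (-1) ^+ i * i%:R^-1 ^+ 2) / 9 :> rat.
    rewrite /B (@big_ltn _ _ _ 0 M.+1) // !big_add1 /= muln0 expr0 invr1 expr1n mul1r opprD addrA subrr add0r.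
    rewrite -!sumrN mulr_suml -big_split /=; apply: eq_bigr => i _.
    rewrite [(-1) ^+ i.+1]exprS (_ : 3 * i.+1 + 1 = 3 * i + 4)%N; last by lia.
    rewrite (_ : 3 * i + 3 = 3 * i.+1)%N ?natrM; last by lia.
    have d0 : i.+1%:R != 0 :> rat by rewrite pnatr_eq0.
    have e0 : (3 * i + 4)%:R != 0 :> rat by rewrite pnatr_eq0; lia.
    by move: (i.+1%:R) ((3 * i + 4)%:R) d0 e0 => d e d0 e0; field; rewrite ?d0 ?e0.
  rewrite -[1 in X in cg _ _ _ X]subr0; apply: cgD (cg_refl _ _ _); apply: cgB B0; exact: cg_refl.
have hM : (h - uphalf M)%N = M by lia.
have h2 := harm2_sixth pE hM (ltac:(lia) : (M <= 2 * h)%N).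
have alt : - (\sum_(1 <= i < M.+1) (-1) ^+ i * i%:R^-1 ^+ 2) / 9 ==[1] - harm 2 M / 6.
  rewrite (sum_alternating (fun i => i%:R^-1 ^+ 2)) -/(harm 2 M).
  have -> : \sum_(1 <= i < M./2.+1) (2 * i)%:R^-1 ^+ 2 = harm 2 M./2 / 4 :> rat.
    rewrite mulr_suml; apply: eq_big_nat => i hi; rewrite natrM.
    by field; rewrite pnatr_eq0; lia.
  have -> : - harm 2 M / 6 = - (2 * (5 * harm 2 M / 4) - harm 2 M) / 9 by field.
  apply: cgMr; zp; apply: cgN; apply: cgB (cg_refl _ _ _); apply: cgMl; zp.
  by apply: cgMr; zp.
have {}SE := cg_trans SE (cgD (cg_refl p 1 1) alt).
have aS : a p = S - a 2 by transitivity (- (-1 * a p)); [ring | rewrite E opprB].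
have := cg_sym a_p; rewrite aS a0 => /cgD /(_ (cg_refl p 1 (- Uq n / 2))) H.
have {}H := cg_trans H (cgD (cgB SE (cg_refl p 1 (a 2))) (cg_refl p 1 (- Uq n / 2))).
by apply: (eq_cg2 (cgMl (pint_nat p 2) H)); rewrite ?a2; field.
Qed.

End Third.
End Kummer.

(** * The truncated hypergeometric sum *)

Definition poch (a : rat) (k : nat) : rat := \prod_(0 <= i < k) (a + i%:R).

Lemma poch0 a : poch a 0 = 1.
Proof. by rewrite /poch big_geq. Qed.

Lemma pochS a k : poch a k.+1 = poch a k * (a + k%:R).
Proof. by rewrite /poch big_nat_recr. Qed.

Lemma pochSl a k : poch a k.+1 = a * poch (a + 1) k.
Proof.
rewrite /poch big_ltn // addr0 big_add1; congr (_ * _); apply: eq_bigr => i _.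
by rewrite -natr1; ring.
Qed.

Lemma poch1 k : poch 1 k = k`!%:R.
Proof.
elim: k => [|k IH]; first by rewrite poch0.
by rewrite pochS IH factS natrM -natr1; ring.
Qed.

Lemma fact_neq0 k : k`!%:R != 0 :> rat.
Proof. by rewrite pnatr_eq0 -lt0n fact_gt0. Qed.

Lemma succr_neq0 k : k%:R + 1 != 0 :> rat.
Proof. by rewrite natr1 pnatr_eq0. Qed.

Definition hterm (n : rat) (k : nat) : rat :=
  poch 2^-1 k * poch (- n) k * poch (n + 1) k / k`!%:R ^+ 3.

Definition hsum (N : nat) (n : rat) : rat := \sum_(0 <= k < N) hterm n k.

Lemma hterm0 n : hterm n 0 = 1.
Proof. by rewrite /hterm !poch0 fact0; field. Qed.

Lemma htermS n k : hterm n k.+1 =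
  hterm n k * ((2^-1 + k%:R) * (k%:R - n) * (n + 1 + k%:R) / (k%:R + 1) ^+ 3).
Proof.
rewrite /hterm !pochS factS natrM -natr1.
by have := fact_neq0 k; have := succr_neq0 k => h1 h2; field; rewrite ?h1 ?h2.
Qed.

(** The quotient of [hterm (n + 1) k] by [hterm n k] is (n+1+k)/(n+1-k), which has a pole at k = n +
    1. Advancing k together with n removes it, and the relation holds for every n. *)
Lemma hterm_succ n k : hterm (n + 1) k.+1 =
  - hterm n k * ((2^-1 + k%:R) * (n + k%:R + 1) * (n + k%:R + 2) / (k%:R + 1) ^+ 3).
Proof.
elim: k => [|k IH]; first by rewrite htermS !hterm0; field.
rewrite htermS IH htermS -natr1.
have := succr_neq0 k; have := succr_neq0 k.+1; rewrite -natr1 => h1 h2; field.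
by rewrite ?h1 ?h2.
Qed.

Lemma hsum_reflect N n : hsum N (-1 - n) = hsum N n.
Proof.
apply: eq_bigr => k _; rewrite /hterm.
have -> : - (-1 - n) = n + 1 by ring.
have -> : -1 - n + 1 = - n by ring.
by ring.
Qed.

(* Found by Gosper's algorithm applied to the difference of both sides. *)
Lemma hsum_weighted N n : n != 0 ->
  \sum_(0 <= k < N) hterm n k / (k%:R + 1) ^+ 2 =
    2 * hsum N.+1 n + (2 * n ^+ 2 + 2 * n - 1) / n ^+ 2 * hsum N.+1 (n + 1)
    + hterm n N * (2 * (1 - 2 * n) / n ^+ 2 * (N%:R + 2^-1) - 4).
Proof.
move=> n0; elim: N => [|N IH].
  by rewrite big_geq // /hsum !big_nat1 !hterm0; field.
rewrite big_nat_recr //= IH /hsum [X in _ = 2 * X + _ + _]big_nat_recr //=.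
rewrite [X in _ = _ + _ * X + _]big_nat_recr //= htermS hterm_succ -natr1.
set A := \sum_(_ <= _ < _) _; set B := \sum_(_ <= _ < _) hterm (n + 1) _.
by have h := succr_neq0 N; field; rewrite n0 h.
Qed.

(** With [hterm_high], this puts the terms for n and n + 2 over one common factor, that of the
    certificate of [hsum_shift], so that the recurrence is verified by clearing denominators. *)
Lemma hterm_low n k : hterm n k.+2 = (n + 1) * (n + 2) * (k%:R - n) * (k%:R + 1 - n) *
  (poch 2^-1 k.+2 * poch (- n) k * poch (n + 3) k / k.+2`!%:R ^+ 3).
Proof.
rewrite /hterm [poch (n + 1) _]pochSl [poch (n + 1 + 1) _]pochSl.
rewrite (_ : n + 1 + 1 + 1 = n + 3); last by ring.
rewrite !pochS -natr1.
have := fact_neq0 k.+2 => h; field; exact: h.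
Qed.

Lemma hterm_high n k : hterm (n + 2) k.+2 = (n + 1) * (n + 2) * (n + k%:R + 3) * (n + k%:R + 4) *
  (poch 2^-1 k.+2 * poch (- n) k * poch (n + 3) k / k.+2`!%:R ^+ 3).
Proof.
rewrite /hterm [poch (- (n + 2)) _]pochSl.
rewrite [poch (- (n + 2) + 1) _]pochSl (_ : - (n + 2) + 1 + 1 = - n); last by ring.
rewrite (_ : n + 2 + 1 = n + 3); last by ring.
rewrite !pochS -natr1.
have := fact_neq0 k.+2 => h; field; exact: h.
Qed.

(* Zeilberger's recurrence in n, with the certificate as boundary term. *)
Lemma hsum_shift k n :
  (n + 2) ^+ 2 * hsum k.+2 (n + 2) - (n + 1) ^+ 2 * hsum k.+2 n =
  - 2 * (2 * n + 3) * (n + 1) * (n + 2) *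
    (poch 2^-1 k.+2 * poch (- n) k * poch (n + 3) k / k.+1`!%:R ^+ 3).
Proof.
elim: k => [|k IH].
  rewrite /hsum !big_nat_recr //= !big_geq // !htermS !hterm0.
  rewrite !pochS !poch0 (_ : 1`! = 1%N) // ?mulr0n ?(add0r, addr0, mul1r, expr1n, divr1).
  by field.
rewrite /hsum ![\sum_(0 <= _ < k.+3) _]big_nat_recr //= -!/(hsum _ _) mulrDr [X in _ - X]mulrDr.
have -> : forall a b c d : rat, a + b - (c + d) = (a - c) + (b - d) by move=> *; ring.
rewrite IH (hterm_low n) hterm_high [poch 2^-1 k.+3]pochS [poch (- n) k.+1]pochS.
rewrite [poch (n + 3) k.+1]pochS (factS k.+1) natrM -!natr1.
have := fact_neq0 k.+1; have := succr_neq0 k.+1; rewrite -natr1 => h1 h2; field.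
by rewrite ?h1 ?h2.
Qed.

(** Both sides are (2k)!(3k)!/(108^k k!^5): (1/2)_k contributes 4^k, and (1/3)_k (2/3)_k contributes
    27^k to the denominator. *)
Lemma hterm_central k : hterm (- 3^-1) k =
  'C(2 * k, k)%:R ^+ 2 * 'C(3 * k, k)%:R / 108 ^+ k.
Proof.
have E j : ('C(2 * j, j)%:R * 'C(3 * j, j)%:R * j`!%:R ^+ 3 = (3 * j)`!%:R :> rat) /\
    ('C(2 * j, j)%:R * j`!%:R ^+ 2 = (2 * j)`!%:R :> rat).
  have b2 := bin_fact (_ : j <= 2 * j)%N; have b3 := bin_fact (_ : j <= 3 * j)%N.
  rewrite (_ : 2 * j - j = j)%N in b2; last by lia.
  rewrite (_ : 3 * j - j = 2 * j)%N in b3; last by lia.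
  split; last by rewrite -b2 ?natrM; [ring | lia].
  by rewrite -b3 -?b2 ?natrM; [ring | lia | lia].
have key : hterm (- 3^-1) k * 108 ^+ k * k`!%:R ^+ 5 = (3 * k)`!%:R * (2 * k)`!%:R.
  elim: k => [|k IH]; first by rewrite hterm0 muln0 fact0; ring.
  have d3 : (3 * k.+1 = (3 * k).+3)%N by lia.
  have d2 : (2 * k.+1 = (2 * k).+2)%N by lia.
  rewrite htermS d3 d2.
  have f0 := fact_neq0 k; have k0 := succr_neq0 k.
  have e1 : k.+1`!%:R = (k%:R + 1) * k`!%:R :> rat by rewrite factS natrM natr1.
  have e2 : (2 * k).+2`!%:R = (2 * k%:R + 2) * (2 * k%:R + 1) * (2 * k)`!%:R :> rat.
    rewrite !factS !natrM mulrA -[(2 * k).+2]addn2 -[(2 * k).+1]addn1.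
    by rewrite (natrD _ (2 * k)) (natrD _ (2 * k)) !natrM.
  have e3 : (3 * k).+3`!%:R = (3 * k%:R + 3) * (3 * k%:R + 2) * (3 * k%:R + 1) * (3 * k)`!%:R :> rat.
    rewrite !factS !natrM !mulrA -[(3 * k).+3]addn3 -[(3 * k).+2]addn2 -[(3 * k).+1]addn1.
    by rewrite !(natrD _ (3 * k)) !natrM.
  rewrite e1 e2 e3 [108 ^+ k.+1]exprS.
  transitivity ((hterm (- 3^-1) k * 108 ^+ k * k`!%:R ^+ 5) *
    (108 * (2^-1 + k%:R) * (k%:R + 3^-1) * (k%:R + 2 / 3) * (k%:R + 1) ^+ 2)).
    set H := hterm _ _; set D := 108 ^+ k; by field.
  by rewrite IH; field.
have c0 : 108 ^+ k != 0 :> rat by rewrite expf_neq0.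
have f0 := fact_neq0 k; case: (E k) => e3 e2.
apply: (mulIf (expf_neq0 5 f0)); apply: (mulIf c0).
by rewrite mulrAC key -e3 -e2; field.
Qed.

(** * Alternating sums of binomial coefficients over powers of k *)

Lemma sum_alt_bin N h : (0 < h < N)%N ->
  \sum_(0 <= k < N) (-1) ^+ k * 'C(h, k)%:R = 0 :> rat.
Proof.
case/andP=> h0 hN; rewrite (@sum_nat_cat h.+1) // [X in _ + X]big1_seq ?addr0; last first.
  by move=> i; rewrite mem_index_iota => /andP [_ /andP [hi _]]; rewrite bin_small // mulr0.
have := exprDn (1 : rat) (-1) h; rewrite subrr expr0n (gtn_eqF h0) => E.
rewrite big_mkord [RHS]E; apply: eq_bigr => i _.
by rewrite expr1n mul1r mulr_natr.
Qed.

Lemma sum_alt_bin1 N h : (0 < h < N)%N ->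
  \sum_(1 <= k < N) (-1) ^+ k * 'C(h, k)%:R = - 1 :> rat.
Proof.
move=> hN; have := sum_alt_bin hN; rewrite big_ltn ?expr0 ?bin0 ?mul1r; last by lia.
by move=> /eqP; rewrite addrC addr_eq0 => /eqP.
Qed.

(** After division by k^j the extra term only has k^(j-1) in the denominator. Hence the next two
    sums follow by induction on h, each from the previous one. *)
Lemma bin_step h k : (0 < k)%N ->
  'C(h.+1, k)%:R = 'C(h, k)%:R + k%:R * 'C(h.+1, k)%:R / h.+1%:R :> rat.
Proof.
case: k => // k _; rewrite {1}binS natrD; congr (_ + _).
by rewrite -natrD -binS -natrM -mul_bin_diag natrM mulrC mulKf // pnatr_eq0.
Qed.

Lemma sum_alt_bin_inv N h : (h < N)%N ->
  \sum_(1 <= k < N) (-1) ^+ k * 'C(h, k)%:R * k%:R^-1 = - harm 1 h :> rat.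
Proof.
elim: h => [|h IH] hN.
  rewrite harm0 oppr0 big1_seq // => k; rewrite mem_index_iota => /andP [_ hk].
  by rewrite bin_small ?mulr0 ?mul0r //; case/andP: hk.
rewrite /harm big_nat_recr //= opprD -/(harm 1 h) -(IH (ltnW hN)) expr1.
have -> : - h.+1%:R^-1 = (\sum_(1 <= k < N) (-1) ^+ k * 'C(h.+1, k)%:R) * h.+1%:R^-1 :> rat.
  by rewrite sum_alt_bin1 // mulN1r.
rewrite mulr_suml -big_split /=.
apply: eq_big_nat => k hk; rewrite [in LHS]bin_step; last by case/andP: hk.
have k0 : k%:R != 0 :> rat by rewrite pnatr_eq0; lia.
have h0 : h.+1%:R != 0 :> rat by rewrite pnatr_eq0.
by move: (h.+1%:R) h0 => b b0; field; rewrite ?k0 ?b0.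
Qed.

Lemma sum_alt_bin_inv_sqr N h : (h < N)%N ->
  \sum_(1 <= k < N) (-1) ^+ k * 'C(h, k)%:R * k%:R^-1 ^+ 2 =
    - (harm 1 h ^+ 2 + harm 2 h) / 2 :> rat.
Proof.
elim: h => [|h IH] hN.
  rewrite !harm0 big1_seq => [|k]; first by field.
  by rewrite mem_index_iota => /andP [_ hk]; rewrite bin_small ?mulr0 ?mul0r //; case/andP: hk.
have -> : - (harm 1 h.+1 ^+ 2 + harm 2 h.+1) / 2 =
    - (harm 1 h ^+ 2 + harm 2 h) / 2 + - harm 1 h.+1 * h.+1%:R^-1.
  have h0 : h.+1%:R != 0 :> rat by rewrite pnatr_eq0.
  by rewrite /harm !(@big_nat_recr _ _ _ h.+1) //=; move: (h.+1%:R) h0 => b b0; field.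
rewrite -IH ?(ltnW hN) // -(sum_alt_bin_inv hN) mulr_suml -big_split /=.
apply: eq_big_nat => k hk; rewrite [in LHS]bin_step; last by case/andP: hk.
have k0 : k%:R != 0 :> rat by rewrite pnatr_eq0; lia.
have h0 : h.+1%:R != 0 :> rat by rewrite pnatr_eq0.
by move: (h.+1%:R) h0 => b b0; field; rewrite ?k0 ?b0.
Qed.

Lemma poch_neg_nat h k : poch (- h%:R) k = (-1) ^+ k * 'C(h, k)%:R * k`!%:R.
Proof.
rewrite -mulrA -natrM bin_ffact; elim: k => [|k IH].
  by rewrite poch0 ffactn0 expr0 mul1r.
rewrite pochS IH ffactnSr natrM exprS.
have [kh|hk] := leqP k h; first by rewrite natrB //; ring.
by rewrite ffact_small //; ring.
Qed.

Lemma prod_nat_factor (p : nat) (f : nat -> rat) m n i0 : (m <= i0 < n)%N ->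
  (forall i, (m <= i < n)%N -> f i \in pint p) ->
  exists2 c, c \in pint p & \prod_(m <= i < n) f i = f i0 * c.
Proof.
move=> h fZ; exists (\prod_(m <= i < n | i != i0) f i).
  by rewrite big_nat_cond; apply: rpred_prod => i /andP [hi _]; exact: fZ.
by rewrite (bigD1_seq i0) ?mem_index_iota ?iota_uniq.
Qed.

(** * The recurrence for F modulo p^3 *)

Section Congruences.

Variable p : prime_gt3.
Local Notation p_pr := (pval_prime p).
Local Notation p_gt3 := (pval_gt3 p).
Local Notation P := (p%:R : rat).
Local Notation Z_ := (pint p).
Local Notation "a ==[ k ] b" := (cg p k a b) (at level 70).
Let co6 := coprime_p6 p.
Let F := hsum p.

Lemma pint_poch a k : a \in Z_ -> poch a k \in Z_.
Proof. by move=> aZ; apply: pint_prod_nat => i _; zp. Qed.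

Lemma cg_poch j a b k : b \in Z_ -> a ==[j] b -> poch a k ==[j] poch b k.
Proof.
move=> bZ ab; apply: cg_prod_nat => i _; first by zp.
exact: cgD ab (cg_refl _ _ _).
Qed.

Lemma punit_fact k : (k < p)%N -> punit p k`!%:R.
Proof.
elim: k => [|k IH] kp; first by rewrite fact0; apply: (@punit_small p 1); have := p_gt3; lia.
by rewrite factS natrM; apply: punitM; [apply: punit_small; lia | apply: IH; lia].
Qed.

Lemma poch_half : exists2 c, c \in Z_ & poch 2^-1 p = P * c.
Proof.
have p3 := p_gt3; have po : odd p by case: (even_prime p_pr) => // p2; lia.
have [] := @prod_nat_factor p (fun i => 2^-1 + i%:R) 0 p ((p - 1) %/ 2).
- by lia.
- by move=> i _; zp.
move=> c cZ E; exists (2^-1 * c); first by zp.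
rewrite /poch E mulrA; congr (_ * _).
have -> : P = 2 * ((p - 1) %/ 2)%:R + 1.
  by rewrite -natrM natr1; congr (_%:R); lia.
by field.
Qed.

Lemma poch_factor a k i : (i < k)%N -> a \in Z_ ->
  exists2 c, c \in Z_ & poch a k = (a + i%:R) * c.
Proof.
by move=> ik aZ; apply: (@prod_nat_factor p (fun i => a + i%:R) 0 k) => // j _; zp.
Qed.

Let pE2 : (p - 2).+2 = p. Proof. by have := p_gt3; lia. Qed.
Let pE1 : (p - 2).+1 = (p - 1)%N. Proof. by have := p_gt3; lia. Qed.

(** With n = ps + v, each of the three Pochhammer symbols in the boundary term contains a multiple
    of p: at index (p-1)/2 in (1/2)_p, v in (-n)_(p-2), and p-3-v in (n+3)_(p-2). The denominator
    (p-1)!^3 is prime to p. *)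
Lemma hsum_step (s : rat) (v : nat) : s \in Z_ -> (v <= p - 3)%N ->
  (P * s + v%:R + 2) ^+ 2 * F (P * s + v%:R + 2) ==[3]
  (P * s + v%:R + 1) ^+ 2 * F (P * s + v%:R).
Proof.
move=> sZ vp; set n := P * s + v%:R; have p3 := p_gt3.
have nZ : n \in Z_ by rewrite /n; zp.
have := hsum_shift (p - 2) n; rewrite pE2 pE1 -/F => /eqP; rewrite subr_eq => /eqP ->.
have [c1 z1 ->] := poch_half.
have [c2 z2 ->] := @poch_factor (- n) (p - 2) v (ltac:(lia)) (ltac:(zp)).
have [c3 z3 ->] := @poch_factor (n + 3) (p - 2) (p - 3 - v) (ltac:(lia)) (ltac:(zp)).
have -> : - n + v%:R = P * (- s) by rewrite /n; ring.
have -> : n + 3 + (p - 3 - v)%:R = P * (s + 1) by rewrite /n !natrB //; [ring | lia].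
have zf := punitV_pint (punit_fact (_ : p - 1 < p)%N); move: zf; set f := (p - 1)`!%:R => zf.
exists (- 2 * (2 * n + 3) * (n + 1) * (n + 2) * (c1 * (- s * c2) * ((s + 1) * c3) * f^-1 ^+ 3)).
  by have := zf (ltac:(lia)) => zf'; zp.
by rewrite -exprVn; ring.
Qed.

Lemma hsum_even (s : rat) r : s \in Z_ -> (2 * r <= p - 1)%N ->
  F (P * s + (2 * r)%:R) ==[3]
  (\prod_(1 <= i < r.+1) ((P * s + (2 * i - 1)%:R) / (P * s + (2 * i)%:R))) ^+ 2 * F (P * s).
Proof.
move=> sZ; elim: r => [|r IH] hr.
  by rewrite muln0 addr0 big_geq // expr1n mul1r; exact: cg_refl.
have {}IH := IH (ltac:(lia)).
have u : punit p (P * s + (2 * r.+1)%:R).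
  apply: (@punit_cg p _ (2 * r.+1)%:R); last by apply: punit_small; have := p_gt3; lia.
  by exists s => //; rewrite expr1 addrC.
have := @hsum_step s (2 * r) sZ (ltac:(lia)).
have e2 : P * s + (2 * r)%:R + 2 = P * s + (2 * r.+1)%:R.
  by rewrite mulnS natrD; ring.
have e1 : P * s + (2 * r)%:R + 1 = P * s + (2 * r.+1 - 1)%:R.
  by rewrite mulnS add2n subn1 -natr1; ring.
rewrite e2 e1 => H; rewrite big_nat_recr //=.
apply: (@cg_cancel p 3 ((P * s + (2 * r.+1)%:R) ^+ 2)); first by rewrite expr2; exact: punitM.
apply: cg_trans H _.
apply: cg_trans (cgMl _ IH) _; first by zp.
by move: (punit_neq0 u); move: (_ + (2 * r.+1)%:R) => D D0; apply: eq_cg; field.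
Qed.

Lemma hsum_odd (s : rat) r : s \in Z_ -> (2 * r + 1 <= p - 1)%N ->
  F (P * s + 1 + (2 * r)%:R) ==[3]
  (\prod_(1 <= i < r.+1) ((P * s + (2 * i)%:R) / (P * s + (2 * i + 1)%:R))) ^+ 2 * F (P * s + 1).
Proof.
move=> sZ; elim: r => [|r IH] hr.
  by rewrite muln0 addr0 big_geq // expr1n mul1r; exact: cg_refl.
have {}IH := IH (ltac:(lia)).
have u : punit p (P * s + (2 * r.+1 + 1)%:R).
  apply: (@punit_cg p _ (2 * r.+1 + 1)%:R); last by apply: punit_small; have := p_gt3; lia.
  by exists s => //; rewrite expr1 addrC.
have := @hsum_step s (2 * r).+1 sZ (ltac:(lia)).
have e2 : P * s + (2 * r).+1%:R + 2 = P * s + (2 * r.+1 + 1)%:R.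
  by rewrite mulnS -natr1 !natrD; ring.
have e1 : P * s + (2 * r).+1%:R + 1 = P * s + (2 * r.+1)%:R.
  by rewrite mulnS -natr1 natrD; ring.
have e0 : P * s + (2 * r).+1%:R = P * s + 1 + (2 * r)%:R by rewrite -natr1; ring.
have e3 : P * s + 1 + (2 * r.+1)%:R = P * s + (2 * r.+1 + 1)%:R by rewrite natrD; ring.
rewrite e2 e1 e0 => H; rewrite big_nat_recr //= e3.
apply: (@cg_cancel p 3 ((P * s + (2 * r.+1 + 1)%:R) ^+ 2)); first by rewrite expr2; exact: punitM.
apply: cg_trans H _.
apply: cg_trans (cgMl _ IH) _; first by zp.
by move: (punit_neq0 u); move: (_ + (2 * r.+1 + 1)%:R) => D D0; apply: eq_cg; field.
Qed.

End Congruences.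

(** * Expansion of F at ps and ps + 1 *)

Lemma poch_conj m k : poch (1 - m) k * poch (m + 1) k =
  k`!%:R ^+ 2 * \prod_(1 <= i < k.+1) (1 - m ^+ 2 * i%:R^-1 ^+ 2).
Proof.
elim: k => [|k IH]; first by rewrite !poch0 big_geq // fact0; ring.
rewrite !pochS big_nat_recr //= factS natrM.
transitivity ((poch (1 - m) k * poch (m + 1) k) * (k.+1%:R ^+ 2 - m ^+ 2)).
  by rewrite -natr1; ring.
rewrite IH; have := succr_neq0 k; rewrite natr1; move: (k.+1%:R) => b b0.
by field.
Qed.

(** Extracts the factor m(m+k+1) and leaves a product in m^2. For m = ps that product is 1 modulo
    p^2, so a term of F(ps) contributes only at orders p and p^2. *)
Lemma hterm_conj m k : hterm m k.+1 = - (poch 2^-1 k.+1 / k.+1`!%:R) *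
  (m * (m + k.+1%:R) * k.+1%:R^-1 ^+ 2) * \prod_(1 <= i < k.+1) (1 - m ^+ 2 * i%:R^-1 ^+ 2).
Proof.
rewrite /hterm [poch (- m) _]pochSl [poch (m + 1) _]pochS [- m + 1]addrC.
transitivity (poch 2^-1 k.+1 * (- m * (m + 1 + k%:R)) * (poch (1 - m) k * poch (m + 1) k) / k.+1`!%:R ^+ 3).
  by ring.
rewrite poch_conj factS natrM.
have -> : m + 1 + k%:R = m + k.+1%:R by rewrite -natr1; ring.
have := succr_neq0 k; rewrite natr1; move: (k.+1%:R) => b b0.
by field; rewrite ?b0 fact_neq0.
Qed.

Section Congruences.

Variable p : prime_gt3.
Local Notation p_pr := (pval_prime p).
Local Notation p_gt3 := (pval_gt3 p).
Local Notation P := (p%:R : rat).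
Local Notation Z_ := (pint p).
Local Notation "a ==[ k ] b" := (cg p k a b) (at level 70).
Let co6 := coprime_p6 p.
Let F := hsum p.

Let c k := poch 2^-1 k / k`!%:R.

Let zc k : (k < p)%N -> c k \in Z_.
Proof.
move=> kp; have zf := punitV_pint (punit_fact kp).
by rewrite /c; apply: rpredM => //; apply: pint_poch; zp.
Qed.

Let hterm_cg s k : s \in Z_ -> (0 < k < p)%N ->
  hterm (P * s) k ==[3] P * (s * - (c k * k%:R^-1)) + P ^+ 2 * (s ^+ 2 * - (c k * k%:R^-1 ^+ 2)).
Proof.
case: k => // k sZ hk; have zk := pint_inv_small hk.
have zck := zc (proj2 (andP hk)); rewrite hterm_conj -/(c k.+1).
have H : \prod_(1 <= i < k.+1) (1 - (P * s) ^+ 2 * i%:R^-1 ^+ 2) ==[2] 1.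
  apply: (@cg_trans _ _ (\prod_(1 <= i < k.+1) 1)); last by rewrite big1 //; exact: cg_refl.
  apply: cg_prod_nat => i hi; first by zp.
  have zi : i%:R^-1 \in Z_ by apply: pint_inv_small; lia.
  by exists (- (s ^+ 2 * i%:R^-1 ^+ 2)); zp; ring.
case: H => e eZ ->.
exists (- c k.+1 * (s * (P * s + k.+1%:R) * k.+1%:R^-1 ^+ 2) * e); first by zp.
have := punit_neq0 (punit_small hk); move: (k.+1%:R) => b b0.
by field.
Qed.

(** The coefficients of ps and p^2 s^2 in F(ps), the same for all s. [be] is computed directly
    modulo p; [al], required modulo p^2, is then deduced from the known value at s = -1. *)
Let al := \sum_(1 <= k < p) - (c k * k%:R^-1).
Let be := \sum_(1 <= k < p) - (c k * k%:R^-1 ^+ 2).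

Let zal : al \in Z_.
Proof.
apply: pint_sum_nat => k hk; have := pint_inv_small hk.
by case/andP: hk => _ /zc h1 h2; zp.
Qed.

Let zbe : be \in Z_.
Proof.
apply: pint_sum_nat => k hk; have := pint_inv_small hk.
by case/andP: hk => _ /zc h1 h2; zp.
Qed.

Let hsum_ser0 s : s \in Z_ -> ser p (F (P * s)) 1 (s * al) (s ^+ 2 * be).
Proof.
move=> sZ; split; zp; have p3 := p_gt3.
rewrite /F /hsum big_ltn ?hterm0; last by lia.
rewrite -addrA; apply: cgD; first exact: cg_refl.
rewrite /al /be !mulr_sumr -big_split /=; apply: cg_sum_nat => k hk.
by apply: cg_trans (hterm_cg sZ hk) _; apply: eq_cg; ring.
Qed.

Section Half.

Variables (h : nat) (pE : p = (2 * h + 1)%N :> nat).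
Let q2 := fermat_quotient p 2.

Let zq2 : q2 \in Z_. Proof. exact: pint_q2 pE. Qed.

(** Modulo p the number 1/2 is -h, so (1/2)_k / k! becomes (-1)^k times the binomial coefficient of
    h over k, and [sum_alt_bin_inv_sqr] applies. *)
Let be_cg : be ==[1] 2 * q2 ^+ 2.
Proof.
have p3 := p_gt3; have h1 := harm1_half pE; have h2 := harm2_half pE; rewrite -/q2 in h1.
have zh1 : harm 1 h \in Z_ by apply: pint_harm; lia.
have H : be ==[1] - \sum_(1 <= k < p) (-1) ^+ k * 'C(h, k)%:R * k%:R^-1 ^+ 2.
  rewrite /be -sumrN; apply: cg_sum_nat => k hk; apply: cgN.
  have zk := pint_inv_small hk; apply: cgMr; first by zp.
  have kp : (k < p)%N by case/andP: hk.
  have zf := punitV_pint (punit_fact kp).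
  have -> : (-1) ^+ k * 'C(h, k)%:R = poch (- h%:R) k / k`!%:R.
    by rewrite poch_neg_nat mulfK // fact_neq0.
  apply: cgMr => //; apply: cg_poch; first by zp.
  by exists 2^-1; zp; rewrite expr1 pE natrD natrM; field.
apply: cg_trans H _; rewrite sum_alt_bin_inv_sqr; last by lia.
have -> : 2 * q2 ^+ 2 = - (- ((- 2 * q2) ^+ 2 + 0) / 2) by field.
apply: cgN; apply: cgMr; first by zp.
apply: cgN; apply: cgD h2; apply: cgX; first by zp.
apply: cg_trans (cgW (isT : 1 <= 2)%N h1) _.
by exists (q2 ^+ 2); zp; ring.
Qed.

(* F (-p) = F (p - 1), which [hsum_even] at s = 0 gives as a product. *)
Let hsum_central : F (P * -1) ==[3] (2 ^+ (p - 1)) ^+ 2.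
Proof.
have p3 := p_gt3.
have -> : P * -1 = -1 - (2 * h)%:R by rewrite pE natrD; ring.
rewrite /F hsum_reflect.
have := @hsum_even p 0 h (rpred0 _); rewrite mulr0 !add0r => /(_ (ltac:(lia))) H.
apply: cg_trans H _.
have -> : hsum p 0 = 1.
  rewrite /hsum big_ltn ?hterm0; last by lia.
  rewrite big1_seq ?addr0 // => k; rewrite mem_index_iota => /andP [_ /andP [k0 _]].
  by case: k k0 => // k _; rewrite hterm_conj; ring.
rewrite mulr1.
(* Reversing the order of the numerators turns 2i - 1 into p - 2i. That the resulting product is
   2^(p-1) modulo p^3 up to sign is Morley's congruence, as the original product is C(2h,h)/4^h. *)
have -> : \prod_(1 <= i < h.+1) ((0 + (2 * i - 1)%:R) / (0 + (2 * i)%:R))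
   = (-1) ^+ h * \prod_(1 <= i < h.+1) (1 + P * (- 2^-1 * i%:R^-1)).
  have -> : (-1) ^+ h = \prod_(1 <= i < h.+1) -1 :> rat.
    by rewrite prodr_const_nat subn1.
  rewrite prodf_div -big_split /=.
  have -> : \prod_(1 <= i < h.+1) (0 + (2 * i - 1)%:R) = \prod_(1 <= i < h.+1) (P - (2 * i)%:R) :> rat.
    rewrite big_nat_rev /=; apply: eq_big_nat => i hi.
    by rewrite add0r -natrB; [congr _%:R; lia | lia].
  rewrite -prodf_div; apply: eq_big_nat => i hi.
  rewrite add0r natrM; have : i%:R != 0 :> rat by rewrite pnatr_eq0; lia.
  by move=> i0; field.
rewrite exprMn sqrr_sign mul1r.
have zi i : (1 <= i < h.+1)%N -> i%:R^-1 \in Z_ by move=> hi; apply: pint_inv_small; lia.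
have z2 : - 2^-1 \in Z_ by zp.
have s := ser_prod z2 zi.
have zh : harm 1 h \in Z_ by apply: pint_harm; lia.
apply: cgX; first exact: ser_pint (ser_pow2 pE).
apply: ser_cg _ (ser_pow2 pE).
apply: ser_cg2; first (apply: ser_eq s _ _ _ _; [by [] | by [] | | by []]).
- by rewrite /harm; under [in LHS]eq_bigr => i _ do rewrite expr1; ring.
- by zp.
have -> : harm 1 h ^+ 2 / 8 = (- 2^-1) ^+ 2 * (harm 1 h ^+ 2 - 0) / 2 by field.
apply: cgMr; first by zp.
apply: cgMl; first by zp.
apply: cgB (harm2_half pE); apply: eq_cg; congr (_ ^+ 2).
Qed.

Let al_cg : al ==[2] - 2 * q2 + P * q2 ^+ 2.
Proof.
have s1 := hsum_ser0 (_ : -1 \in Z_); have {}s1 := s1 (ltac:(zp)).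
have s2 : ser p (F (P * -1)) 1 (2 * q2) (q2 ^+ 2).
  apply: cg_ser hsum_central _.
  have s : ser p (2 ^+ (p - 1)) 1 q2 0.
    by rewrite pow_fermat_quotient; apply: ser_lin; zp.
  apply: ser_eq (serM s s) _ _ _ _; [by rewrite expr2 | ring | ring | ring].
have H := ser_inj s1 s2.
have B : P * be ==[2] P * (2 * q2 ^+ 2) by rewrite -[P]expr1; exact: (@cgMp p 1 1 _ _ be_cg).
by apply: (eq_cg2 (cgB B H)); ring.
Qed.

Lemma hsum_ser s : s \in Z_ ->
  ser p (F (P * s)) 1 (- 2 * q2 * s) ((s + 2 * s ^+ 2) * q2 ^+ 2).
Proof.
move=> sZ; have e1 : s * al ==[2] - 2 * q2 * s + P * (s * q2 ^+ 2).
  by apply: cg_trans (cgMl sZ al_cg) _; apply: eq_cg; ring.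
have e2 : s ^+ 2 * be ==[1] 2 * s ^+ 2 * q2 ^+ 2.
  by apply: cg_trans (cgMl _ be_cg) _; [zp | apply: eq_cg; ring].
have := ser_cg1 (ser_cg2 (hsum_ser0 sZ) _ e2) _ _ e1 => H.
by apply: ser_eq (H _ _ _) _ _ _ _ => //; zp; ring.
Qed.

(** The recurrence from ps - 1 to ps + 1, where reflection gives F(ps - 1) = F(-ps). Here the
    boundary term has order p^2 only: one p from n + 1 = ps and one from (1/2)_p. Its Pochhammer
    part X is therefore evaluated modulo p^2. *)
Lemma hsum_succ s : s \in Z_ -> F (P * s + 1) ==[3] P ^+ 2 * (s ^+ 2 + s).
Proof.
move=> sZ; have p3 := p_gt3.
have pE2 : (p - 2).+2 = p by lia.
have pE1 : (p - 2).+1 = (p - 1)%N by lia.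
have := hsum_shift (p - 2) (P * s - 1); rewrite pE2 pE1 -/F.
have -> : P * s - 1 + 2 = P * s + 1 by ring.
have -> : P * s - 1 + 1 = P * s by ring.
have -> : P * s - 1 + 3 = P * s + 2 by ring.
have -> : - (P * s - 1) = 1 - P * s by ring.
have -> : P * s - 1 = - 1 - P * (- s) by ring.
rewrite {2}/F hsum_reflect -/F => /eqP; rewrite subr_eq => /eqP E.
have u : punit p (P * s + 1).
  apply: (@punit_cg p _ 1%:R); last by apply: punit_small; lia.
  by exists s => //; rewrite expr1 addrC.
apply: (@cg_cancel p 3 ((P * s + 1) ^+ 2)); first by rewrite expr2; exact: punitM.
have F1 : F (P * - s) ==[1] 1.
  case: (hsum_ser0 (_ : - s \in Z_)); first by zp.
  move=> _ z1 z2 /(cgW (isT : 1 <= 3)%N) H; apply: cg_trans H _.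
  by exists (- s * al + P * ((- s) ^+ 2 * be)); zp; ring.
have zf k : (k < p)%N -> k`!%:R^-1 \in Z_ by move=> kp; exact: punitV_pint (punit_fact kp).
have X : poch 2^-1 p * poch (1 - P * s) (p - 2) * poch (P * s + 2) (p - 2) / (p - 1)`!%:R ^+ 3
   ==[2] P * - 2^-1.
  (* The factor of index h in (1/2)_p is p/2. Modulo p the parts before and after it are h! up to
     sign, and (-1)^h h!^2 is (p-1)!. What is left of X/p is (p-1)!^2 (p-2)!/(2 (p-1)!^3) =
     1/(2(p-1)), that is -1/2. *)
  have -> : poch 2^-1 p = P * (2^-1 * (poch (P / 2 + 1) h * poch 2^-1 h)).
    have -> : (p : nat) = (h + h.+1)%N by lia.
    have cat a m n : poch a (m + n) = poch a m * poch (a + m%:R) n.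
      elim: n => [|n IH]; first by rewrite addn0 poch0 mulr1.
      by rewrite addnS !pochS IH natrD; ring.
    rewrite cat pochSl (_ : 2^-1 + h%:R = P / 2).
      by rewrite (_ : (h + h.+1)%:R = P); [ring | rewrite pE; congr _%:R; lia].
    by rewrite pE natrD natrM; field.
  have -> : poch 2^-1 h = (-1) ^+ h * poch (1 - P / 2) h.
    rewrite /poch big_nat_rev /= -[h in X in _ = _ ^+ X * _]subn0 -prodr_const_nat -big_split /=.
    apply: eq_big_nat => i hi; rewrite pE add0n natrB; last by lia.
    by rewrite -natr1 natrD natrM; field.
  have a1 : poch (P / 2 + 1) h ==[1] h`!%:R.
    by rewrite -poch1; apply: cg_poch; zp; exists 2^-1; zp; ring.
  have a2 : poch (1 - P / 2) h ==[1] h`!%:R.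
    by rewrite -poch1; apply: cg_poch; zp; exists (- 2^-1); zp; ring.
  have a3 : poch (1 - P * s) (p - 2) ==[1] (p - 2)`!%:R.
    by rewrite -poch1; apply: cg_poch; zp; exists (- s); zp; ring.
  have a4 : poch (P * s + 2) (p - 2) ==[1] (p - 1)`!%:R.
    have -> : (p - 1)`!%:R = poch 2 (p - 2) :> rat by rewrite -poch1 -pE1 pochSl mul1r.
    by apply: cg_poch; zp; exists s; zp; ring.
  have w : (p - 1)`!%:R ==[1] (-1) ^+ h * h`!%:R * h`!%:R.
    rewrite (_ : p - 1 = h + h)%N -?(prod_rising_fact h h); last by lia.
    apply: cgMr; first by zp.
    have -> : h`!%:R = \prod_(0 <= i < h) (h - i)%:R :> rat.
      rewrite -poch1 /poch big_nat_rev /=; apply: eq_big_nat => i hi.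
      by rewrite nat1r; congr _%:R; lia.
    have -> : (-1) ^+ h = \prod_(0 <= i < h) -1 :> rat by rewrite prodr_const_nat subn0.
    rewrite -big_split big_add1 /=.
    apply: cg_prod_nat => i hi; first by zp.
    exists 1; rewrite ?rpred1 // expr1 mulr1 mulN1r addrC -natrB; last by lia.
    by congr _%:R; lia.
  have -> : P * (2^-1 * (poch (P / 2 + 1) h * ((-1) ^+ h * poch (1 - P / 2) h))) * poch (1 - P * s) (p - 2)
     * poch (P * s + 2) (p - 2) / (p - 1)`!%:R ^+ 3 =
     P * (2^-1 * (((-1) ^+ h * poch (1 - P / 2) h) * poch (P / 2 + 1) h) * (poch (1 - P * s) (p - 2)
     * poch (P * s + 2) (p - 2)) * (p - 1)`!%:R^-1 ^+ 3) by rewrite -exprVn; ring.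
  rewrite -[P]expr1; apply: (@cgMp p 1 1); rewrite expr1.
  have zf1 : (p - 1)`!%:R^-1 \in Z_ by apply: zf; lia.
  have H : 2^-1 * (((-1) ^+ h * poch (1 - P / 2) h) * poch (P / 2 + 1) h) * (poch (1 - P * s) (p - 2)
     * poch (P * s + 2) (p - 2)) * (p - 1)`!%:R^-1 ^+ 3 ==[1]
     2^-1 * (p - 1)`!%:R * ((p - 2)`!%:R * (p - 1)`!%:R) * (p - 1)`!%:R^-1 ^+ 3.
    apply: cgMr; first by zp.
    apply: cgM; zp.
      apply: cgMl; first by zp.
      apply: cg_trans _ (cg_sym w); apply: cgM; zp => //.
      by apply: cgMl; zp.
    by apply: cgM; zp.
  apply: cg_trans H _; rewrite -pE1 factS natrM.
  have -> : (p - 2).+1%:R = P - 1 by rewrite pE1 natrB //; lia.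
  have u1 : punit p (P - 1).
    by rewrite -(natrB _ (_ : 1 <= p)%N); [apply: punit_small; lia | lia].
  have f0 := fact_neq0 (p - 2).
  have u10 := punit_neq0 u1; have z := punitV_pint u1.
  by exists (2^-1 * (P - 1)^-1); zp; field; rewrite ?u10 ?f0.
rewrite E.
have e1 : (P * s) ^+ 2 * F (P * - s) ==[3] (P * s) ^+ 2 * 1.
  by case: F1 => f fZ ->; exists (s ^+ 2 * f); zp; ring.
case: X => e eZ ->; case: e1 => f fZ ->.
exists (f + s * (3 * s + 2 * P * s ^+ 2) - 2 * (2 * (P * s) + 1) * (P * s + 1) * s * e
  - (2 * s + P * s ^+ 2) * (s ^+ 2 + s)); first by zp.
by field.
Qed.

End Half.
End Congruences.

(** * The sum near - 1/3 *)

(** An exact identity, the factor being -(h+1-i)/i. It is written with p = 2h + 1 visible in the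
    numerators so that it can be compared with the product of [hsum_even] factor by factor. *)
Lemma bin_half_prod h r : (r <= h)%N ->
  (-1) ^+ r * 'C(h, r)%:R =
    \prod_(1 <= i < r.+1) (((2 * i - 1)%:R - (2 * h + 1)%:R) / (2 * i)%:R) :> rat.
Proof.
elim: r => [|r IH] hr; first by rewrite big_geq // bin0 expr0 mul1r.
rewrite big_nat_recr //= -IH ?(ltnW hr) // exprS.
have e : r.+1%:R * 'C(h, r.+1)%:R = (h - r)%:R * 'C(h, r)%:R :> rat.
  by rewrite -!natrM mul_bin_left.
have -> : (2 * r.+1 - 1)%:R - (2 * h + 1)%:R = -2 * (h - r)%:R :> rat.
  rewrite (natrB _ (ltnW hr)) (_ : 2 * r.+1 - 1 = 2 * r + 1)%N; last by lia.
  by rewrite !(natrD _ (2 * _)) !natrM; ring.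
rewrite natrM; have : r.+1%:R != 0 :> rat by rewrite pnatr_eq0.
move: e; move: (r.+1%:R) => b e b0.
have -> : 'C(h, r.+1)%:R = (h - r)%:R * 'C(h, r)%:R / b :> rat by rewrite -e; field.
by field.
Qed.

Section Thirds.

Variable p : prime_gt3.
Local Notation p_pr := (pval_prime p).
Local Notation p_gt3 := (pval_gt3 p).
Local Notation P := (p%:R : rat).
Local Notation Z_ := (pint p).
Local Notation "a ==[ k ] b" := (cg p k a b) (at level 70).
Let co6 := coprime_p6 p.
Let F := hsum p.

Variables (h r : nat) (pE : p = (2 * h + 1)%N :> nat) (rh : (r < h)%N).
Let q2 := fermat_quotient p 2.
Let zq2 : q2 \in Z_. Proof. exact: pint_q2 pE. Qed.
Local Notation C := ('C(h, r)%:R : rat).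

Lemma punit_bin : punit p C.
Proof.
have uf k : (k <= h)%N -> punit p k`!%:R by move=> kh; apply: punit_fact; lia.
have e : C * (r`!%:R * (h - r)`!%:R) = h`!%:R by rewrite -!natrM bin_fact // ltnW.
have -> : C = h`!%:R / (r`!%:R * (h - r)`!%:R).
  by rewrite -e mulfK // mulf_neq0 ?fact_neq0.
apply: punitM; first exact: uf.
by apply: punitV; apply: punitM; apply: uf; lia.
Qed.

Let x i := (2 * i - 1)%:R^-1 : rat.
Let zx i : (1 <= i < r.+1)%N -> x i \in Z_.
Proof. by move=> hi; apply: pint_inv_small; lia. Qed.
Let zy i : (1 <= i < r.+1)%N -> i%:R^-1 \in Z_.
Proof. by move=> hi; apply: pint_inv_small; lia. Qed.

Let sum_x k : \sum_(1 <= i < r.+1) x i ^+ k = harm k (2 * r) - 2^-1 ^+ k * harm k r.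
Proof.
rewrite [harm k (2 * r)](sum_even_odd (fun i => i%:R^-1 ^+ k) (leqnn (2 * r))) (_ : (2 * r)./2 = r); last by lia.
rewrite (_ : r - uphalf (2 * r) = 0)%N; last by lia.
rewrite /harm mulr_sumr [X in _ = X - _]addrC.
have -> : \sum_(1 <= i < r.+1) (2 * i)%:R^-1 ^+ k = \sum_(1 <= i < r.+1) 2^-1 ^+ k * i%:R^-1 ^+ k :> rat.
  by apply: eq_bigr => i _; rewrite natrM invfM exprMn.
rewrite addrK sum_nat_reflect; apply: eq_big_nat => i hi.
by congr (_%:R^-1 ^+ _); lia.
Qed.

Let serx c : c \in Z_ -> ser p (\prod_(1 <= i < r.+1) (1 + P * (c * x i))) 1
  (c * (harm 1 (2 * r) - harm 1 r / 2))
  (c ^+ 2 * ((harm 1 (2 * r) - harm 1 r / 2) ^+ 2 - (harm 2 (2 * r) - harm 2 r / 4)) / 2).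
Proof.
move=> zc; have := ser_prod zc zx; rewrite (sum_x 2).
have -> : \sum_(1 <= i < r.+1) x i = harm 1 (2 * r) - harm 1 r / 2.
  rewrite (eq_bigr (fun i => x i ^+ 1)) ?sum_x => [|i _]; last by rewrite expr1.
  by field.
by move/ser_eq; apply=> //; field.
Qed.

Let sery c : c \in Z_ -> ser p (\prod_(1 <= i < r.+1) (1 + P * (c * i%:R^-1))) 1
  (c * harm 1 r) (c ^+ 2 * (harm 1 r ^+ 2 - harm 2 r) / 2).
Proof.
move=> zc; have := ser_prod zc zy.
have -> : \sum_(1 <= i < r.+1) i%:R^-1 = harm 1 r.
  by apply: eq_bigr => i _; rewrite expr1.
by [].
Qed.

(** [A] and [D] come from the numerators 2i-1-p/3 and denominators 2i-p/3 of [hsum_even] at s =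
    -1/3, [B] from the numerators 2i-1-p of [bin_half_prod], each factor being divided by its value
    without p. *)
Let A := \prod_(1 <= i < r.+1) (1 + P * (- 3^-1 * x i)).
Let B := \prod_(1 <= i < r.+1) (1 + P * (- 1 * x i)).
Let D := \prod_(1 <= i < r.+1) (1 + P * (- 6^-1 * i%:R^-1)).

Let sA : ser p A _ _ _ := serx (ltac:(zp) : - 3^-1 \in Z_).
Let sB : ser p B _ _ _ := serx (ltac:(zp) : - 1 \in Z_).
Let sD : ser p D _ _ _ := sery (ltac:(zp) : - 6^-1 \in Z_).
Let u1 : punit p 1. Proof. by apply: (@punit_small p 1); have := p_gt3; lia. Qed.

Let ratio : \prod_(1 <= i < r.+1) ((P * - 3^-1 + (2 * i - 1)%:R) / (P * - 3^-1 + (2 * i)%:R))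
  = (-1) ^+ r * C * (A / (B * D)).
Proof.
have B0 : B != 0 := punit_neq0 (ser_unit sB u1).
have D0 : D != 0 := punit_neq0 (ser_unit sD u1).
rewrite bin_half_prod ?(ltnW rh) // -pE; apply: (mulIf (mulf_neq0 B0 D0)).
rewrite -[RHS]mulrA divfK ?mulf_neq0 // /A /B /D -!big_split /=.
apply: eq_big_nat => i hi.
have : (2 * i - 1)%:R != 0 :> rat by rewrite pnatr_eq0; lia.
have : i%:R != 0 :> rat by rewrite pnatr_eq0; lia.
have : P * - 3^-1 + (2 * i)%:R != 0.
  apply: (@punit_neq0 p); apply: (@punit_cg p _ (2 * i)%:R).
    by exists (- 3^-1); zp; rewrite addrC.
  by apply: punit_small; lia.
rewrite /x natrM; move: (i%:R) ((2 * i - 1)%:R) => a b d0 a0 b0.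
have d1 : P * -1 + 2 * a * 3 != 0.
  by apply: contraNneq d0 => d1; apply/eqP; transitivity ((P * -1 + 2 * a * 3) / 3); [field | rewrite d1 mul0r].
by field; rewrite a0 b0 d1.
Qed.

(** W is (A/(BD))^2 F(-p/3). Its coefficient of p^2 is written as f1^2/2 plus the coefficient of p^2
    in log W, the part that is additive over the factors. *)
Lemma hsum_even_third : exists2 W,
  (let f1 := (4 * harm 1 (2 * r) - harm 1 r) / 3 + 2 / 3 * q2 in
   ser p W 1 f1 (f1 ^+ 2 / 2 + 8 / 9 * harm 2 (2 * r) - 7 / 36 * harm 2 r - q2 ^+ 2 / 3))
  & F (P * - 3^-1 + (2 * r)%:R) ==[3] C ^+ 2 * W.
Proof.
have z3 : - 3^-1 \in Z_ by zp.
exists ((A / (B * D)) ^+ 2 * F (P * - 3^-1)).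
  have s1 := serM sA (serV _ (serM sB sD)); rewrite mulr1 in s1; have {}s1 := s1 u1.
  have := serM (serM s1 s1) (hsum_ser pE z3); rewrite -/q2 -expr2 => /ser_eq.
  by apply=> //; field.
have := hsum_even z3 (_ : (2 * r <= p - 1)%N); rewrite ratio => /(_ (ltac:(lia))) H.
apply: cg_trans H _; apply: eq_cg.
by rewrite /F !exprMn sqrr_sign mul1r; ring.
Qed.

(** [hsum_succ] at s = -1/3 yields -2/9 p^2, so the product of [hsum_odd] matters modulo p only.
    There the factors 2i/(2i+1) against (2i-1)/(2i) of [bin_half_prod] telescope to 1/(2r+1). *)
Lemma hsum_odd_third :
  F (P * - 3^-1 + 1 + (2 * r)%:R) ==[3] P ^+ 2 * (- (2 / 9) / ((2 * r + 1)%:R ^+ 2 * C ^+ 2)).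
Proof.
have z3 : - 3^-1 \in Z_ by zp.
apply: cg_trans (hsum_odd z3 (_ : (2 * r + 1 <= p - 1)%N)) _; first by lia.
have uC := punit_bin; have zC := punitV_pint uC; have zC' := punit_pint uC.
have u2 : punit p (2 * r + 1)%:R by apply: punit_small; lia.
have z2 := punitV_pint u2.
set X := \prod_(_ <= _ < _) _.
have ui c : (0 < c < p)%N -> punit p (P * - 3^-1 + c%:R).
  move=> hc; apply: (@punit_cg p _ c%:R); last exact: punit_small.
  by exists (- 3^-1) => //; rewrite expr1 addrC.
have XE : X * ((2 * r + 1)%:R * ((-1) ^+ r * C)) ==[1] 1.
  apply: (@cg_trans _ _ (\prod_(1 <= i < r.+1) 1)); last by rewrite big1 //; exact: cg_refl.
  have -> : (2 * r + 1)%:R = \prod_(1 <= i < r.+1) ((2 * i + 1)%:R / (2 * i - 1)%:R) :> rat.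
    have E k : \prod_(1 <= i < k.+1) ((2 * i + 1)%:R / (2 * i - 1)%:R) = (2 * k + 1)%:R :> rat.
      elim: k => [|k IH]; first by rewrite big_geq.
      rewrite big_nat_recr //= IH (_ : 2 * k.+1 - 1 = 2 * k + 1)%N; last by lia.
      by rewrite mulrC divfK // pnatr_eq0; lia.
    by rewrite E.
  rewrite bin_half_prod ?(ltnW rh) // -pE /X -!big_split /=.
  apply: cg_prod_nat => i hi; first by zp.
  have [n1 [n2 n3]] : (0 < 2 * i + 1 < p)%N /\ (0 < 2 * i < p)%N /\ (0 < 2 * i - 1 < p)%N.
    by lia.
  have h1 := punit_neq0 (punit_small n1); have h2 := punit_neq0 (punit_small n2).
  have h3 := punit_neq0 (punit_small n3).
  have w1 := punitV_pint (ui _ n1); have h4 := punit_neq0 (ui _ n1).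
  have w2 := pint_inv_small n2; have w3 := pint_inv_small n3.
  move: h1 h2 h3 h4 w1 w2 w3.
  have -> : (2 * i + 1)%:R = (2 * i)%:R + 1 :> rat by rewrite natrD.
  have -> : (2 * i - 1)%:R = (2 * i)%:R - 1 :> rat by rewrite natrB //; lia.
  have zb : (2 * i)%:R \in Z_ by zp.
  move: ((2 * i)%:R) zb => b zb h1 h2 h3 h4 w1 w2 w3.
  exists ((- (b + 1) * (b - 1) / 3 - b * (b + 1) + (b - 1) * b / 3 + P * (b + 1) / 3)
    * (P * - 3^-1 + (b + 1))^-1 * (b - 1)^-1 * b^-1); first by zp.
  have h5 : P * -1 + (b + 1) * 3 != 0.
    apply: contraNneq h4 => h5; apply/eqP.
    by transitivity ((P * -1 + (b + 1) * 3) / 3); [field | rewrite h5 mul0r].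
  by field; rewrite h2 h3 h5.
have XV : X ==[1] ((2 * r + 1)%:R * ((-1) ^+ r * C))^-1.
  have uu : punit p ((2 * r + 1)%:R * ((-1) ^+ r * C)).
    apply: punitM => //; rewrite -signr_odd; case: (odd r); rewrite ?expr0 ?expr1 ?mul1r //.
    by rewrite mulN1r; exact: punitN.
  apply: (@cg_cancel p 1 _ _ _ uu); rewrite divff ?(punit_neq0 uu) // mulrC.
  exact: XE.
have zV : ((2 * r + 1)%:R * ((-1) ^+ r * C))^-1 \in Z_.
  by rewrite !invfM -exprVn invrN1; zp.
have V2 := cgX 2 zV XV.
have V2' : X ^+ 2 ==[1] ((2 * r + 1)%:R ^+ 2 * C ^+ 2)^-1.
  by apply: cg_trans V2 _; apply: eq_cg; rewrite exprVn !exprMn sqrr_sign mul1r.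
have H := hsum_succ pE z3.
apply: cg_trans (cgMl _ H) _; first by rewrite (cg_pint V2); zp.
have -> : X ^+ 2 * (P ^+ 2 * ((- 3^-1) ^+ 2 - 3^-1)) = P ^+ 2 * (- (2 / 9) * X ^+ 2) by field.
by apply: (@cgMp p 2 1); apply: cgMl => //; zp.
Qed.

End Thirds.

(** * The sum of the theorem, and the case p = 2 mod 3 *)

Definition central_sum (p : nat) : rat := \sum_(0 <= k < p - 1)
    ('C(2 * k, k)%:R ^+ 2 * 'C(3 * k, k)%:R) / (108 ^+ k * (k%:R + 1) ^+ 2).

(** At n = -1/3 the coefficient (2n^2 + 2n - 1)/n^2 equals -13; this is where the constant 13 comes
    from. *)
Lemma hsum_weighted_third N :
  \sum_(0 <= k < N) hterm (- 3^-1) k / (k%:R + 1) ^+ 2 =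
    2 * hsum N.+1 (- 3^-1) - 13 * hsum N.+1 (- 3^-1 + 1)
    + hterm (- 3^-1) N * (30 * N%:R + 11).
Proof.
rewrite hsum_weighted //.
move: (hsum _ _) (hsum _ (_ + 1)) (hterm _ _) => a b c; by field.
Qed.

Section Main.

Variable p : prime_gt3.
Local Notation p_pr := (pval_prime p).
Local Notation p_gt3 := (pval_gt3 p).
Local Notation P := (p%:R : rat).
Local Notation Z_ := (pint p).
Local Notation "a ==[ k ] b" := (cg p k a b) (at level 70).
Let co6 := coprime_p6 p.
Let F := hsum p.

(** What remains is to see that the boundary term vanishes: (1/2)_(p-1), (1/3)_(p-1) and (2/3)_(p-1)
    each contain one multiple of p, and their product is divisible by p^3. *)
Lemma central_sum_hsum : central_sum p ==[3] 2 * F (- 3^-1) - 13 * F (- 3^-1 + 1).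
Proof.
have p3 := p_gt3; have po : odd p by case: (even_prime p_pr) => // p2; lia.
have pn0 : coprime p 3 by apply: coprime_dvdr (coprime_p6 p); vm_compute.
have n3 : ~~ (3 %| p)%N by rewrite -prime_coprime // coprime_sym.
have -> : central_sum p = \sum_(0 <= k < p - 1) hterm (- 3^-1) k / (k%:R + 1) ^+ 2.
  by apply: eq_bigr => k _; rewrite hterm_central invfM mulrA.
rewrite hsum_weighted_third; have -> : (p - 1).+1 = p by lia.
rewrite -[X in cg _ _ _ X]addr0; apply: cgD; first exact: cg_refl.
move: (30 * _ + 11) (ltac:(zp) : 30 * (p - 1)%:R + 11 \in Z_) => g zg.
rewrite /hterm opprK (_ : - 3^-1 + 1 = 2 / 3); last by field.
have zf : (p - 1)`!%:R^-1 \in Z_ by apply: punitV_pint; apply: punit_fact; lia.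
have [|c1 z1 ->] := @poch_factor p 2^-1 (p - 1) ((p - 1) %/ 2) _ (ltac:(zp)); first by lia.
have [i ip [e1 z1' E1]] : exists2 i, (i < p - 1)%N & exists2 e : rat, e \in Z_ & 3^-1 + i%:R = P * e.
  have [h|h] : (pval p = 3 * (p %/ 3) + 1 \/ pval p = 3 * (p %/ 3) + 2)%N by lia.
    exists (p %/ 3)%N; first by lia.
    by exists 3^-1; zp; rewrite [in RHS]h natrD natrM; field.
  exists (2 * (p %/ 3) + 1)%N; first by lia.
  by exists (2 / 3); zp; rewrite [in RHS]h (natrD _ (2 * _)) (natrD _ (3 * _)) !natrM; field.
have [j jp [e2 z2' E2]] : exists2 j, (j < p - 1)%N & exists2 e : rat, e \in Z_ & 2 / 3 + j%:R = P * e.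
  have [h|h] : (pval p = 3 * (p %/ 3) + 1 \/ pval p = 3 * (p %/ 3) + 2)%N by lia.
    exists (2 * (p %/ 3))%N; first by lia.
    by exists (2 / 3); zp; rewrite [in RHS]h natrD !natrM; field.
  exists (p %/ 3)%N; first by lia.
  by exists 3^-1; zp; rewrite [in RHS]h natrD natrM; field.
have [c2 z2 ->] := @poch_factor p 3^-1 (p - 1) i ip (ltac:(zp)).
have [c3 z3 ->] := @poch_factor p (2 / 3) (p - 1) j jp (ltac:(zp)).
have -> : 2^-1 + ((p - 1) %/ 2)%:R = P * 2^-1.
  have -> : P = 2 * ((p - 1) %/ 2)%:R + 1 by rewrite -natrM natr1; congr (_%:R); lia.
  by field.
rewrite E1 E2; exists (2^-1 * c1 * (e1 * c2) * (e2 * c3) * (p - 1)`!%:R^-1 ^+ 3 * g); first by zp.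
by rewrite -exprVn; ring.
Qed.

Section Case2.

Variables (r : nat) (pr : p = (6 * r + 5)%N :> nat).
Let h := (3 * r + 2)%N.
Local Notation C := ('C(h, r)%:R : rat).
Let q2 := fermat_quotient p 2.
Let q3 := fermat_quotient p 3.

Lemma central_sum_case2 : central_sum p ==[3]
  - 13 * C ^+ 2 *
          (1 + P * (2 + 4 / 3 * q2 - 3 / 2 * q3)
             + P ^+ 2 * (1 + 8 / 3 * q2 + 2 / 9 * q2 ^+ 2 - 3 * q3
                           - 2 * q2 * q3 + 15 / 8 * q3 ^+ 2
                           + 3 / 4 * (U (p - 3))%:~R))
        - P ^+ 2 * C ^- 2.
Proof.
have pE : p = (2 * h + 1)%N :> nat by rewrite pr /h; lia.
have rh : (r < h)%N by rewrite /h; lia.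
pose M := (2 * r + 1)%N.
have pM : p = (3 * M + 2)%N :> nat by rewrite pr /M; lia.
have hM : (h - uphalf M)%N = M by rewrite /h /M; lia.
have Mh : (M <= 2 * h)%N by rewrite /h /M; lia.
have Mr : M./2 = r by rewrite /M; lia.
have Mp : (0 < M < p)%N by rewrite pr /M; lia.
have rp : (r < p)%N by rewrite pr; lia.
have r2p : (2 * r < p)%N by rewrite pr; lia.
have uC := punit_bin pE rh; have zC := punit_pint uC; have zCV := punitV_pint uC.
have zq2 : q2 \in Z_ := pint_q2 pE.
have zq3 : q3 \in Z_ := pint_q3 pE pM.
have zU : (U (p - 3))%:~R \in Z_ by zp.
have hU := U_third pE pM.
have h1M := harm1_third pE pM; have h1r := harm1_sixth pE hM Mh.
have h2r := harm2_sixth pE hM Mh; rewrite Mr -/q2 -/q3 in h1M h1r h2r.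
have zM1 : harm 1 M \in Z_ by apply: pint_harm; case/andP: Mp.
have zM2 : harm 2 M \in Z_ by apply: pint_harm; case/andP: Mp.
have zr1 : harm 1 r \in Z_ by exact: pint_harm.
have zr2 : harm 2 r \in Z_ by exact: pint_harm.
have z1 : harm 1 (2 * r) \in Z_ by exact: pint_harm.
have z2 : harm 2 (2 * r) \in Z_ by exact: pint_harm.
have PM : P = 3 * M%:R + 2 by rewrite pM natrD natrM.
have uM : punit p M%:R by exact: punit_small.
have M0 := punit_neq0 uM; have zMV := punitV_pint uM.
(* [harm 1 (2 * r)] is [harm 1 M] minus 1/M, and 1/M = 3/(p-2) is -3/2 - 3p/4 modulo p^2. *)
have a1 : harm 1 (2 * r) ==[2] harm 1 M + 3 / 2 + P * (3 / 4).
  rewrite {2}/harm /M addn1 big_nat_recr //= -/(harm 1 _) expr1 -(addn1 (2 * r)) -/M.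
  exists (- 4^-1 * M%:R^-1); first by zp.
  by rewrite PM; field.
have a2 : harm 2 (2 * r) ==[1] harm 2 M - 9 / 4.
  rewrite {2}/harm /M addn1 big_nat_recr //= -/(harm 2 _) -(addn1 (2 * r)) -/M.
  exists (M%:R^-1 ^+ 2 * (P - 4) / 4); first by zp.
  by rewrite PM; field.
have uE : harm 2 M ==[1] - 3 * (U (p - 3))%:~R.
  apply: cg_sym; have := cgMl (ltac:(zp) : - 3 \in Z_) hU => /eq_cg2; apply=> //; by field.
have [W /= sW EW] := hsum_even_third pE rh; rewrite -/q2 in sW.
set f1 := (4 * _ - _) / 3 + _ in sW.
have e1 : f1 ==[2] (2 + 4 / 3 * q2 - 3 / 2 * q3) +
   P * (1 - q2 ^+ 2 / 3 + 3 / 4 * q3 ^+ 2 + (U (p - 3))%:~R / 2).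
  have b1 : f1 ==[2] (4 * (harm 1 M + 3 / 2 + P * (3 / 4)) -
       (harm 1 M - 2 * q2 + P * (q2 ^+ 2 - harm 2 M / 2))) / 3 + 2 / 3 * q2.
    apply: cgD (cg_refl _ _ _); apply: cgMr; first by zp.
    by apply: cgB h1r; apply: cgMl => //; zp.
  apply: cg_trans b1 _.
  apply: (@cg_trans p 2 (- (3 / 2) * q3 + P * (3 / 4 * q3 ^+ 2 - harm 2 M / 3)
     + (2 + P + 4 / 3 * q2 - P * q2 ^+ 2 / 3 + P * (harm 2 M / 6)))).
    have := cgD h1M (cg_refl p 2 (2 + P + 4 / 3 * q2 - P * q2 ^+ 2 / 3 + P * (harm 2 M / 6))).
    by move/eq_cg2; apply=> //; field.
  have z6 : - 6^-1 \in Z_ by zp.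
  have := cgD (@cgMp p 1 1 _ _ (cgMl z6 uE)) (cg_refl p 2 (- (3 / 2) * q3 + P * (3 / 4 * q3 ^+ 2) + (2 + P + 4 / 3 * q2 - P * q2 ^+ 2 / 3))).
  by move/eq_cg2; apply; field.
have e2 : f1 ^+ 2 / 2 + 8 / 9 * harm 2 (2 * r) - 7 / 36 * harm 2 r - q2 ^+ 2 / 3 ==[1]
   (2 + 4 / 3 * q2 - 3 / 2 * q3) ^+ 2 / 2 - 2 - q2 ^+ 2 / 3 + (U (p - 3))%:~R / 4.
  have f1E : f1 ==[1] 2 + 4 / 3 * q2 - 3 / 2 * q3.
    apply: cg_trans (cgW (isT : 1 <= 2)%N e1) _.
    by exists (1 - q2 ^+ 2 / 3 + 3 / 4 * q3 ^+ 2 + (U (p - 3))%:~R / 2); zp; rewrite expr1.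
  have b1 : f1 ^+ 2 / 2 + 8 / 9 * harm 2 (2 * r) - 7 / 36 * harm 2 r - q2 ^+ 2 / 3 ==[1]
    (2 + 4 / 3 * q2 - 3 / 2 * q3) ^+ 2 / 2 + 8 / 9 * (harm 2 M - 9 / 4) - 7 / 36 * (5 * harm 2 M) - q2 ^+ 2 / 3.
    apply: cgB (cg_refl _ _ _); apply: cgB; last by apply: cgMl => //; zp.
    apply: cgD; last by apply: cgMl => //; zp.
    by apply: cgMr; [zp | apply: cgX => //; zp].
  apply: cg_trans b1 _.
  have z12 : - 12^-1 \in Z_ by zp.
  have := cgD (cgMl z12 uE) (cg_refl p 1 ((2 + 4 / 3 * q2 - 3 / 2 * q3) ^+ 2 / 2 - 2 - q2 ^+ 2 / 3)).
  by move/eq_cg2; apply; field.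
have s2 := ser_cg2 sW _ e2; have {}s2 := s2 (ltac:(zp)).
have s3 := ser_cg1 s2 _ _ e1; case: (s3 (ltac:(zp)) (ltac:(zp))) => _ _ _ WE.
have odd := hsum_odd_third pE rh.
have E1 : F (- 3^-1) = F (P * - 3^-1 + 1 + (2 * r)%:R).
  by rewrite /F -[RHS]hsum_reflect; congr hsum; rewrite pr natrD !natrM; field.
have E2 : F (- 3^-1 + 1) = F (P * - 3^-1 + (2 * r)%:R).
  by rewrite /F -[RHS]hsum_reflect; congr hsum; rewrite pr natrD !natrM; field.
have := central_sum_hsum; rewrite E1 E2 => H; apply: cg_trans H _.
have zC2 : C ^+ 2 \in Z_ by zp.
have z13 : - 13 \in Z_ by zp.
have K1 := cgMl z13 (cg_trans EW (cgMl zC2 WE)).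
have C0 := punit_neq0 uC.
suff K2 : 2 * F (P * - 3^-1 + 1 + (2 * r)%:R) ==[3] - (P ^+ 2 * C ^- 2).
  have := cgD K1 K2; rewrite -/F; set X := F _; set Y := F _ => /eq_cg2; apply; first by ring.
  by field.
apply: cg_trans (cgMl (pint_nat p 2) odd) _.
(* Modulo p the square of 2r + 1 is 4/9, which turns the constant 2 * (-2/9) into -1. *)
have n9 : (2 * r + 1)%:R = (P - 2) / 3 :> rat by rewrite -/M PM; field.
have u2 : punit p (2 * r + 1)%:R by exact: uM.
have n0 := punit_neq0 u2; have z := punitV_pint u2.
exists (C^-1 ^+ 2 * (2 * r + 1)%:R^-1 ^+ 2 * (P - 4) / 9); first by zp.
have P2 : P - 2 != 0 by apply: contraNneq n0 => e; rewrite n9 e mul0r.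
by rewrite n9; field; rewrite P2 C0.
Qed.

End Case2.

End Main.

(** * Jacobi sums modulo p^3 *)

Section Teichmuller.

Variable p : prime_gt3.
Local Notation p_pr := (pval_prime p).
Local Notation p_gt3 := (pval_gt3 p).
Local Notation Fp := 'F_p.
Local Notation A := 'Z_(p ^ 3).

Let p3_gt1 : (1 < p ^ 3)%N.
Proof. by have := p_gt3; rewrite -[1%N](exp1n 3) ltn_exp2r //; lia. Qed.

Let p_odd : odd p.
Proof. by case: (even_prime p_pr) => [p2|//]; have := p_gt3; rewrite p2. Qed.

Let natA a b : (a%:R == b%:R :> A) = (a == b %[mod p ^ 3])%N.
Proof. by rewrite -val_eqE /= !val_Zp_nat. Qed.

Let natF a b : (a%:R == b%:R :> Fp) = (a == b %[mod p])%N.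
Proof. by rewrite -val_eqE /= !val_Fp_nat ?p_pr. Qed.

Lemma p_nil : p%:R ^+ 3 = 0 :> A.
Proof. by rewrite -natrX; apply/eqP; rewrite (natA _ 0) modnn mod0n. Qed.

Lemma expr_near (x y q z : A) n : x = y + q * z -> exists w, x ^+ n = y ^+ n + q * w.
Proof.
move=> xE; exists (z * \sum_(i < n) x ^+ (n.-1 - i) * y ^+ i).
have := subrXX x y n; rewrite (_ : x - y = q * z) => [e|]; last by rewrite xE; ring.
by rewrite mulrA -e; ring.
Qed.

(** Lifting the exponent: x^p - y^p is x - y times a sum of p terms, each congruent to y^(p-1)
    modulo p, so one more factor p is gained. Two such steps from a congruence modulo p reach p^3 =
    0. *)
Let expr_lift (x y z : A) k : x = y + p%:R ^+ k.+1 * z ->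
  exists w, x ^+ p = y ^+ p + p%:R ^+ k.+2 * w.
Proof.
move=> xE; have [w wE] : exists w, \sum_(i < p) x ^+ (p.-1 - i) * y ^+ i = p%:R * w.
  have H n : exists w, \sum_(i < n) x ^+ (p.-1 - i) * y ^+ i
      = \sum_(i < n) y ^+ (p.-1 - i) * y ^+ i + p%:R * w.
    elim: n => [|n [w IH]]; first by exists 0; rewrite !big_ord0 mulr0 addr0.
    have [v vE] := expr_near (p.-1 - n) xE.
    exists (w + p%:R ^+ k * v * y ^+ n).
    by rewrite !big_ord_recr /= IH vE exprS; ring.
  have [w ->] := H p; exists (y ^+ p.-1 + w); rewrite mulrDr; congr (_ + _).
  rewrite (eq_bigr (fun=> y ^+ p.-1)) => [|i _]; last first.
    by rewrite -exprD subnK // -ltnS (ltn_predK (ltn_ord i)) ltn_ord.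
  by rewrite sumr_const card_ord mulr_natl.
exists (z * w); have := subrXX x y p; rewrite wE (_ : x - y = p%:R ^+ k.+1 * z) => [e|]; last by rewrite xE; ring.
by rewrite -(subrK (y ^+ p) (x ^+ p)) e (exprS _ k.+1); ring.
Qed.

Let expr_p2 (x y z : A) : x = y + p%:R * z -> x ^+ (p ^ 2) = y ^+ (p ^ 2).
Proof.
rewrite -[p%:R]expr1 => /(@expr_lift _ _ _ 0) [w /expr_lift [v]].
by rewrite -!exprM p_nil mul0r addr0.
Qed.

(* The Teichmueller lift, as the p^2-th power of any lift. *)
Definition teich (u : Fp) : A := (u : nat)%:R ^+ (p ^ 2).
Local Notation T := teich.

Let nat_div n : n%:R = (n %/ p)%:R * p%:R + (n %% p)%:R :> A.
Proof. by rewrite -natrM -natrD -divn_eq. Qed.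

Let natp n : (n %% p)%N%:R = n%:R + p%:R * - (n %/ p)%:R :> A.
Proof. by rewrite [n%:R]nat_div; ring. Qed.

Let val_nat n : ((n%:R : Fp) : nat) = (n %% p)%N.
Proof. by rewrite val_Fp_nat ?p_pr. Qed.

Let F_nat (u : Fp) : u = (u : nat)%:R.
Proof. by rewrite natr_Zp. Qed.

Lemma teich_nat n : T n%:R = n%:R ^+ (p ^ 2).
Proof. by rewrite /T val_nat; exact: (expr_p2 (natp n)). Qed.

Lemma teichM u v : T (u * v) = T u * T v.
Proof.
by rewrite (F_nat u) (F_nat v) -natrM !teich_nat natrM exprMn.
Qed.

Lemma teich0 : T 0 = 0.
Proof. by rewrite (teich_nat 0) expr0n; have := p_gt3; case: (p : nat). Qed.

Lemma teich1 : T 1 = 1.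
Proof. by rewrite (teich_nat 1) expr1n. Qed.

Lemma teichX u n : T (u ^+ n) = T u ^+ n.
Proof. by elim: n => [|n IH]; rewrite ?expr0 ?teich1 // !exprS teichM IH. Qed.

Lemma fermat_F (u : Fp) : u != 0 -> u ^+ (p - 1) = 1.
Proof.
move=> u0; apply: (mulfI u0); rewrite -exprS mulr1 -[RHS]expf_card card_Fp ?p_pr //.
by congr (_ ^+ _); have := p_gt3; lia.
Qed.

Lemma teich_order u : u != 0 -> T u ^+ (p - 1) = 1.
Proof. by move=> u0; rewrite -teichX fermat_F // teich1. Qed.

Lemma teich_unit u : u != 0 -> T u \is a GRing.unit.
Proof.
move=> u0; rewrite -(@unitrX_pos _ _ (p - 1)) ?teich_order ?unitr1 //.
by have := p_gt3; lia.
Qed.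

Let natX n : exists z, n%:R ^+ (p ^ 2) = n%:R + p%:R * z :> A.
Proof.
have : (n ^ (p ^ 2) == n %[mod p])%N.
  rewrite -natF natrX; set u := (n%:R : Fp).
  have up : u ^+ p = u by rewrite -[RHS]expf_card card_Fp ?p_pr.
  by rewrite (_ : p ^ 2 = p * p)%N ?exprM ?up.
rewrite -natrX => /eqP e; exists ((n ^ (p ^ 2) %/ p)%:R - (n %/ p)%:R).
by rewrite nat_div e [n%:R]nat_div; ring.
Qed.

Lemma expr_p2_near (x : A) : exists z, x ^+ (p ^ 2) = x + p%:R * z.
Proof. by rewrite -(natr_Zp x); exact: natX. Qed.

Lemma teichD u v : T (u + v) = (T u + T v) ^+ (p ^ 2).
Proof.
rewrite (F_nat u) (F_nat v) -natrD !teich_nat.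
have [z1 ->] := natX u; have [z2 ->] := natX v.
by apply/esym; apply: (@expr_p2 _ _ (z1 + z2)); rewrite natrD; ring.
Qed.

Lemma teichN1 : T (-1) = -1.
Proof.
have -> : -1 = (p - 1)%:R :> Fp.
  have p0 : p%:R = 0 :> Fp by apply/eqP; rewrite (natF _ 0) modnn mod0n.
  by rewrite natrB ?prime_gt0 ?p_pr // p0 sub0r.
rewrite teich_nat (@expr_p2 _ (-1) 1) ?natrB ?prime_gt0 ?p_pr //; last by ring.
by rewrite -signr_odd oddX p_odd orbT expr1.
Qed.

Lemma teichB u v : T (u - v) = (T u - T v) ^+ (p ^ 2).
Proof. by rewrite teichD -mulN1r teichM teichN1 mulN1r. Qed.

Lemma teichB_unit u v : u != v -> T u - T v \is a GRing.unit.
Proof.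
move=> uv; rewrite -(@unitrX_pos _ _ (p ^ 2)) ?expn_gt0 ?prime_gt0 ?p_pr //.
by rewrite -teichB teich_unit // subr_eq0.
Qed.

Lemma exists_nontrivial_power k : ~~ (p - 1 %| k)%N -> exists2 g : Fp, g != 0 & g ^+ k != 1.
Proof.
move=> nk; have p1 : (0 < p - 1)%N by have := p_gt3; lia.
case: (boolP [exists g : Fp, (g != 0) && (g ^+ k != 1)]) => [/existsP [g /andP [g0 g1]]|].
  by exists g.
rewrite negb_exists => /forallP H.
set j := (k %% (p - 1))%N; have j0 : (0 < j)%N by rewrite lt0n.
have all1 (g : Fp) : g != 0 -> g ^+ j = 1.
  move=> g0; have := H g; rewrite g0 negbK => /eqP.
  by rewrite (divn_eq k (p - 1)) exprD mulnC exprM fermat_F // expr1n mul1r.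
have P0 : 'X^j - 1%:P != 0 :> {poly Fp}.
  by rewrite -size_poly_eq0 size_XnsubC.
have := @max_poly_roots _ _ (enum [set~ (0 : Fp)]) P0.
rewrite enum_uniq -cardE cardsC1 card_Fp ?p_pr // size_XnsubC // => H'.
have : ((p : nat).-1 < j.+1)%N.
  apply: H' => //; apply/allP => g; rewrite mem_enum !inE => g0.
  by rewrite rootE !hornerE all1 // subrr.
by have := ltn_pmod k p1; rewrite -/j -subn1; lia.
Qed.

(** Orthogonality of characters in a ring with zero divisors: multiplication by g fixes the sum S,
    and T(g)^k - 1 can be cancelled because differences of distinct Teichmueller representatives are
    units. *)
Lemma sum_teichX k : (0 < k)%N ->
  \sum_(u : Fp) T u ^+ k = if (p - 1 %| k)%N then (p - 1)%:R else 0.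
Proof.
move=> k0; case: ifPn => hk.
  rewrite (bigD1 0) //= teich0 expr0n (gtn_eqF k0) add0r.
  rewrite (eq_bigr (fun=> 1)) => [|u u0]; last first.
    by case/dvdnP: hk => q ->; rewrite mulnC exprM teich_order // expr1n.
  rewrite sumr_const; congr _%:R.
  by rewrite cardC1 card_Fp ?p_pr // subn1.
have [g g0 gk] := exists_nontrivial_power hk.
set S := \sum_(u : Fp) _; have : T g ^+ k * S = S.
  rewrite /S mulr_sumr [RHS](reindex_inj (mulfI g0)); apply: eq_bigr => u _.
  by rewrite teichM exprMn.
move/eqP; rewrite -subr_eq0 -{2}[S]mul1r -mulrBl -teichX -teich1 => /eqP e.
by rewrite -(mulKr (teichB_unit gk) S) e mulr0.
Qed.

End Teichmuller.

(** * Jacobi sums and the quadratic form x^2 + 3y^2 *)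

Lemma natF_eq0 (p : prime_gt3) n : (n%:R == 0 :> 'F_p) = (p %| n)%N.
Proof. by rewrite -val_eqE /= val_Fp_nat ?pval_prime. Qed.

(** The norm t^2 + 3d^2 is nonnegative and at most 7q^2, hence at most q^3; subtracting 4q < q^3
    leaves a number strictly between -q^3 and q^3, which must be the multiple 0. *)
Lemma small_norm (q : nat) (t d : int) :
  `|t| <= 2%:Z * q%:Z -> `|d| <= q%:Z -> (6 < q)%N ->
  (q ^ 3 %| absz (t ^+ 2 + 3 * d ^+ 2 - 4 * q%:Z)%R)%N -> t ^+ 2 + 3 * d ^+ 2 = 4 * q%:Z.
Proof.
move=> tB dB q6 /dvdnP [k E].
have b1 : t ^+ 2 <= 4 * q%:Z ^+ 2.
  by rewrite -[t ^+ 2]real_normK ?num_real // (_ : 4 * q%:Z ^+ 2 = (2%:Z * q%:Z) ^+ 2) ?lerXn2r ?nnegrE //; ring.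
have b2 : d ^+ 2 <= q%:Z ^+ 2 by rewrite -[d ^+ 2]real_normK ?num_real // lerXn2r ?nnegrE.
have b3 : (7 * q ^ 2 <= q ^ 3)%N by rewrite (expnS q 2) leq_mul2r q6 orbT.
have b4 : (4 * q < q ^ 3)%N.
  by apply: leq_trans b3; rewrite -mulnn mulnA ltn_mul2r; lia.
have t0 : 0 <= t ^+ 2 := sqr_ge0 _.
have d0 : 0 <= d ^+ 2 := sqr_ge0 _.
have q2 : q%:Z ^+ 2 = (q ^ 2)%:Z by rewrite expr2 -PoszM mulnn.
rewrite q2 in b1 b2.
move: (t ^+ 2) (d ^+ 2) (q ^ 2)%N (q ^ 3)%N b1 b2 b3 b4 t0 d0 E => a b c e b1 b2 b3 b4 t0 d0 E.
case: k E => [|k] E; first by lia.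
have : (e <= absz (a + 3 * b - 4 * q%:Z)%R)%N by rewrite E leq_pmull.
by lia.
Qed.

(** The prime divides (xv - uy)(xv + uy), and u may change sign, so let xv - uy = kp. Then p^2 = (xu
    + 3yv)^2 + 3k^2 p^2 leaves only k = 0, and the product formula gives v^2 = y^2. *)
Lemma unique_repr (p : nat) (x y u v : int) : prime p ->
  p%:Z = x ^+ 2 + 3 * y ^+ 2 -> p%:Z = u ^+ 2 + 3 * v ^+ 2 -> x ^+ 2 = u ^+ 2.
Proof.
move=> pp xy uv.
have p0 : p%:Z != 0 by rewrite -lt0n prime_gt0.
have e0 : (x * v - u * y) * (x * v + u * y) = p%:Z * (v ^+ 2 - y ^+ 2).
  have -> : (x * v - u * y) * (x * v + u * y) = (x ^+ 2 + 3 * y ^+ 2) * v ^+ 2 - (u ^+ 2 + 3 * v ^+ 2) * y ^+ 2 by ring.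
  by rewrite -xy -uv; ring.
have : (p%:Z %| (x * v - u * y) * (x * v + u * y))%Z by rewrite e0 dvdz_mulr.
wlog dv : u uv e0 / (p%:Z %| x * v - u * y)%Z.
  move=> H; rewrite dvdzE abszM Euclid_dvdM // => /orP [] h.
    by apply: H => //; rewrite e0 dvdz_mulr.
  rewrite -(sqrrN u); apply: H; rewrite ?sqrrN ?mulNr ?opprK //; last by rewrite mulrC e0 dvdz_mulr.
  by rewrite mulrC.
move=> _; case/dvdzP: dv => k kE.
have : k == 0.
  have e1 : p%:Z ^+ 2 = (x * u + 3 * y * v) ^+ 2 + 3 * (k * p%:Z) ^+ 2.
    by rewrite -kE expr2 {1}xy uv; ring.
  have : 3 * k ^+ 2 <= 1.
    rewrite -(ler_pM2r (_ : 0 < p%:Z ^+ 2)) ?exprn_gt0 ?ltz_nat ?prime_gt0 // mul1r.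
    have -> : 3 * k ^+ 2 * p%:Z ^+ 2 = 3 * (k * p%:Z) ^+ 2 by ring.
    by rewrite e1 lerDr sqr_ge0.
  move=> k1; apply: contraT => k0; have : 0 < k ^+ 2 by rewrite exprn_even_gt0.
  by move: (k ^+ 2) k1; clear; lia.
move/eqP => k0; move: kE; rewrite k0 mul0r => kE.
have vy : v ^+ 2 = y ^+ 2.
  apply/eqP; rewrite -subr_eq0; apply/eqP; apply: (mulfI p0).
  by rewrite -e0 kE mul0r mulr0.
have : x ^+ 2 + 3 * y ^+ 2 = u ^+ 2 + 3 * v ^+ 2 by rewrite -xy -uv.
by rewrite vy => /addIr.
Qed.

Section Jacobi.

Variables (p : prime_gt3) (r : nat) (pr : p = (6 * r + 1)%N :> nat).
Local Notation p_pr := (pval_prime p).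
Local Notation p_gt3 := (pval_gt3 p).
Local Notation Fp := 'F_p.
Local Notation A := 'Z_(p ^ 3).
Local Notation T := (@teich p).

Let r0 : (0 < r)%N. Proof. by have := p_gt3; rewrite pr; lia. Qed.
Let p1E : (p - 1 = 6 * r)%N. Proof. by rewrite pr; lia. Qed.

Let chi u : A := T u ^+ (2 * r).
Let phi u : A := T u ^+ (3 * r).

(** Jacobi sums of the quadratic character with the two cubic characters: as p - 1 = 6r, the
    exponents 2r and 4r are inverse to each other. The K of the overview is [jac1], its conjugate is
    [jac2]. *)
Definition jac1 : A := \sum_(u : Fp) T u ^+ (4 * r) * T (1 - u) ^+ (3 * r).
Definition jac2 : A := \sum_(u : Fp) T u ^+ (2 * r) * T (1 - u) ^+ (3 * r).

Let chiM u v : chi (u * v) = chi u * chi v.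
Proof. by rewrite /chi teichM exprMn. Qed.
Let phiM u v : phi (u * v) = phi u * phi v.
Proof. by rewrite /phi teichM exprMn. Qed.
Let chi0 : chi 0 = 0. Proof. by rewrite /chi teich0 expr0n; case: r r0. Qed.
Let phi0 : phi 0 = 0. Proof. by rewrite /phi teich0 expr0n; case: r r0. Qed.
Let chi1 : chi 1 = 1. Proof. by rewrite /chi teich1 expr1n. Qed.
Let phi1 : phi 1 = 1. Proof. by rewrite /phi teich1 expr1n. Qed.

Let phi_sqr u : u != 0 -> phi u * phi u = 1.
Proof.
by move=> u0; rewrite /phi -exprD (_ : 3 * r + 3 * r = p - 1)%N ?teich_order //; lia.
Qed.

Let phi_div u v : v != 0 -> phi (u * v) = phi (u / v).
Proof.
move=> v0; have -> : u * v = u / v * (v * v) by field.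
by rewrite phiM [phi (v * v)]phiM phi_sqr // mulr1.
Qed.

Let sum_zero k : (0 < k < 6 * r)%N -> \sum_(u : Fp) T u ^+ k = 0.
Proof. by move=> hk; rewrite sum_teichX ?p1E ?gtnNdvd //; case/andP: hk. Qed.

(** The quadratic character does not distinguish (1-x)(1-tx) from z = (1-tx)/(1-x), and z takes each
    value other than t exactly once for x different from 1. So the sum is the full character sum,
    which is 0, without the term at t. *)
Let sum_quad t : t != 0 -> t != 1 -> \sum_(x : Fp) phi ((1 - x) * (1 - t * x)) = - phi t.
Proof.
move=> t0 t1; have E : \sum_(z : Fp | z != t) phi z = - phi t.
  apply/eqP; rewrite -subr_eq0 opprK addrC; apply/eqP.
  have := @sum_zero (3 * r) (ltac:(lia)); rewrite (bigD1 t) //=.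
rewrite (bigD1 1) //= subrr mul0r phi0 add0r -E.
rewrite [RHS](reindex_onto (fun x : Fp => (1 - t * x) / (1 - x)) (fun z => (1 - z) / (t - z))) /=.
  apply: eq_big => [x|x x1].
    have [->|x1] := eqVneq x 1.
      rewrite subrr invr0 mulr0 !subr0 div1r; apply/esym/negbTE; rewrite negb_and; apply/orP; right.
      by apply: contraNneq t1 => e; rewrite -[t]invrK e invr1.
    have x1' : 1 - x != 0 by rewrite subr_eq0 eq_sym.
    have nt : (1 - t * x) / (1 - x) != t.
      apply: contraNneq t1 => e; rewrite eq_sym -subr_eq0.
      have : (1 - t * x) / (1 - x) * (1 - x) = t * (1 - x) by rewrite e.
      by rewrite divfK // => e'; apply/eqP; rewrite -(subrr (1 - t * x)) {2}e'; ring.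
    rewrite nt /=; apply/esym/eqP.
    have d0 : t - 1 != 0 by rewrite subr_eq0.
    have dd : t - (1 - t * x) / (1 - x) = (t - 1) / (1 - x) by field.
    by rewrite dd; field; rewrite x1' d0.
  by rewrite mulrC phi_div // subr_eq0 eq_sym.
move=> z zt; have d0 : t - z != 0 by rewrite subr_eq0 eq_sym.
have d1 : t - 1 != 0 by rewrite subr_eq0.
have -> : 1 - (1 - z) / (t - z) = (t - 1) / (t - z) by field.
by field; rewrite d0 d1.
Qed.

(* After t := u / x the inner sums are sums of the quadratic character over a
   quadratic polynomial, see [sum_quad]. *)
Lemma jac_mul : jac1 * jac2 = p%:R.
Proof.
rewrite /jac1 /jac2 mulr_suml.
transitivity (\sum_(x : Fp | x != 0) \sum_(t : Fp) chi t * phi ((1 - x) * (1 - t * x))).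
  rewrite (bigD1 0) //= teich0 expr0n (_ : (4 * r == 0)%N = false) ?mul0r ?add0r; last by lia.
  apply: eq_bigr => x x0; rewrite mulr_sumr (reindex_inj (mulIf x0)) /=.
  apply: eq_bigr => t _; rewrite -/(chi _) -!/(phi _) chiM phiM.
  have e : T x ^+ (4 * r) * chi x = 1.
    by rewrite /chi -exprD (_ : 4 * r + 2 * r = p - 1)%N ?teich_order //; lia.
  by rewrite -[RHS]mul1r -e; ring.
rewrite exchange_big /= (bigD1 0) //= big1 ?add0r => [|x _]; last by rewrite chi0 mul0r.
(* The value t = 1 gives p - 2. Any other nonzero t gives chi(t)(-phi(t) - 1), where the -1 accounts
   for the missing x = 0; the two character sums lack t = 1 and contribute 1 each. *)
rewrite (bigD1 1) ?oner_eq0 //=.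
have -> : \sum_(x : Fp | x != 0) chi 1 * phi ((1 - x) * (1 - 1 * x)) = p%:R - 2.
  rewrite (bigD1 1) ?oner_eq0 //= mul1r subrr mul0r phi0 mulr0 add0r.
  rewrite (eq_bigr (fun=> 1)) => [|x /andP [x0 x1]]; last first.
    by rewrite chi1 !mul1r phiM phi_sqr // subr_eq0 eq_sym.
  rewrite sumr_const (_ : #|_| = p - 2)%N ?natrB //; first by have := p_gt3; lia.
  have := cardC (pred2 (0 : Fp) 1); rewrite card2 eq_sym oner_eq0 /= card_Fp ?p_pr // => e.
  have -> : #|[pred x : Fp | (x != 0) && (x != 1)]| = #|predC (pred2 (0 : Fp) 1)|.
    by apply: eq_card => x; rewrite !inE negb_or.
  by rewrite -[in RHS]e addKn.
have -> : \sum_(t : Fp | (t != 0) && (t != 1)) \sum_(x : Fp | x != 0) chi t * phi ((1 - x) * (1 - t * x))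
   = \sum_(t : Fp | (t != 0) && (t != 1)) - (T t ^+ (5 * r) + T t ^+ (2 * r)).
  apply: eq_bigr => t /andP [t0 t1]; rewrite -mulr_sumr.
  have := sum_quad t0 t1; rewrite (bigD1 0) //= mulr0 !subr0 mulr1 phi1 => e.
  rewrite -[X in _ * X](addKr 1) e (_ : 5 * r = 2 * r + 3 * r)%N; last by lia.
  by rewrite exprD -/(chi _) -/(phi _); ring.
rewrite sumrN big_split /=.
have S k : (0 < k < 6 * r)%N -> \sum_(t : Fp | (t != 0) && (t != 1)) T t ^+ k = - 1.
  move=> hk; have := sum_zero hk; rewrite (bigD1 0) //= (bigD1 1) ?oner_eq0 //=.
  rewrite teich0 teich1 expr1n expr0n (_ : (k == 0)%N = false); last by lia.
  by rewrite add0r => e; apply/eqP; rewrite -subr_eq0 opprK addrC e.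
by rewrite !S; [ring | lia | lia].
Qed.

Let w_spec : exists2 w : Fp, w ^+ 2 + w + 1 = 0 & forall u : Fp, u != 0 ->
  [\/ u ^+ (2 * r) = 1, u ^+ (2 * r) = w | u ^+ (2 * r) = w ^+ 2].
Proof.
have [g g0 g1] : exists2 g : Fp, g != 0 & g ^+ (2 * r) != 1.
  by apply: exists_nontrivial_power; rewrite p1E gtnNdvd //; lia.
have cube (u : Fp) : u != 0 -> (u ^+ (2 * r)) ^+ 3 = 1.
  by move=> u0; rewrite -exprM (_ : 2 * r * 3 = p - 1)%N ?fermat_F //; lia.
have w2 : (g ^+ (2 * r)) ^+ 2 + g ^+ (2 * r) + 1 = 0.
  apply: (mulfI (_ : g ^+ (2 * r) - 1 != 0)); first by rewrite subr_eq0.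
  by rewrite mulr0 -(subrr (1 : Fp)) -{3}(cube g g0); ring.
exists (g ^+ (2 * r)) => // u u0; move: (g ^+ (2 * r)) w2 => w w2.
have : (u ^+ (2 * r) - 1) * ((u ^+ (2 * r) - w) * (u ^+ (2 * r) - w ^+ 2)) = 0.
  have := cube u u0; move: (u ^+ (2 * r)) => v v3.
  have w3 : w ^+ 3 = 1.
    by transitivity (w ^+ 3 + (1 - w) * (w ^+ 2 + w + 1)); [rewrite w2 mulr0 addr0 | ring].
  transitivity (v ^+ 3 - w ^+ 3 - (v ^+ 2 - v * w) * (w ^+ 2 + w + 1)); last by rewrite v3 w3 w2; ring.
  by ring.
move/eqP; rewrite !mulf_eq0 !subr_eq0 => /orP [/eqP e|/orP [/eqP e|/eqP e]].
- by constructor 1.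
- by constructor 2.
by constructor 3.
Qed.

Lemma jac_trace (x y : int) : p%:Z = x ^+ 2 + 3 * y ^+ 2 ->
  (jac1 + jac2) ^+ 2 = (4 * x ^+ 2)%:~R.
Proof.
move=> pxy; have [w w2 wP] := w_spec.
have w1 : w != 1.
  apply/eqP => w1; move: w2; rewrite w1 expr1n => /eqP.
  by rewrite (_ : 1 + 1 + 1 = 3%:R) ?natF_eq0 ?gtnNdvd //; [exact: p_gt3 | ring].
(* Integer lifts: [s] of phi, [c] of the trace chi + chi^2, and [e] of (chi - chi^2)/(W - W^2),
   where W is a primitive cube root of unity and (W - W^2)^2 = -3. *)
pose s (u : Fp) : int := if u == 0 then 0 else if u ^+ (3 * r) == 1 then 1 else -1.
pose c (u : Fp) : int := if u == 0 then 0 else if u ^+ (2 * r) == 1 then 2 else -1.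
pose e (u : Fp) : int := if u ^+ (2 * r) == w then 1 else if u ^+ (2 * r) == w ^+ 2 then -1 else 0.
pose W := T w.
have W2 : W ^+ 2 + W + 1 = 0.
  have u1 := teichB_unit w1; rewrite teich1 -/W in u1.
  have W3 : W ^+ 3 = 1.
    rewrite /W -teichX -[RHS](teich1 p); congr T.
    by transitivity (1 + (w - 1) * (w ^+ 2 + w + 1)); [ring | rewrite w2 mulr0 addr0].
  by apply: (mulrI u1); rewrite mulr0 -(subrr (1 : A)) -{3}W3; ring.
have sE u : phi u = (s u)%:~R.
  rewrite /s; have [->|u0] := eqVneq u 0; first by rewrite phi0.
  rewrite /phi -teichX; have [->|n1] := eqVneq (u ^+ (3 * r)) 1; first by rewrite teich1.
  have : (u ^+ (3 * r)) ^+ 2 = 1 by rewrite -exprM (_ : 3 * r * 2 = p - 1)%N ?fermat_F //; lia.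
  by move/eqP; rewrite sqrf_eq1 (negbTE n1) => /eqP ->; rewrite teichN1 rmorphN1.
have w3 : w ^+ 3 = 1.
  by transitivity (1 + (w - 1) * (w ^+ 2 + w + 1)); [ring | rewrite w2 mulr0 addr0].
have w0 : w != 0.
  by apply/eqP => w0; move/eqP: w3; rewrite w0 expr0n eq_sym oner_eq0.
have w21 : w ^+ 2 != 1.
  by apply: contraNneq w1 => e1; rewrite -w3 exprS e1 mulr1.
have w22 : w ^+ 2 != w.
  by apply: contraNneq w1 => e1; rewrite -w3 exprS e1 -expr2 e1.
have W4 : (W ^+ 2) ^+ 2 = W.
  by rewrite /W -!teichX -exprM (exprD w 3 1) w3 mul1r.
have cE u : chi u + chi u ^+ 2 = (c u)%:~R /\ chi u - chi u ^+ 2 = (e u)%:~R * (W - W ^+ 2).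
  have [->|u0] := eqVneq u 0.
    rewrite /c /e eqxx chi0 !expr0n (_ : (2 * r == 0)%N = false); last by have := r0; lia.
    rewrite ![0 == _]eq_sym (negbTE w0) (negbTE (expf_neq0 2 w0)) mulr0z mul0r.
    by rewrite addr0 subr0.
  rewrite /c /e (negbTE u0) /chi -teichX; case: (wP u u0) => ->.
  - rewrite eqxx teich1 ![1 == _]eq_sym (negbTE w1) (negbTE w21) mulr0z mul0r expr1n subrr.
    by split=> //; ring.
  - rewrite eqxx (negbTE w1) -/W mulr1z mul1r; split=> //.
    by rewrite rmorphN1 -[LHS](addrK 1) [W + _]addrC W2 sub0r.
  rewrite (negbTE w21) (negbTE w22) eqxx teichX -/W W4 rmorphN1 mulN1r opprB; split=> //.
  by rewrite -[LHS](addrK 1) W2 sub0r.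
pose t := \sum_(u : Fp) c u * s (1 - u).
pose d := \sum_(u : Fp) e u * s (1 - u).
have jac1E : jac1 = \sum_(u : Fp) chi u ^+ 2 * phi (1 - u).
  by apply: eq_bigr => u _; rewrite /chi -exprM (_ : 2 * r * 2 = 4 * r)%N //; lia.
have tE : jac1 + jac2 = t%:~R.
  rewrite jac1E /jac2 -big_split rmorph_sum /=; apply: eq_bigr => u _.
  by rewrite rmorphM /= -(cE u).1 -sE mulrDl addrC.
have dE : jac2 - jac1 = d%:~R * (W - W ^+ 2).
  rewrite jac1E /jac2 -sumrB rmorph_sum mulr_suml /=; apply: eq_bigr => u _.
  by rewrite rmorphM /= -mulrBl (cE u).2 -sE mulrAC.
(* This is (K' + K)^2 - (K' - K)^2 = 4KK' with KK' = p; as K' - K = d(W - W^2), minus the square of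
   the difference is 3d^2. The bounds that follow turn it into an equality of integers. *)
have key : (t ^+ 2 + 3 * d ^+ 2 - 4 * p%:Z)%:~R = 0 :> A.
  rewrite intrB intrD !intrM -tE -pmulrn -jac_mul.
  have -> : 3%:~R * (d%:~R * d%:~R) = - (jac2 - jac1) ^+ 2 :> A.
    rewrite dE exprMn; have -> : (W - W ^+ 2) ^+ 2 = -3.
      transitivity ((W ^+ 2 + W + 1) * (W ^+ 2 - 3 * W + 3) - 3); last by rewrite W2 mul0r sub0r.
      by ring.
    by rewrite mulrN opprK mulrC expr2.
  by ring.
have natA0 n : (n%:R == 0 :> A) = (p ^ 3 %| n)%N.
  rewrite -val_eqE /= val_Zp_nat //.
  by rewrite -[1%N](exp1n 3) ltn_exp2r //; exact: prime_gt1 p_pr.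
have intA0 (z : int) : z%:~R = 0 :> A -> (p ^ 3 %| `|z|)%N.
  case: z => n /eqP; first by rewrite natA0.
  by rewrite NegzE mulrNz oppr_eq0 (natA0 n.+1).
have sB u : `|s u| <= 1 by rewrite /s; case: eqP => // _; case: ifP.
have cB u : `|c u| <= 2%:Z by rewrite /c; case: eqP => // _; case: ifP.
have eB u : `|e u| <= 1%:Z by rewrite /e; case: ifP => // _; case: ifP.
have sumB (f g : Fp -> int) (b : nat) : (forall u, `|f u| <= b%:Z) -> (forall u, `|g u| <= 1) ->
    `|\sum_(u : Fp) f u * g u| <= b%:Z * p%:Z.
  move=> fB gB; apply: le_trans (ler_norm_sum _ _ _) _.
  have -> : b%:Z * p%:Z = \sum_(u : Fp) b%:Z * 1 :> int.
    by rewrite mulr1 sumr_const card_Fp ?p_pr // -mulr_natr natz.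
  by apply: ler_sum => u _; rewrite normrM ler_pM.
have tB : `|t| <= 2%:Z * p%:Z by apply: sumB.
have dB : `|d| <= 1%:Z * p%:Z by apply: sumB.
have t4 : t ^+ 2 + 3 * d ^+ 2 = 4 * p%:Z.
  by apply: small_norm tB _ _ (intA0 _ key); [rewrite -[p%:Z]mul1r | have := r0; rewrite pr; lia].
have p1 : (1 < p)%N := prime_gt1 p_pr.
(* Prepares the parity of t: modulo this vanishing sum, t is the sum of c(u)(s(1-u) - 1), where
   s(1-u) - 1 is even except at u = 1, and there c(u) = 2. *)
have c0 : \sum_(u : Fp) c u = 0.
  have H : (\sum_(u : Fp) c u)%:~R = 0 :> A.
    rewrite rmorph_sum /= (eq_bigr (fun u => T u ^+ (2 * r) + T u ^+ (4 * r))) => [|u _]; last first.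
      by rewrite -(cE u).1 /chi -exprM (_ : 2 * r * 2 = 4 * r)%N //; lia.
    by rewrite big_split /= !sum_zero ?addr0 //; have := r0; lia.
  have B : `|\sum_(u : Fp) c u| <= 2%:Z * p%:Z.
    have -> : \sum_(u : Fp) c u = \sum_(u : Fp) c u * 1 by apply: eq_bigr => u _; rewrite mulr1.
    by apply: sumB.
  have := intA0 _ H; case/dvdnP => -[|k] E; first by apply/eqP; rewrite -absz_eq0 E.
  have b4 : (2 * p < p ^ 3)%N.
    rewrite (expnS p 2) mulnC ltn_pmul2l ?prime_gt0 ?p_pr // -mulnn.
    by apply: leq_trans (leq_pmulr _ _); rewrite ?prime_gt0 ?p_pr // ltnW ?p_gt3.
  have : (p ^ 3 <= absz (\sum_(u : Fp) c u)%R)%N by rewrite E leq_pmull.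
  by move: B b4; clear; lia.
have t2 : (2 %| t)%Z.
  rewrite -[t]subr0 -c0 -sumrB; apply: rpred_sum => u _.
  have -> : c u * s (1 - u) - c u = c u * (s (1 - u) - 1) by ring.
  rewrite /s; have [e1|_] := eqVneq (1 - u) 0.
    have -> : u = 1 by apply/esym/eqP; rewrite -subr_eq0 e1.
    by rewrite dvdz_mulr // /c oner_eq0 expr1n eqxx.
  by rewrite dvdz_mull //; case: ifP.
have [t' tt] := dvdzP t2.
have d2 : (2 %| d)%Z.
  have : (2 %| 3 * d ^+ 2)%Z.
    apply/dvdzP; exists (2 * (p%:Z - t' ^+ 2)).
    by transitivity (4 * p%:Z - t ^+ 2); [rewrite -t4 | rewrite tt]; ring.
  by rewrite dvdzE abszM Euclid_dvdM //= abszX Euclid_dvdX // => /andP [].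
have [d' dd] := dvdzP d2.
have pE' : p%:Z = t' ^+ 2 + 3 * d' ^+ 2.
  apply: (mulfI (_ : 4 != 0 :> int)) => //; rewrite -t4 tt dd; ring.
rewrite tE (unique_repr p_pr pxy pE') (_ : 4 * t' ^+ 2 = t ^+ 2); last by rewrite tt; ring.
by rewrite [in RHS]expr2 intrM expr2.
Qed.

End Jacobi.

(** What orthogonality retains of (1 - T u)^(3r+6rl) expanded against T(u)^(4r): the exponents i
    with 4r + i divisible by p - 1 = 6r are i = 2r + 6rj. These i are even, so no signs appear. *)
Definition jbin (r l : nat) : nat := \sum_(0 <= j < l.+1) 'C(3 * r + 6 * r * l, 2 * r + 6 * r * j).

Section Jacobi.

Variables (p : prime_gt3) (r : nat) (pr : p = (6 * r + 1)%N :> nat).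
Local Notation p_pr := (pval_prime p).
Local Notation p_gt3 := (pval_gt3 p).
Local Notation Fp := 'F_p.
Local Notation A := 'Z_(p ^ 3).
Local Notation T := (@teich p).

Let r0 : (0 < r)%N. Proof. by have := p_gt3; rewrite pr; lia. Qed.
Let p1E : (p - 1 = 6 * r)%N. Proof. by rewrite pr; lia. Qed.

(* T (1 - u) = (1 - T u)^(p^2) and (1 - T u)^(p-1) = 1 + X with X^3 = 0. *)
Let expr1X (X : A) e : X ^+ 3 = 0 -> (1 + X) ^+ e = 1 + e%:R * X + 'C(e, 2)%:R * X ^+ 2.
Proof.
move=> n3; elim: e => [|e IH]; first by rewrite expr0 bin0n !mul0r !addr0.
rewrite exprSr IH binS bin1 natrD -natr1.
transitivity (1 + (e%:R + 1) * X + ('C(e, 2)%:R + e%:R) * X ^+ 2 + 'C(e, 2)%:R * X ^+ 3); first by ring.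
by rewrite n3 mulr0 addr0.
Qed.

(** The exponent for which 3r p^2 = 3r + (p-1)e, so that (1 - T u)^(3r p^2) is (1 - T u)^(3r) times
    the e-th power of (1 - T u)^(p-1). *)
Let e := ((p ^ 2 - 1) %/ 2)%N.
Let b := 'C(e, 2).

Let e_eq : (3 * r * p ^ 2 = 3 * r + 6 * r * e)%N.
Proof.
have E : (2 * e = p ^ 2 - 1)%N.
  rewrite /e mulnC divnK // pr (_ : (6 * r + 1) ^ 2 - 1 = (6 * r * (3 * r + 1)) * 2)%N ?dvdn_mull //.
  by rewrite -mulnn; nia.
have : (0 < p ^ 2)%N by rewrite expn_gt0 prime_gt0 ?p_pr.
by move: E; move: (p ^ 2)%N e => P2 e'; clear; nia.
Qed.

(** The coefficients are those of 1 + eX + bX^2 rewritten in powers of Y = 1 + X = (1 - T u)^(p-1).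
    Every term is then a power of 1 - T u and can be summed by the binomial theorem. *)
Let teich_expand u : T (1 - u) ^+ (3 * r) =
  (1 - e%:R + b%:R) * (1 - T u) ^+ (3 * r + 6 * r * 0)
  + (e%:R - 2 * b%:R) * (1 - T u) ^+ (3 * r + 6 * r * 1)
  + b%:R * (1 - T u) ^+ (3 * r + 6 * r * 2).
Proof.
have tE : T (1 - u) = (1 - T u) ^+ (p ^ 2) by rewrite teichB teich1.
rewrite muln0 addn0 muln1.
(* At u = 1 the power (1 - T u)^(p-1) is 0 and not 1 plus a nilpotent; both sides vanish there. *)
have [->|u1] := eqVneq u 1.
  have z1 : (3 * r == 0)%N = false by have := r0; lia.
  have z2 k : (3 * r + k == 0)%N = false by have := r0; lia.
  by rewrite subrr teich0 teich1 subrr !expr0n z1 !z2 !mulr0 !addr0.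
have [z zE] := expr_p2_near (1 - T u).
have yE : 1 - T u = T (1 - u) + p%:R * - z by rewrite tE zE; ring.
have [w wE] := expr_near (6 * r) yE.
have o1 : T (1 - u) ^+ (6 * r) = 1 by rewrite -p1E teich_order // subr_eq0 eq_sym.
rewrite o1 in wE.
have Xn : ((1 - T u) ^+ (6 * r) - 1) ^+ 3 = 0.
  by rewrite wE addrC addKr exprMn p_nil mul0r.
rewrite {1}tE -exprM mulnC e_eq.
rewrite (exprD _ (3 * r) (6 * r * e)) (exprD _ (3 * r) (6 * r)) (exprD _ (3 * r) (6 * r * 2)).
rewrite (exprM _ (6 * r) e) (exprM _ (6 * r) 2).
move: Xn; move: ((1 - T u) ^+ (6 * r)) ((1 - T u) ^+ (3 * r)) => Y y Xn.
rewrite -[Y in LHS](subrKC 1) expr1X //.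
by rewrite -/b; ring.
Qed.

Lemma jac1_eval : jac1 p r = (6 * r)%:R * ((1 - e%:R + b%:R) * (jbin r 0)%:R
  + (e%:R - 2 * b%:R) * (jbin r 1)%:R + b%:R * (jbin r 2)%:R).
Proof.
have S l : \sum_(u : Fp) T u ^+ (4 * r) * (1 - T u) ^+ (3 * r + 6 * r * l) = (6 * r)%:R * (jbin r l)%:R.
  set n := (3 * r + 6 * r * l)%N; set N := (6 * r * l.+1)%N.
  have nN : (n < N)%N by rewrite /n /N mulnS; have := r0; lia.
  have E u : T u ^+ (4 * r) * (1 - T u) ^+ n =
      \sum_(0 <= i < N) (-1) ^+ i * 'C(n, i)%:R * T u ^+ (4 * r + i).
    rewrite (big_cat_nat (leq0n n.+1) nN) /= [\sum_(n.+1 <= _ < N) _]big1_seq ?addr0; last first.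
      by move=> i; rewrite mem_index_iota => /andP [_ /andP [hi _]]; rewrite bin_small // mulr0 mul0r.
    rewrite exprDn big_mkord mulr_sumr; apply: eq_bigr => i _.
    by rewrite expr1n mul1r (exprNn (T u)) exprD -mulrnAr -[_ *+ 'C(n, i)]mulr_natr; ring.
  rewrite (eq_bigr _ (fun u _ => E u)) exchange_big /=.
  have E2 i : \sum_(u : Fp) (-1) ^+ i * 'C(n, i)%:R * T u ^+ (4 * r + i) =
      (if (6 * r %| 4 * r + i)%N then (6 * r)%:R * ((-1) ^+ i * 'C(n, i)%:R) else 0).
    rewrite -mulr_sumr sum_teichX ?p1E; last by have := r0; lia.
    by case: ifP => _; rewrite ?mulr0 // mulrC.
  rewrite (eq_bigr _ (fun i _ => E2 i)) /N.
  (* Each block of 6r consecutive indices contains exactly one i with 6r dividing 4r + i. *)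
  have E3 (f : nat -> A) m : \sum_(0 <= i < 6 * r * m.+1) (if (6 * r %| 4 * r + i)%N then f i else 0)
     = \sum_(0 <= j < m.+1) f (2 * r + 6 * r * j)%N.
    have blk a : \sum_(6 * r * a <= i < 6 * r * a.+1) (if (6 * r %| 4 * r + i)%N then f i else 0) = f (2 * r + 6 * r * a)%N.
      rewrite (bigD1_seq (2 * r + 6 * r * a)%N) ?mem_index_iota ?iota_uniq //=; last first.
        by rewrite mulnS; have := r0; lia.
      rewrite ifT; last by rewrite addnA -mulnDl dvdn_add // dvdn_mulr.
      rewrite big1_seq ?addr0 // => i; rewrite mem_index_iota => /andP [ni hi].
      rewrite ifN //; apply: contraNN ni => /dvdnP [q qE].
      have qa : q = a.+1 by move: qE hi; have := r0; rewrite mulnS; clear; nia.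
      by apply/eqP; move: qE; rewrite qa mulSn; lia.
    elim: m => [|m IH].
      by have := blk 0%N; rewrite !muln0 addn0 => ->; rewrite big_nat1 muln0 addn0.
    rewrite (big_cat_nat (_ : 0 <= 6 * r * m.+1)%N (_ : 6 * r * m.+1 <= 6 * r * m.+2)%N) //=.
      by rewrite IH blk [RHS]big_nat_recr.
    by rewrite leq_mul2l leqnSn orbT.
  rewrite E3 /jbin -/n natr_sum mulr_sumr; apply: eq_bigr => j _.
  rewrite -signr_odd (_ : odd _ = false) ?expr0 ?mul1r //.
  by rewrite oddD !oddM /=.
rewrite /jac1 (eq_bigr (fun u => (1 - e%:R + b%:R) * (T u ^+ (4 * r) * (1 - T u) ^+ (3 * r + 6 * r * 0))
  + (e%:R - 2 * b%:R) * (T u ^+ (4 * r) * (1 - T u) ^+ (3 * r + 6 * r * 1))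
  + b%:R * (T u ^+ (4 * r) * (1 - T u) ^+ (3 * r + 6 * r * 2)))); last first.
  by move=> u _; rewrite teich_expand; ring.
by rewrite !big_split /= -!mulr_sumr !S; ring.
Qed.

End Jacobi.

(** * The case p = 1 mod 3 *)

Section Case1.

Variables (p : prime_gt3) (r : nat) (pr : p = (6 * r + 1)%N :> nat).
Local Notation p_pr := (pval_prime p).
Local Notation p_gt3 := (pval_gt3 p).
Local Notation P := (p%:R : rat).
Local Notation Z_ := (pint p).
Local Notation "a ==[ k ] b" := (cg p k a b) (at level 70).
Let co6 := coprime_p6 p.
Local Notation C := ('C(3 * r, r)%:R : rat).
Let q2 := fermat_quotient p 2.

Let e := ((p ^ 2 - 1) %/ 2)%N.
Let b := 'C(e, 2).

(** The integer expression of [jac1_eval] read in the rationals. It represents K modulo p^3 and can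
    be expanded with harmonic sums. *)
Let kap : rat := (6 * r)%:R * ((1 - e%:R + b%:R) * (jbin r 0)%:R
  + (e%:R - 2 * b%:R) * (jbin r 1)%:R + b%:R * (jbin r 2)%:R).

Let r0 : (0 < r)%N. Proof. by have := p_gt3; rewrite pr; lia. Qed.
Let pE : p = (2 * (3 * r) + 1)%N :> nat. Proof. by rewrite pr; lia. Qed.
Let PE : P = 6 * r%:R + 1. Proof. by rewrite pr natrD natrM. Qed.

Lemma cg_int_Zp (x y : int) : x%:~R = y%:~R :> 'Z_(p ^ 3) -> x%:~R ==[3] y%:~R.
Proof.
move=> /eqP; rewrite -subr_eq0 -rmorphB /=; set z := x - y => /eqP zE.
have natA0 n : (n%:R == 0 :> 'Z_(p ^ 3)) = (p ^ 3 %| n)%N.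
  rewrite -val_eqE /= val_Zp_nat //.
  by rewrite -[1%N](exp1n 3) ltn_exp2r //; exact: prime_gt1 p_pr.
have : (p ^ 3 %| `|z|)%N.
  move: zE; case: z => n /eqP; first by rewrite natA0.
  by rewrite NegzE mulrNz oppr_eq0 (natA0 n.+1).
move=> dz; have /dvdzP [q qE] : ((p ^ 3)%:Z %| z)%Z by rewrite dvdzE.
exists q%:~R; first exact: pint_int.
have -> : x = y + z by rewrite /z; ring.
by rewrite qE intrD intrM -natrX mulrC.
Qed.

(** The relation 4x^2 = (K + K')^2 multiplied by K^2, with KK' replaced by p, so that only K has to
    be transferred from Z/p^3 to the rationals. *)
Lemma kap_trace (x y : int) : p%:Z = x ^+ 2 + 3 * y ^+ 2 ->
  4 * x%:~R ^+ 2 * kap ^+ 2 ==[3] (kap ^+ 2 + P) ^+ 2.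
Proof.
move=> xy.
(* A single integer with the prescribed image in every ring, which links Z/p^3 with the
   rationals. *)
have [k0 k0E] : exists k0 : int, forall R : pzRingType, k0%:~R = (6 * r)%:R * ((1 - e%:R + b%:R) * (jbin r 0)%:R
    + (e%:R - 2 * b%:R) * (jbin r 1)%:R + b%:R * (jbin r 2)%:R) :> R.
  exists ((6 * r)%:Z * ((1%:Z - e%:Z + b%:Z) * (jbin r 0)%:Z
    + (e%:Z - 2%:Z * b%:Z) * (jbin r 1)%:Z + b%:Z * (jbin r 2)%:Z)) => R.
  by rewrite !(intrM, intrD, mulrNz) -!pmulrn.
have kE : kap = k0%:~R by rewrite k0E.
have jE : jac1 p r = k0%:~R by rewrite (jac1_eval pr) k0E.
have H : (4 * x ^+ 2 * k0 ^+ 2)%:~R = ((k0 ^+ 2 + p%:Z) ^+ 2)%:~R :> 'Z_(p ^ 3).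
  rewrite intrM -(jac_trace pr xy) [in RHS]rmorphXn /= intrD -pmulrn -(jac_mul pr).
  by rewrite !rmorphXn /= -jE; ring.
apply: (eq_cg2 (cg_int_Zp H)); rewrite kE !(intrM, intrD) -!pmulrn; ring.
Qed.

Let Q c k : rat := \prod_(1 <= i < k.+1) (1 + P * (c * i%:R^-1)).

Let shift_fact c k : (c * p + k)`!%:R = (c * p)`!%:R * k`!%:R * Q c%:R k :> rat.
Proof.
rewrite -prod_rising_fact mulrC -mulrA; congr (_ * _).
have -> : k`!%:R = \prod_(1 <= i < k.+1) i%:R :> rat.
  elim: k => [|k IH]; first by rewrite big_geq.
  by rewrite big_nat_recr //= -IH factS natrM mulrC.
rewrite /Q -big_split /=; apply: eq_big_nat => i hi; rewrite natrD natrM.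
by field; rewrite pnatr_eq0; lia.
Qed.

Let serQ c k : c \in Z_ -> (k < p)%N ->
  ser p (Q c k) 1 (c * harm 1 k) (c ^+ 2 * (harm 1 k ^+ 2 - harm 2 k) / 2).
Proof.
move=> zc kp; have zi i : (1 <= i < k.+1)%N -> i%:R^-1 \in Z_.
  by move=> hi; apply: pint_inv_small; lia.
have := ser_prod zc zi.
by have -> : \sum_(1 <= i < k.+1) i%:R^-1 = harm 1 k by apply: eq_bigr => i _; rewrite expr1.
Qed.

(** This is the binomial coefficient of 2p-1 over p-1, which is 1 modulo p^3 by Wolstenholme's
    theorem. *)
Let wol : rat := Q 1 (p - 1).

Let ser_wol : ser p wol 1 0 0.
Proof.
have h1 := harm1_full pE; have h2 := harm2_full pE.
have s := @serQ 1 (p - 1) (rpred1 _) (ltac:(have := p_gt3; lia)).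
have z1 : harm 1 (p - 1) \in Z_ by rewrite (cg_pint h1); zp.
have z2 : harm 2 (p - 1) \in Z_ by rewrite (cg_pint h2); zp.
have e1 : 1 * harm 1 (p - 1) ==[2] 0 + P * 0 by rewrite mul1r mulr0 addr0.
have e2 : 1 ^+ 2 * (harm 1 (p - 1) ^+ 2 - harm 2 (p - 1)) / 2 ==[1] 0.
  have -> : 0 = 1 ^+ 2 * (0 ^+ 2 - 0) / 2 :> rat by field.
  apply: cgMr; zp; apply: cgMl; zp; apply: cgB h2; apply: cgX; zp.
  exact: cgW h1.
have := ser_cg1 (ser_cg2 s (rpred0 _) e2) (rpred0 _) (rpred0 _) e1.
by rewrite addr0.
Qed.

Let double_fact : (2 * p)`!%:R = 2 * wol * p`!%:R ^+ 2 :> rat.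
Proof.
have [n pn] : exists n, pval p = n.+1 by exists (p - 1)%N; have := p_gt3; lia.
have := shift_fact 1 (p - 1); rewrite -/wol pn mul1n subn1 /= => H.
rewrite (_ : 2 * n.+1 = (n.+1 + n).+1)%N; last by lia.
rewrite factS natrM H factS natrM (_ : (n.+1 + n).+1 = 2 * n.+1)%N ?natrM; last by lia.
by ring.
Qed.

Let up1 c k n : (c * p + k = n.+1)%N ->
  n`!%:R * (c%:R * P + k%:R) = (c * p)`!%:R * k`!%:R * Q c%:R k :> rat.
Proof. by move=> e'; rewrite -shift_fact e' factS -natrM -natrD e' -natrM mulnC. Qed.

Let up2 c k n : (c * p + k = n.+2)%N ->
  n`!%:R * ((c%:R * P + k%:R) * (c%:R * P + k%:R - 1)) = (c * p)`!%:R * k`!%:R * Q c%:R k :> rat.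
Proof.
move=> e'; rewrite -shift_fact e' !factS -natrM -natrD e' -[X in _ - X]/(1%:R) -natrB // subn1 /=.
by rewrite -!natrM; congr _%:R; ring.
Qed.

Let bin_rat m k : (k <= m)%N -> 'C(m, k)%:R = m`!%:R / (k`!%:R * (m - k)`!%:R) :> rat.
Proof.
by move=> km; rewrite -(bin_fact km) !natrM mulfK // mulf_neq0 ?fact_neq0.
Qed.

Let u1 : punit p 1. Proof. by apply: (@punit_small p 1); have := p_gt3; lia. Qed.

Let Q_neq0 c k : c \in Z_ -> (k < p)%N -> Q c k != 0.
Proof. by move=> zc kp; apply: punit_neq0 (ser_unit (serQ zc kp) u1). Qed.

Let ltr k : (k <= 3)%N -> (k * r < p)%N.
Proof. by move=> k3; rewrite pr; nia. Qed.

Let ltr1 : (r < p)%N. Proof. by rewrite pr; lia. Qed.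

Let Q12 := Q 1 (2 * r).
Let Q11 := Q 1 r.
Let Q13 := Q 1 (3 * r).
Let Q22 := Q 2 (2 * r).
Let Q21 := Q 2 r.
Let Q23 := Q 2 (3 * r).

Let jbin0 : (jbin r 0)%:R = C.
Proof.
rewrite /jbin big_nat1 !muln0 !addn0 -bin_sub; last by rewrite leq_mul2r orbT.
by rewrite (_ : 3 * r - 2 * r = r)%N //; lia.
Qed.

Let nz_add n : P + n%:R != 0.
Proof. by rewrite -natrD pnatr_eq0 addn_eq0 pr addn1. Qed.

Let CE : C = (3 * r)`!%:R / ((2 * r)`!%:R * r`!%:R).
Proof.
rewrite bin_rat; last by lia.
by rewrite (_ : 3 * r - r = 2 * r)%N ?[_ * r`!%:R]mulrC //; lia.
Qed.

(* (9r)!, (8r)! and (7r)! are the factorials of p + 3r - 1, p + 2r - 1, p + r - 1. *)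
Let jbin1 : (jbin r 1)%:R = C * (Q13 * ((P + (2 * r)%:R) / Q12 + (P + r%:R) / Q11) / (P + (3 * r)%:R)).
Proof.
have jE : jbin r 1 = ('C(9 * r, 2 * r) + 'C(9 * r, 8 * r))%N.
  by rewrite /jbin big_nat_recr // big_nat1 /=; congr ('C(_, _) + 'C(_, _))%N; lia.
have s1 : (9 * r - 2 * r = 7 * r)%N by lia.
have s2 : (9 * r - 8 * r = r)%N by lia.
have h9 := @up1 1 (3 * r) (9 * r) (ltac:(rewrite pr; lia)).
have h8 := @up1 1 (2 * r) (8 * r) (ltac:(rewrite pr; lia)).
have h7 := @up1 1 r (7 * r) (ltac:(rewrite pr; lia)).
rewrite -/Q13 -/Q12 -/Q11 mul1n mul1r in h9 h8 h7.
have z13 : Q13 != 0 by apply: Q_neq0; rewrite ?rpred1 ?ltr.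
have z12 : Q12 != 0 by apply: Q_neq0; rewrite ?rpred1 ?ltr.
have z11 : Q11 != 0 by apply: Q_neq0; rewrite ?rpred1 ?ltr1.
have d9 : P + (3 * r)%:R != 0 := nz_add _.
have d8 : P + (2 * r)%:R != 0 := nz_add _.
have d7 : P + r%:R != 0 := nz_add _.
have f9 : (9 * r)`!%:R = p`!%:R * (3 * r)`!%:R * Q13 / (P + (3 * r)%:R) :> rat by rewrite -h9 mulfK.
have f8 : (8 * r)`!%:R = p`!%:R * (2 * r)`!%:R * Q12 / (P + (2 * r)%:R) :> rat by rewrite -h8 mulfK.
have f7 : (7 * r)`!%:R = p`!%:R * r`!%:R * Q11 / (P + r%:R) :> rat by rewrite -h7 mulfK.
rewrite jE natrD CE !bin_rat ?leq_mul2r ?orbT // s1 s2 f9 f8 f7.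
have := fact_neq0 r; have := fact_neq0 (2 * r); have := fact_neq0 p.
move: (r`!%:R) ((2 * r)`!%:R) ((3 * r)`!%:R) (p`!%:R) d9 d8 d7 z11 z12 z13.
move: (P + r%:R) (P + (2 * r)%:R) (P + (3 * r)%:R) Q11 Q12 Q13 => *; field.
by do !(apply/andP; split).
Qed.

(** Here (15r)!, (14r)! and (13r)! are the factorials of 2p+3r-2, 2p+2r-2 and 2p+r-2. In the middle
    binomial coefficient, with 8r and 7r below, the quotient (2p)!/p!^2 = 2 [wol] remains. *)
Let jbin2 : (jbin r 2)%:R = C * (Q23 * ((2 * P + (2 * r)%:R) * (2 * P + (2 * r)%:R - 1) / Q22
   + (2 * P + r%:R) * (2 * P + r%:R - 1) / Q21
   + 2 * wol * ((P + (2 * r)%:R) / Q12) * ((P + r%:R) / Q11))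
   / ((2 * P + (3 * r)%:R) * (2 * P + (3 * r)%:R - 1))).
Proof.
have jE : jbin r 2 = ('C(15 * r, 2 * r) + 'C(15 * r, 8 * r) + 'C(15 * r, 14 * r))%N.
  by rewrite /jbin 2?big_nat_recr // big_nat1 /=; congr ('C(_, _) + 'C(_, _) + 'C(_, _))%N; lia.
have s1 : (15 * r - 2 * r = 13 * r)%N by lia.
have s2 : (15 * r - 8 * r = 7 * r)%N by lia.
have s3 : (15 * r - 14 * r = r)%N by lia.
have h15 := @up2 2 (3 * r) (15 * r) (ltac:(rewrite pr; lia)).
have h14 := @up2 2 (2 * r) (14 * r) (ltac:(rewrite pr; lia)).
have h13 := @up2 2 r (13 * r) (ltac:(rewrite pr; lia)).
have h8 := @up1 1 (2 * r) (8 * r) (ltac:(rewrite pr; lia)).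
have h7 := @up1 1 r (7 * r) (ltac:(rewrite pr; lia)).
rewrite -/Q23 -/Q22 -/Q21 double_fact in h15 h14 h13.
rewrite -/Q12 -/Q11 mul1n mul1r in h8 h7.
have nz2 k : 2 * P + k%:R != 0.
  by rewrite -natrM -natrD pnatr_eq0 addn_eq0 muln_eq0 pr addn1.
have nz2' k : 2 * P + k%:R - 1 != 0.
  rewrite -natrM -natrD -[X in _ - X]/(1%:R) -natrB ?pnatr_eq0 pr; by lia.
have z2 : 2 \in Z_ by zp.
have z23 : Q23 != 0 by apply: Q_neq0; rewrite ?ltr.
have z22 : Q22 != 0 by apply: Q_neq0; rewrite ?ltr.
have z21 : Q21 != 0 by apply: Q_neq0; rewrite ?ltr1.
have z12 : Q12 != 0 by apply: Q_neq0; rewrite ?rpred1 ?ltr.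
have z11 : Q11 != 0 by apply: Q_neq0; rewrite ?rpred1 ?ltr1.
have w0 : wol != 0 by apply: punit_neq0 (ser_unit ser_wol u1).
have d15 := nz2 (3 * r)%N; have d14 := nz2 (2 * r)%N; have d13 := nz2 r.
have d15' := nz2' (3 * r)%N; have d14' := nz2' (2 * r)%N; have d13' := nz2' r.
have d8 := nz_add (2 * r)%N; have d7 := nz_add r.
have f15 : (15 * r)`!%:R = 2 * wol * p`!%:R ^+ 2 * (3 * r)`!%:R * Q23 / ((2 * P + (3 * r)%:R) * (2 * P + (3 * r)%:R - 1)) :> rat.
  by rewrite -h15 mulfK // mulf_neq0.
have f14 : (14 * r)`!%:R = 2 * wol * p`!%:R ^+ 2 * (2 * r)`!%:R * Q22 / ((2 * P + (2 * r)%:R) * (2 * P + (2 * r)%:R - 1)) :> rat.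
  by rewrite -h14 mulfK // mulf_neq0.
have f13 : (13 * r)`!%:R = 2 * wol * p`!%:R ^+ 2 * r`!%:R * Q21 / ((2 * P + r%:R) * (2 * P + r%:R - 1)) :> rat.
  by rewrite -h13 mulfK // mulf_neq0.
have f8 : (8 * r)`!%:R = p`!%:R * (2 * r)`!%:R * Q12 / (P + (2 * r)%:R) :> rat by rewrite -h8 mulfK.
have f7 : (7 * r)`!%:R = p`!%:R * r`!%:R * Q11 / (P + r%:R) :> rat by rewrite -h7 mulfK.
rewrite jE [LHS]natrD [X in X + _ = _]natrD CE !bin_rat ?leq_mul2r ?orbT // s1 s2 s3 f15 f14 f13 f8 f7.
have := fact_neq0 r; have := fact_neq0 (2 * r); have := fact_neq0 p.
move: (r`!%:R) ((2 * r)`!%:R) ((3 * r)`!%:R) (p`!%:R) d15' d14' d13' d15 d14 d13 d8 d7 z11 z12 z21 z22 z23 w0.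
move: (2 * P + (3 * r)%:R - 1) (2 * P + (2 * r)%:R - 1) (2 * P + r%:R - 1).
move: (2 * P + (3 * r)%:R) (2 * P + (2 * r)%:R) (2 * P + r%:R).
move: (P + r%:R) (P + (2 * r)%:R) Q11 Q12 Q21 Q22 Q23 wol => *; field.
by do !(apply/andP; split).
Qed.

(** Kept as parameters together with q2: the harmonic numbers at r and 3r are expressed by these
    three quantities, and both sides of [hsum_kap] become series in p with coefficients polynomial
    in them. *)
Let c1 := harm 1 (2 * r).
Let c2 := harm 2 (2 * r).

Let zc1 : c1 \in Z_. Proof. by apply: pint_harm; apply: ltr. Qed.
Let zc2 : c2 \in Z_. Proof. by apply: pint_harm; apply: ltr. Qed.
Let zq2 : q2 \in Z_. Proof. exact: pint_q2 pE. Qed.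

Let hM : (3 * r - uphalf (2 * r))%N = (2 * r)%N. Proof. by lia. Qed.
Let Mh : (2 * r <= 2 * (3 * r))%N. Proof. by lia. Qed.
Let Mr : (2 * r)./2 = r. Proof. by lia. Qed.

Let h1r : harm 1 r ==[2] c1 - 2 * q2 + P * (q2 ^+ 2 - c2 / 2).
Proof. by have := harm1_sixth pE hM Mh; rewrite Mr. Qed.

Let h2r : harm 2 r ==[1] 5 * c2.
Proof. by have := harm2_sixth pE hM Mh; rewrite Mr. Qed.

Let h1r1 : harm 1 r ==[1] c1 - 2 * q2.
Proof.
apply: cg_trans (cgW (isT : 1 <= 2)%N h1r) _.
by exists (q2 ^+ 2 - c2 / 2); zp; rewrite expr1.
Qed.

Let h1h1 : harm 1 (3 * r) ==[1] - 2 * q2.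
Proof.
apply: cg_trans (cgW (isT : 1 <= 2)%N (harm1_half pE)) _.
by exists (q2 ^+ 2); zp; rewrite expr1.
Qed.

Let serQ3 c : c \in Z_ -> ser p (Q c (3 * r)) 1 (- 2 * c * q2) ((c + 2 * c ^+ 2) * q2 ^+ 2).
Proof.
move=> zc; have s := serQ zc (ltr (isT : 3 <= 3)%N).
have e1 : c * harm 1 (3 * r) ==[2] - 2 * c * q2 + P * (c * q2 ^+ 2).
  by apply: cg_trans (cgMl zc (harm1_half pE)) _; apply: eq_cg; rewrite -/q2; ring.
have e2 : c ^+ 2 * (harm 1 (3 * r) ^+ 2 - harm 2 (3 * r)) / 2 ==[1] 2 * c ^+ 2 * q2 ^+ 2.
  have -> : 2 * c ^+ 2 * q2 ^+ 2 = c ^+ 2 * ((- 2 * q2) ^+ 2 - 0) / 2 by field.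
  apply: cgMr; first by zp.
  apply: cgMl; first by zp.
  by apply: cgB (harm2_half pE); apply: cgX => //; zp.
have s2 := ser_cg2 s _ e2; have {}s2 := s2 (ltac:(zp)).
have s3 := ser_cg1 s2 _ _ e1; have {}s3 := s3 (ltac:(zp)) (ltac:(zp)).
by apply: (ser_eq s3); [reflexivity | reflexivity | reflexivity | ring].
Qed.

Let serQ2 c : c \in Z_ -> ser p (Q c (2 * r)) 1 (c * c1) (c ^+ 2 * (c1 ^+ 2 - c2) / 2).
Proof. by move=> zc; exact: (serQ zc (ltr (isT : 2 <= 3)%N)). Qed.

Let serQ1 c : c \in Z_ -> ser p (Q c r) 1 (c * (c1 - 2 * q2))
  (c * (q2 ^+ 2 - c2 / 2) + c ^+ 2 * ((c1 - 2 * q2) ^+ 2 - 5 * c2) / 2).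
Proof.
move=> zc; have s := serQ zc ltr1.
have e1 : c * harm 1 r ==[2] c * (c1 - 2 * q2) + P * (c * (q2 ^+ 2 - c2 / 2)).
  by apply: cg_trans (cgMl zc h1r) _; apply: eq_cg; ring.
have e2 : c ^+ 2 * (harm 1 r ^+ 2 - harm 2 r) / 2 ==[1] c ^+ 2 * ((c1 - 2 * q2) ^+ 2 - 5 * c2) / 2.
  apply: cgMr; first by zp.
  apply: cgMl; first by zp.
  by apply: cgB h2r; apply: cgX => //; zp.
have s2 := ser_cg2 s _ e2; have {}s2 := s2 (ltac:(zp)).
have s3 := ser_cg1 s2 _ _ e1; have {}s3 := s3 (ltac:(zp)) (ltac:(zp)).
by apply: (ser_eq s3); [reflexivity | reflexivity | reflexivity | ring].
Qed.

Let serl (x a0 a1 : rat) : a0 \in Z_ -> a1 \in Z_ -> x = a0 + P * a1 -> ser p x a0 a1 0.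
Proof. by move=> z0 z1 ->; exact: ser_lin. Qed.

Let rE : r%:R = (P - 1) / 6 :> rat. Proof. by rewrite PE; field. Qed.

Let u_of (n : nat) : (0 < n)%N -> (n %| 6 ^ 4)%N -> punit p n%:R.
Proof. by move=> n0 dn; apply: punit_nat => //; apply: coprime_dvdr dn co6. Qed.

(** The quotient of [jbin r 1] by C. With r = (p-1)/6 all its linear factors are explicit in p, and
    only the products Q need harmonic sums. *)
Let J1 := Q13 * ((P + (2 * r)%:R) / Q12 + (P + r%:R) / Q11) / (P + (3 * r)%:R).

Let s13 : ser p (P + (3 * r)%:R) (- (1 / 2)) (3 / 2) 0.
Proof. by apply: serl; zp; rewrite natrM rE; field. Qed.
Let s12 : ser p (P + (2 * r)%:R) (- (1 / 3)) (4 / 3) 0.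
Proof. by apply: serl; zp; rewrite natrM rE; field. Qed.
Let s11 : ser p (P + r%:R) (- (1 / 6)) (7 / 6) 0.
Proof. by apply: serl; zp; rewrite rE; field. Qed.

Let uh : punit p (- (1 / 2)).
Proof. by apply: punitN; rewrite mul1r; apply: punitV; exact: (@u_of 2). Qed.

Let serI c k a1 a2 : ser p (Q c k) 1 a1 a2 -> ser p (Q c k)^-1 1 (- a1) (a1 ^+ 2 - a2).
Proof. by move=> s; apply: (ser_eq (serV u1 s)); [reflexivity | field | field | field]. Qed.

Let serJ1 : ser p J1 1 (- 2 - 4 / 3 * q2 - c1)
  (- 6 + 4 / 3 * q2 + 2 * q2 ^+ 2 + 4 / 3 * c2 + 2 * c1 + 4 / 3 * c1 * q2 + c1 ^+ 2 / 2).
Proof.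
have i12 := serI (serQ2 (rpred1 _)); have i11 := serI (serQ1 (rpred1 _)).
have := serM (serM (serQ3 (rpred1 _)) (serD (serM s12 i12) (serM s11 i11))) (serV uh s13).
by move/ser_eq; apply; [reflexivity | field | field | field].
Qed.

Let J2 := Q23 * ((2 * P + (2 * r)%:R) * (2 * P + (2 * r)%:R - 1) / Q22
   + (2 * P + r%:R) * (2 * P + r%:R - 1) / Q21
   + 2 * wol * ((P + (2 * r)%:R) / Q12) * ((P + r%:R) / Q11))
   / ((2 * P + (3 * r)%:R) * (2 * P + (3 * r)%:R - 1)).

Let serJ2 : ser p J2 1 (- 4 - 8 / 3 * q2 - 2 * c1)
  (- (52 / 3) + 56 / 9 * q2 + 172 / 27 * q2 ^+ 2 + 41 / 9 * c2 + 8 * c1 + 16 / 3 * c1 * q2 + 2 * c1 ^+ 2).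
Proof.
have z2 : 2 \in Z_ by zp.
have t3 : ser p (2 * P + (3 * r)%:R) (- (1 / 2)) (5 / 2) 0 by apply: serl; zp; rewrite natrM rE; field.
have t3' : ser p (2 * P + (3 * r)%:R - 1) (- (3 / 2)) (5 / 2) 0 by apply: serl; zp; rewrite natrM rE; field.
have t2 : ser p (2 * P + (2 * r)%:R) (- (1 / 3)) (7 / 3) 0 by apply: serl; zp; rewrite natrM rE; field.
have t2' : ser p (2 * P + (2 * r)%:R - 1) (- (4 / 3)) (7 / 3) 0 by apply: serl; zp; rewrite natrM rE; field.
have t1 : ser p (2 * P + r%:R) (- (1 / 6)) (13 / 6) 0 by apply: serl; zp; rewrite rE; field.
have t1' : ser p (2 * P + r%:R - 1) (- (7 / 6)) (13 / 6) 0 by apply: serl; zp; rewrite rE; field.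
have u34 : punit p (- (1 / 2) * - (3 / 2)).
  apply: punitM uh _; apply: punitN; apply: punitM; first exact: (@u_of 3).
  by apply: punitV; exact: (@u_of 2).
have i12 := serI (serQ2 (rpred1 _)); have i11 := serI (serQ1 (rpred1 _)).
have i22 := serI (serQ2 z2); have i21 := serI (serQ1 z2).
have S := serM (serM (serQ3 z2) (serD (serD (serM (serM t2 t2') i22) (serM (serM t1 t1') i21))
   (serM (serM (serM (ser_const z2) ser_wol) (serM s12 i12)) (serM s11 i11)))) (serV u34 (serM t3 t3')).
by apply: (ser_eq S); [reflexivity | field | field | field].
Qed.

Let eE : e%:R = (P ^+ 2 - 1) / 2 :> rat.
Proof.
have E : (2 * e + 1 = p ^ 2)%N.
  have : (2 %| p ^ 2 - 1)%N.
    by rewrite pr (_ : (6 * r + 1) ^ 2 - 1 = (6 * r * (3 * r + 1)) * 2)%N ?dvdn_mull // -mulnn; nia.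
  have : (0 < p ^ 2)%N by rewrite expn_gt0 prime_gt0 ?p_pr.
  by rewrite /e; move: (p ^ 2)%N => n; clear; lia.
by rewrite -natrX -E natrD natrM; field.
Qed.

Let bE : b%:R = e%:R * (e%:R - 1) / 2 :> rat.
Proof.
have := bin_ffact e 2; rewrite -/b (_ : 2`! = 2)%N // ffactnS ffactn1 => H.
have : b%:R * 2 = e%:R * e.-1%:R :> rat by rewrite -!natrM H.
have e0 : (0 < e)%N by have := p_gt3; rewrite /e -mulnn; nia.
by rewrite -subn1 natrB // => <-; field.
Qed.

Lemma kap_ser : exists2 Y, kap = C * Y &
  ser p Y (- 1) (- (2 / 3) * q2 - c1 / 2)
   (q2 ^+ 2 / 9 - c2 / 24 - c1 * q2 / 3 - c1 ^+ 2 / 8).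
Proof.
exists ((P - 1) * ((1 - e%:R + b%:R) + (e%:R - 2 * b%:R) * J1 + b%:R * J2)).
  rewrite /kap jbin0 jbin1 jbin2 -/J1 -/J2 natrM rE; set X := 1 - _ + _; set Z := _ - _ * b%:R.
  by field.
have z2 : 2 \in Z_ by zp.
have se : ser p e%:R (- (1 / 2)) 0 (1 / 2).
  have za : - (1 / 2) \in Z_ by zp.
  have zb : 1 / 2 \in Z_ by zp.
  by apply: (ser_eq (ser_exact za (rpred0 Z_) zb)); [rewrite eE; field | reflexivity | reflexivity | reflexivity].
have sb : ser p b%:R (3 / 8) 0 (- (1 / 2)).
  have h2 : 2^-1 \in Z_ by zp.
  have S := serM (serM se (serD se (serN (ser_const (rpred1 Z_))))) (ser_const h2).
  by apply: (ser_eq S); [rewrite bE; reflexivity | field | field | field].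
have s1 := ser_const (rpred1 Z_).
have sP : ser p (P - 1) (- 1) 1 0 by apply: serl; zp; ring.
have S := serM sP (serD (serD (serD (serD s1 (serN se)) sb)
  (serM (serD se (serN (serM (ser_const z2) sb))) serJ1)) (serM sb serJ2)).
by apply: (ser_eq S); [reflexivity | field | field | field].
Qed.

Let F := hsum p.

Let r3 : (r < 3 * r)%N. Proof. by have := r0; lia. Qed.

(** Both sides are C^2 times a series. In terms of q2, c1 and c2 the series W of [hsum_even_third]
    and the square of Y from [kap_ser] have the same coefficients. *)
Let hsum_kap : F (P * - 3^-1 + (2 * r)%:R) ==[3] kap ^+ 2.
Proof.
have [W /= sW EW] := hsum_even_third pE r3.
have [Y -> sY] := kap_ser.
apply: cg_trans EW _; rewrite exprMn; apply: cgMl; first by zp.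
rewrite -/q2 -/c1 -/c2 in sW; set f1 := (4 * _ - _) / 3 + _ in sW.
have e1 : f1 ==[2] (c1 + 4 / 3 * q2) + P * (- (q2 ^+ 2 - c2 / 2) / 3).
  have -> : c1 + 4 / 3 * q2 + P * (- (q2 ^+ 2 - c2 / 2) / 3) =
     (4 * c1 - (c1 - 2 * q2 + P * (q2 ^+ 2 - c2 / 2))) / 3 + 2 / 3 * q2 by field.
  apply: cgD (cg_refl _ _ _); apply: cgMr; first by zp.
  exact: cgB (cg_refl _ _ _) h1r.
have f1E : f1 ==[1] c1 + 4 / 3 * q2.
  apply: cg_trans (cgW (isT : 1 <= 2)%N e1) _.
  by exists (- (q2 ^+ 2 - c2 / 2) / 3); zp; rewrite expr1.
have e2 : f1 ^+ 2 / 2 + 8 / 9 * c2 - 7 / 36 * harm 2 r - q2 ^+ 2 / 3 ==[1]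
   (c1 + 4 / 3 * q2) ^+ 2 / 2 + 8 / 9 * c2 - 7 / 36 * (5 * c2) - q2 ^+ 2 / 3.
  apply: cgB (cg_refl _ _ _); apply: cgB; last by apply: cgMl h2r; zp.
  apply: cgD (cg_refl _ _ _); apply: cgMr; first by zp.
  by apply: cgX => //; zp.
have s2 := ser_cg2 sW _ e2; have {}s2 := s2 (ltac:(zp)).
have s3 := ser_cg1 s2 _ _ e1; have {}s3 := s3 (ltac:(zp)) (ltac:(zp)).
apply: ser_cg s3 _; have S := serM sY sY.
by apply: (ser_eq S); [reflexivity | ring | field | field].
Qed.

Lemma central_sum_case1 (x y : int) : p%:Z = x ^+ 2 + 3 * y ^+ 2 ->
  central_sum p ==[3] 8 * x%:~R ^+ 2 - 4 * P + (9 * P ^+ 2) / (8 * x%:~R ^+ 2).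
Proof.
have r21 : (0 < 2 * r + 1 < p)%N by rewrite pr; have := r0; lia.
move=> xy; have tr := kap_trace xy.
have uC := punit_bin pE r3; have zC := punit_pint uC.
have zCV := punitV_pint uC; have C0 := punit_neq0 uC.
have [Y kY sY] := kap_ser.
have uY : punit p Y by apply: (ser_unit sY); exact: punitN.
have uk : punit p kap by rewrite kY; exact: punitM.
have ug : punit p (kap ^+ 2) by rewrite expr2; exact: punitM.
have zx : x%:~R \in Z_ by zp.
have k2 : kap ^+ 2 ==[1] C ^+ 2.
  have Y1 : Y ==[1] - 1.
    case: sY => _ z1 z2 /(cgW (isT : 1 <= 3)%N) h; apply: cg_trans h _.
    by eexists; [|rewrite -addrA expr1 [P ^+ 2]expr2 -mulrA -mulrDr; reflexivity]; zp.
  rewrite kY exprMn -[X in cg _ _ _ X]mulr1; apply: cgMl; first by zp.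
  by rewrite (_ : 1 = (- 1) ^+ 2 :> rat); [apply: cgX => //; zp | ring].
have E1 : F (- 3^-1) = F (P * - 3^-1 + (2 * r)%:R).
  by congr hsum; rewrite natrM rE; field.
have E2 : F (- 3^-1 + 1) = F (P * - 3^-1 + 1 + (2 * r)%:R).
  by congr hsum; rewrite natrM rE; field.
have odd : F (P * - 3^-1 + 1 + (2 * r)%:R) ==[3] P ^+ 2 * (- 2^-1 * (kap ^+ 2)^-1).
  apply: cg_trans (hsum_odd_third pE r3) _; apply: (@cgMp p 2 1).
  have uC2 : punit p (C ^+ 2) by rewrite expr2; exact: punitM.
  apply: (@cg_trans p 1 (- 2^-1 * (C ^+ 2)^-1)); last first.
    by apply: cgMl; [zp | apply: cgV => //; exact: cg_sym].
  (* Modulo p the square of 2r + 1 is 4/9, which turns the constant -2/9 into -1/2. *)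
  have n3 : (2 * r + 1)%:R = (P + 2) / 3 :> rat by rewrite natrD natrM rE; field.
  have u3 := punit_small r21.
  have n0 := punit_neq0 u3; have z3 := punitV_pint u3.
  exists (C^-1 ^+ 2 * (2 * r + 1)%:R^-1 ^+ 2 * (P + 4) / 18); first by zp.
  have P2 : P + 2 != 0 by apply: contraNneq n0 => e0; rewrite n3 e0 mul0r.
  by rewrite n3; field; rewrite P2 C0.
have := central_sum_hsum p; rewrite -/F E1 E2 => H.
have {}H := cg_trans H (cgB (cgMl (pint_nat p 2) hsum_kap) (cgMl (pint_nat p 13) odd)).
apply: cg_trans H _.
have zg := punit_pint ug; have zgV := punitV_pint ug; have g0 := punit_neq0 ug.
move: (kap ^+ 2) tr ug zg zgV g0 => g tr ug zg zgV g0.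
have X4 : 4 * x%:~R ^+ 2 ==[3] g + 2 * P + P ^+ 2 / g.
  have := cgMr zgV tr; rewrite mulfK // => /eq_cg2; apply; first by [].
  by field.
have u4 : punit p (4 * x%:~R ^+ 2).
  apply: (punit_cg (cgW (isT : 1 <= 3)%N X4)); apply: (punit_cg _ ug).
  by exists (2 + P / g); zp; field.
have X4' : 4 * x%:~R ^+ 2 ==[1] g.
  apply: cg_trans (cgW (isT : 1 <= 3)%N X4) _.
  by exists (2 + P / g); zp; field.
have V4 := cgV u4 ug X4'.
have V5 : P ^+ 2 * (9 / 2 * (4 * x%:~R ^+ 2)^-1) ==[3] P ^+ 2 * (9 / 2 * g^-1).
  by apply: (@cgMp p 2 1); apply: cgMl; zp.
(* Twice [X4] provides 2g + 4p + 2p^2/g and [V5] the missing (9/2)p^2/g; the term 4p is subtracted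
   afterwards. *)
have K := cgD (cgMl (pint_nat p 2) X4) V5.
have x0 : x%:~R != 0 :> rat.
  by have := punit_neq0 u4; rewrite mulf_eq0 negb_or sqrf_eq0 => /andP [].
have {}K := cgD K (cg_refl p 3 (- 4 * P)).
apply: cg_sym; apply: (eq_cg2 K); first by field.
by field.
Qed.

End Case1.

(** * Integrality, and the theorem in terms of [rat_congr] *)

Lemma pint_central_sum (p : prime_gt3) : central_sum p \in pint p.
Proof.
apply: pint_sum_nat => k /andP [_ kp]; have co6 := coprime_p6 p.
rewrite natr1; apply: rpredM; first by zp.
rewrite -!natrX -natrM; apply: pint_inv_nat; rewrite coprimeMr.
rewrite !coprimeXr //; last by apply: (coprime_dvdr _ co6); vm_compute.
by rewrite prime_coprime ?pval_prime // gtnNdvd //; lia.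
Qed.

Lemma rat_congr_cg (p : prime_gt3) n a b :
  a \in pint p -> cg p n a b -> rat_congr p n a b.
Proof.
move=> za ab; have zb : b \in pint p by rewrite -(cg_pint ab).
have pp := pval_prime p; split; rewrite -?pint_p_integral //.
case: ab => c zc ->; exists c; first by rewrite -pint_p_integral.
by rewrite addrC addKr.
Qed.

Theorem theorem9p4 (p : nat) (p_prime : prime p) (p_gt3 : (3 < p)%N) :
  let S : rat := \sum_(0 <= k < p - 1)
    ('C(2 * k, k)%:R ^+ 2 * 'C(3 * k, k)%:R) / (108 ^+ k * (k%:R + 1) ^+ 2) in
  let b : rat := 'C((p - 1) %/ 2, (p - 5) %/ 6)%:R in
  let P : rat := p%:R in
  let q2 : rat := fermat_quotient p 2 in
  let q3 : rat := fermat_quotient p 3 in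
  ((p = 1 %[mod 3])%N -> forall x y : int, p%:Z = x ^+ 2 + 3 * y ^+ 2 ->
     rat_congr p 3 S
       (8 * x%:~R ^+ 2 - 4 * P + (9 * P ^+ 2) / (8 * x%:~R ^+ 2)))
  /\
  ((p = 2 %[mod 3])%N ->
     rat_congr p 3 S
       (- 13 * b ^+ 2 *
          (1 + P * (2 + 4 / 3 * q2 - 3 / 2 * q3)
             + P ^+ 2 * (1 + 8 / 3 * q2 + 2 / 9 * q2 ^+ 2 - 3 * q3
                           - 2 * q2 * q3 + 15 / 8 * q3 ^+ 2
                           + 3 / 4 * (U (p - 3))%:~R))
        - P ^+ 2 * b ^- 2)).
Proof.
pose pp := PrimeGt3 p_prime p_gt3.
have po : odd p by case: (even_prime p_prime) => // p2; have := p_gt3; rewrite p2.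
have po2 : (p %% 2 = 1)%N by rewrite modn2 po.
move=> S b P q2 q3; split=> [p1 x y xy | p2].
  have pr : pp = (6 * (p %/ 6) + 1)%N :> nat by rewrite /=; lia.
  apply: (@rat_congr_cg pp); first exact: pint_central_sum.
  exact: (central_sum_case1 pr xy).
have pr : pp = (6 * ((p - 5) %/ 6) + 5)%N :> nat by rewrite /=; lia.
apply: (@rat_congr_cg pp); first exact: pint_central_sum.
have bE : b = 'C(3 * ((p - 5) %/ 6) + 2, (p - 5) %/ 6)%:R.
  by congr ('C(_, _)%:R); move: pr => /=; lia.
by rewrite bE; exact: (central_sum_case2 pr).
Qed.
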